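(* Let $(T,X)$ be a topologically mixing countable Markov shift, let $\phi:X\to\mathbb{R}$ be a locally Hölder continuous potential (with respect to a fixed $\theta\in(0,1)$), and let $m$ be a Gibbs measure for $\phi$. Then there is a constant $a>0$ such that for every $T$-invariant Borel probability measure $\mu$ on $X$ and every $f\in\mathcal{L}$, $$|m(f)-\mu(f)|\leq a\,\|f\|_{\mathcal{L}}\,\bigl(P_{GS}(\phi)-P_\mu(\phi)\bigr)^{\frac12}.$$
   Context: Let $S$ be a countable set of states and $A=(t_{ij})_{i,j\in S}$ a matrix with entries in $\{0,1\}$ (the transition matrix). The countable Markov shift is $X=\{x=(x_0,x_1,\dots)\in S^{\mathbb{N}_0}: t_{x_ix_{i+1}}=1 \text{ for all } i\ge 0\}$ with the left shift $T:X\to X$, assumed topologically mixing. Cylinders are $[a_0,\dots,a_{n-1}]=\{x\in X: x_i=a_i,\ 0\le i<n\}$. Fix $\theta\in(0,1)$ and the metric $d(x,y)=\theta^{\min\{i:x_i\ne y_i\}}$ for $x\neq y$, $d(x,x)=0$. For $\phi:X\to\mathbb{R}$ put $\phi_n=\phi+\phi\circ T+\dots+\phi\circ T^{n-1}$ and $\mathrm{var}_n\phi=\sup\{\phi(x)-\phi(y): x,y\in X,\ x_i=y_i \text{ for } i<n\}$. $\phi$ is locally Hölder continuous if there is $A_\phi>0$ with $\mathrm{var}_n\phi\le A_\phi\theta^n$ for all $n\ge1$. A $T$-invariant Borel probability measure $m$ on $X$ is a Gibbs measure for $\phi$ if there are constants $C,P$ such that for every cylinder $[a_0,\dots,a_{n-1}]$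 and every $x\in[a_0,\dots,a_{n-1}]$, $\frac1C\le \frac{m([a_0,\dots,a_{n-1}])}{e^{\phi_n(x)-nP}}\le C$. The Gurevich-Sarig pressure is $P_{GS}(\phi)=\lim_{n\to\infty}\frac1n\log\sum_{x\in X,\,T^nx=x}e^{\phi_n(x)}1_{[s]}(x)$ for any $s\in S$ (the limit exists and is independent of $s$; it is finite when a Gibbs measure exists). For a measure $\mu$, $\mu(g)=\int g\,d\mu$. The metric pressure of a $T$-invariant probability measure $\mu$ is $P_\mu(\phi)=\mu(I_\mu+\phi)\in[-\infty,\infty)$, where $I_\mu(x)=-\log \mu_x^{\xi_1^\infty}([x_0])$ is the information function, $\xi=\{[s]\}_{s\in S}$, $\xi_1^\infty$ is the $\sigma$-algebra generated by $T^{-j}\xi$, $j\ge1$, and $\mu_x^{\xi_1^\infty}$ are the conditional measures of $\mu$ given $\xi_1^\infty$. (The function $I_\mu+\phi$ is one-sided integrable in this setting; when $-\mu(\phi)<\infty$ one has $P_\mu(\phi)=h_\mu(T)+\mu(\phi)$ with $h_\mu(T)$ the Kolmogorov–Sinai entropy.) For continuous $f:X\to\mathbb{R}$ let $\|f\|_\theta=\sup\{|f(x)-f(y)|/d(x,y): x\neq y,\ x_0=y_0\}$ and $\|f\|_{\mathcal{L}}=\|f\|_\theta+\|f\|_\infty$; $\mathcal{L}$ is the Banach space of those $f$ with $\|f\|_{\mathcal{L}}<\infty$. *)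

(* Defs.v *)
From HB Require Import structures.
From mathcomp Require Import all_boot all_order all_algebra.
From mathcomp Require Import all_classical all_reals all_analysis.
From mathcomp Require Import measurable_realfun.

Set Implicit Arguments.
Unset Strict Implicit.
Unset Printing Implicit Defensive.

Import Order.TTheory GRing.Theory Num.Theory.
Import numFieldNormedType.Exports.

Local Open Scope classical_set_scope.
Local Open Scope ring_scope.

Definition admissible (S : countType) (t : rel S) :
    set (prod_topology (fun _ : nat => discrete_topology S)) :=
  [set x | forall i, t (x i) (x i.+1)].

(* Measurable types are pointed in the library, hence the nonemptiness proof
   [X0]: it is only used to provide a default point. Any shift that carries a
   probability measure is nonempty, so this is not a restriction. *)
Definition markov_shift (S : countType) (t : rel S)
  (X0 : admissible t !=set0) : Type := admissible t.

Section instances.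
Context (S : countType) (t : rel S) (X0 : admissible t !=set0).

(* Subspace topology of the product topology, [S] being discrete; see
   [shift_openP] below for the comparison with the metric. *)
HB.instance Definition _ :=
  Topological.copy (markov_shift X0) (set_type (admissible t)).

Definition markov_shift_point : markov_shift X0 :=
  exist _ (sval (cid X0)) (mem_set (svalP (cid X0))).

HB.instance Definition _ :=
  isPointed.Build (markov_shift X0) markov_shift_point.

HB.instance Definition _ := Measurable.copy (markov_shift X0)
  (g_sigma_algebraType (@open (markov_shift X0))).

End instances.

Definition topologically_mixing (X : topologicalType) (T : X -> X) :=
  forall U V : set X, open U -> open V -> U !=set0 -> V !=set0 ->
    exists N, forall n, (N <= n)%N -> U `&` iter n T @^-1` V !=set0.

Definition invariant_measure d (X : measurableType d) (R : realType) (T : X -> X)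
    (mu : probability X R) :=
  forall A, measurable A -> mu (T @^-1` A) = mu A.

(* Conditional measures of [mu] given the sub-sigma-algebra [F]. *)
Definition is_conditional_measures d (X : measurableType d) (R : realType)
    (mu : probability X R) (F : set (set X)) (k : X -> probability X R) :=
  forall A, measurable A ->
    (forall B : set (\bar R), measurable B -> F ((fun x => k x A) @^-1` B)) /\
    (forall B, F B -> mu (A `&` B) = \int[mu]_(x in B) k x A)%E.

(* Two such families agree mu-almost everywhere on each event; one of them is
   chosen. They exist on a countable Markov shift, which is standard Borel; the
   default value [fun=> mu] is immaterial. *)
Definition conditional_measures d (X : measurableType d) (R : realType)
    (mu : probability X R) (F : set (set X)) : X -> probability X R :=
  xget (fun=> mu) [set k | is_conditional_measures mu F k].

Section markov_shift.
Context (S : countType) (t : rel S) (X0 : admissible t !=set0).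
Local Notation X := (markov_shift X0).

Definition state_at (x : X) : nat -> S := sval x.

Lemma shift_subproof (x : X) : (fun i => state_at x i.+1) \in admissible t.
Proof. by case: x => x xP; apply: mem_set => i; exact: (set_mem xP). Qed.

Definition left_shift (x : X) : X :=
  exist (fun y => y \in admissible t) _ (shift_subproof x).

Definition cylinder (a : seq S) : set X := [set x | mkseq (state_at x) (size a) = a].

Context (R : realType).

Definition shift_dist (theta : R) (x y : X) : R :=
  if pselect (exists i, state_at x i != state_at y i) is left xy
  then theta ^+ ex_minn xy else 0.

Definition birkhoff (phi : X -> R) (n : nat) (x : X) : R :=
  \sum_(i < n) phi (iter i left_shift x).

Definition agree_upto (n : nat) (x : X) : set X :=
  [set y | forall i, (i < n)%N -> state_at y i = state_at x i].

Lemma shift_nbhsP (x : X) (U : set X) :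
  nbhs x U <-> exists n, agree_upto n x `<=` U.
Proof.
split=> [|[n nU]].
  rewrite nbhsE => -[_ [[W oW <-] /= Wx] WU].
  pose H : set_system (prod_topology (fun _ : nat => discrete_topology S)) :=
    filter_from setT
      (fun n => [set y | forall i, (i < n)%N -> y i = state_at x i]).
  have FH : Filter H.
    apply: filter_from_filter; first by exists 0%N.
    move=> i j _ _; exists (maxn i j) => // y /= yx.
    by split=> k ki; apply: yx; rewrite leq_max ki ?orbT.
  have Hx : H --> (state_at x : prod_topology (fun _ : nat => discrete_topology S)).
    apply/cvg_sup => i A; rewrite (@nbhsE (initial_topology _)).
    move=> -[_ [[V oV <-] /= Vx] VA].
    by exists i.+1 => // y yx; apply: VA => /=; rewrite yx.
  have [n _ nW] : H W by apply: Hx; apply: open_nbhs_nbhs.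
  by exists n => y yx; apply: WU; apply: nW.
have state_atc i : continuous (fun y : X => state_at y i : discrete_topology S).
  move=> y; apply: (@continuous_comp _ (prod_topology
    (fun _ : nat => discrete_topology S)) _ state_at (fun z => z i)).
    exact: (@initial_continuous _ _ (@set_val _ (admissible t))).
  exact: (@proj_continuous _ (fun _ : nat => discrete_topology S) i).
apply: (filterS nU) => {nU}.
elim: n => [|n IHn]; first by apply: filterS (@filterT _ (nbhs x) _).
have := state_atc n x _ (discrete_set1 _).
move: IHn; apply: filterS2 => y yx ynx i.
by rewrite ltnS leq_eqVlt => /orP[/eqP ->//|/yx].
Qed.

Lemma shift_openP (theta : R) (U : set X) : 0 < theta < 1 ->
  open U <-> forall x, U x -> exists2 e, 0 < e & [set y | shift_dist theta x y < e] `<=` U.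
Proof.
move=> /andP[t0 t1]; rewrite openE; split=> [oU x /oU|oU x /oU].
  move=> /shift_nbhsP[n nU]; exists (theta ^+ n); first exact: exprn_gt0.
  move=> y /= xy; apply: nU => i ni; apply/eqP/negPn/negP => yxi.
  move: xy; rewrite /shift_dist; case: pselect => [h|[]]; last first.
    by exists i; rewrite eq_sym.
  case: ex_minnP => j _ /(_ i); rewrite eq_sym => /(_ yxi) ji.
  apply/negP; rewrite -leNgt; apply: ler_wiXn2l; [exact: ltW|exact: ltW|].
  exact/ltnW/(leq_ltn_trans ji).
move=> [e e0 eU]; apply/shift_nbhsP.
have [n ne] : exists n, theta ^+ n < e.
  have : theta ^+ n @[n --> \oo] --> (0 : R).
    by apply: cvg_expr; rewrite gtr0_norm.
  move=> /cvgrPdist_lt/(_ _ e0)[n _ /(_ n (leqnn n))].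
  by rewrite sub0r normrN gtr0_norm ?exprn_gt0 => // ?; exists n.
exists n => y yx; apply: eU => /=; rewrite /shift_dist; case: pselect => // h.
case: ex_minnP => j xyj _; apply: le_lt_trans ne.
apply: ler_wiXn2l; [exact: ltW|exact: ltW|rewrite leqNgt; apply/negP => /yx].
by apply/eqP; rewrite eq_sym.
Qed.

Local Open Scope ereal_scope.

Definition var_n (phi : X -> R) (n : nat) : \bar R :=
  ereal_sup [set (phi xy.1 - phi xy.2)%:E | xy in
    [set xy : X * X | agree_upto n xy.1 xy.2]].

Definition locally_holder (theta : R) (phi : X -> R) :=
  exists2 A : R, (0 < A)%R &
    forall n, (1 <= n)%N -> var_n phi n <= (A * theta ^+ n)%:E.

Definition gibbs_measure (phi : X -> R) (m : probability X R) :=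
  invariant_measure left_shift m /\
  exists C P : R, (0 < C)%R /\
    forall (a : seq S) (x : X), a != [::] -> cylinder a x ->
      (C^-1)%:E <=
        m (cylinder a) * (expR (birkhoff phi (size a) x - (size a)%:R * P))^-1%:E
      <= C%:E.

Definition gurevich_pressure (phi : X -> R) (s : S) : \bar R :=
  limn (fun n => (n%:R^-1)%:E * lne
    (\esum_(x in [set x | iter n left_shift x = x /\ cylinder [:: s] x])
       (expR (birkhoff phi n x))%:E)).

(* The sigma-algebra xi_1^oo generated by T^-j xi, j >= 1, where xi is the
   partition into the cylinders [s]. *)
Definition future_sigma_algebra : set (set X) :=
  <<s [set A | exists j s, (1 <= j)%N /\ A = iter j left_shift @^-1` cylinder [:: s]] >>.

Definition information (mu : probability X R) (x : X) : \bar R :=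
  - lne (conditional_measures mu future_sigma_algebra x
           (cylinder [:: state_at x 0%N])).

Definition metric_pressure (mu : probability X R) (phi : X -> R) : \bar R :=
  \int[mu]_x (information mu x + (phi x)%:E).

(* The maximum with 0 gives the value 0 to the supremum over the empty family,
   which occurs when each cylinder [s] has at most one point. *)
Definition theta_seminorm (theta : R) (f : X -> R) : \bar R :=
  maxe 0 (ereal_sup [set (`|f xy.1 - f xy.2| / shift_dist theta xy.1 xy.2)%:E | xy in
    [set xy : X * X | xy.1 <> xy.2 /\ state_at xy.1 0%N = state_at xy.2 0%N]]).

Definition sup_norm (f : X -> R) : \bar R := ereal_sup [set `|f x|%:E | x in setT].

Definition L_norm (theta : R) (f : X -> R) : \bar R :=
  theta_seminorm theta f + sup_norm f.

Definition L_space (theta : R) : set (X -> R) :=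
  [set f | continuous f /\ L_norm theta f < +oo].

End markov_shift.

(* Main.v *)
(* Let [P] be the constant of the Gibbs property and [L f x] the sum of
   [exp (phi y - P) * f y] over the preimages [y] of [x]. Comparison with [m] on
   cylinders bounds [L^n 1] above and below uniformly in [n]. Mixing gives a
   minorization of the iterates of [L], hence an exponential contraction of
   oscillations, an eigenfunction [L h = h], and exponentially fast convergence
   of [Q^n f] to a constant, for the Markov operator [Q f = L (h f) / h] and [f]
   in the space of the theorem. The limit is [m f]: by the Gibbs property
   [\int ln u dm <= \int ln (Q u) dm] for [u >= 1]; iterate, and apply this to
   small perturbations of the constant 1.

   For an invariant [mu], let [p x] be the conditional probability of the letter
   [x_0] given the future, and [r = exp (phi - P) * h / (h \o T) / p]. Then
   [mu (r f) <= mu (Q f)] for [f >= 0], so that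
   [|mu f - mu (Q f)| <= osc f * mu (1 - r)^+ <= 2 * osc f * D^(1/2)], where
   [D = - mu (ln r)] equals [P - P_mu phi]. Applying this to [Q^k f] and summing
   the geometric series of oscillations bounds [|mu f - m f|]. Finally, counting
   periodic points with the Gibbs property shows that [P_GS phi = P]. *)
Require Import Defs.
From mathcomp Require Import all_boot all_order all_algebra.
From HB Require Import structures.
From mathcomp Require Import all_classical all_reals all_analysis.
From mathcomp Require Import measurable_realfun ring lra.
Import Order.TTheory GRing.Theory Num.Theory.
Import numFieldNormedType.Exports.
Local Open Scope classical_set_scope.
Local Open Scope ring_scope.
Local Open Scope ereal_scope.

Set Implicit Arguments.
Unset Strict Implicit.
Unset Printing Implicit Defensive.

(** * Words and cylinders *)

(** The alphabet may be infinite and [X] need not be locally compact, so neither an eigenfunction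
    nor an eigenmeasure can be drawn from a compactness argument, and mixing alone does not provide
    finitely many letters through which every point is entered with substantial weight. The Gibbs
    measure replaces compactness: its finite total mass makes the weights of the letters uniformly
    summable, so finitely many letters carry a fixed share of [L 1] at every point. [m] is
    [T]-invariant but is not known to be fixed by the dual of [L] or of [Q]; it is only comparable
    with its images, with a constant independent of [n]. This gives bounds but does not identify the
    limit of [Q^n f]; the inequality for logarithms does, since a bounded factor disappears after
    division by [n]. The contraction is stated for non-stationary sequences because it is used
    twice: on [L^(n+1) 1 / L^n 1], before an eigenfunction is available, and then on [Q^n f]. The
    exponent 1/2 is that of Pinsker's inequality. It survives the summation because the square root
    is the same at each step and is multiplied by oscillations that decay geometrically. *)

Section shift_space.
Context (S : countType) (t : rel S) (X0 : admissible t !=set0).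
Local Notation X := (markov_shift X0).
Local Notation T := (@left_shift S t X0).
Local Notation cyl := (@cylinder S t X0).
Implicit Types (x y z : X) (s : S) (a b w : seq S).

Lemma state_admissible x i : t (state_at x i) (state_at x i.+1).
Proof. by case: x => f fP; exact: (set_mem fP i). Qed.

Lemma state_at_inj x y : state_at x =1 state_at y -> x = y.
Proof. by move=> xy; apply: val_inj; exact/funext. Qed.

Definition of_states (f : nat -> S) : X :=
  if pselect (admissible t f) is left fP then exist _ f (mem_set fP) else point.

Lemma of_statesK (f : nat -> S) : admissible t f -> state_at (of_states f) = f.
Proof. by rewrite /of_states; case: pselect. Qed.

Lemma state_iter_shift n x i : state_at (iter n T x) i = state_at x (n + i).
Proof.
elim: n x i => [//|n IHn] x i.
by rewrite iterSr IHn /state_at/= addSn.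
Qed.

Definition allowed s x := t s (state_at x 0).

(* A junk point when [s] cannot precede [x]. *)
Definition prepend s x : X :=
  of_states (fun i => if i is j.+1 then state_at x j else s).

Lemma state_prepend s x : allowed s x ->
  state_at (prepend s x) = fun i => if i is j.+1 then state_at x j else s.
Proof.
by move=> sx; rewrite of_statesK// => -[|i] //; exact: state_admissible.
Qed.

Lemma shift_prepend s x : allowed s x -> T (prepend s x) = x.
Proof.
move=> sx; apply: state_at_inj => i.
by rewrite -[T _]/(iter 1 T _) state_iter_shift state_prepend.
Qed.

Lemma allowed_shift x : allowed (state_at x 0) (T x).
Proof. exact: (state_admissible x 0). Qed.

Lemma prepend_shift x : prepend (state_at x 0) (T x) = x.
Proof.
apply: state_at_inj => i; rewrite state_prepend; last exact: allowed_shift.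
by case: i => [//|i]; rewrite -[T _]/(iter 1 T _) state_iter_shift.
Qed.

(** The letter [x_n] is dropped in favour of [y_0]; when the two are equal, the junction is one of
    the transitions of [x], hence admissible. *)
Definition splice n x y : X :=
  of_states (fun i => if (i < n)%N then state_at x i else state_at y (i - n)).

Lemma state_splice n x y : state_at x n = state_at y 0 ->
  state_at (splice n x y) =
    fun i => if (i < n)%N then state_at x i else state_at y (i - n).
Proof.
move=> xy; rewrite of_statesK// => i /=; case: (ltnP i.+1 n) => [ni|].
  by rewrite (ltnW ni); exact: state_admissible.
rewrite leq_eqVlt => /orP[/eqP ni|].
  by rewrite -ni subnn -xy ni ltnSn; exact: state_admissible.
by rewrite ltnS => ni; rewrite ltnNge ni/= subSn//; exact: state_admissible.
Qed.

Lemma shift_splice n x y : state_at x n = state_at y 0 ->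
  iter n T (splice n x y) = y.
Proof.
move=> xy; apply: state_at_inj => i.
by rewrite state_iter_shift state_splice// ltnNge leq_addr/= addKn.
Qed.

Definition word n x : seq S := mkseq (state_at x) n.

Lemma agree_wordP n x y :
  agree_upto n x y <-> word n y = word n x.
Proof.
split=> [xy|/(congr1 (fun w => nth (state_at x 0) w)) xy i ni].
  by apply/eq_in_map => i; rewrite mem_iota => /andP[_ /xy].
by have := congr1 (fun f => f i) xy; rewrite !nth_mkseq.
Qed.

Lemma agree_sym n x y : agree_upto n x y -> agree_upto n y x.
Proof. by move=> xy i /xy. Qed.

Lemma agree_le n k x y : (k <= n)%N -> agree_upto n x y -> agree_upto k x y.
Proof. by move=> kn xy i ik; apply: xy; exact: leq_trans kn. Qed.

Lemma agree_splice n x y : state_at x n = state_at y 0 ->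
  agree_upto n x (splice n x y).
Proof. by move=> xy i ni; rewrite state_splice// ni. Qed.

Lemma agree_allowed k s x y : (0 < k)%N -> agree_upto k x y ->
  allowed s y = allowed s x.
Proof. by move=> k0 xy; rewrite /allowed xy. Qed.

Lemma agree_prepend k s x y : allowed s x -> (0 < k)%N -> agree_upto k x y ->
  agree_upto k.+1 (prepend s x) (prepend s y).
Proof.
move=> sx k0 xy [|i] ik; rewrite !state_prepend ?(agree_allowed s k0 xy)//.
exact: xy.
Qed.

Lemma agree_shift k x y : agree_upto k.+1 x y -> agree_upto k (T x) (T y).
Proof. by move=> xy i ik; have := xy i.+1 ik. Qed.

Lemma cylinderP a x : cyl a x <-> word (size a) x = a.
Proof. by []. Qed.

Lemma size_word n x : size (word n x) = n.
Proof. exact: size_mkseq. Qed.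

Lemma cylinder_word n x : cyl (word n x) x.
Proof. by apply/cylinderP; rewrite size_word. Qed.

Lemma cylinder_wordE n x y : cyl (word n x) y <-> agree_upto n x y.
Proof. by rewrite cylinderP size_word agree_wordP. Qed.

Lemma cylinder1 s x : cyl [:: s] x <-> state_at x 0 = s.
Proof. by split=> [[]//|<-]. Qed.

Lemma word_cat n k x : word (n + k) x = word n x ++ word k (iter n T x).
Proof.
rewrite /word /mkseq iotaD map_cat add0n; congr (_ ++ _).
rewrite -{1}[n]addn0 iotaDl -map_comp.
by apply/eq_map => i /=; rewrite state_iter_shift.
Qed.

Lemma cylinder_cat a b x :
  cyl (a ++ b) x <-> cyl a x /\ cyl b (iter (size a) T x).
Proof.
rewrite !cylinderP size_cat word_cat; split=> [/eqP|[-> ->]//].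
by rewrite eqseq_cat ?size_word// => /andP[/eqP -> /eqP ->].
Qed.

Lemma cylinder_agree a x y : cyl a x -> cyl a y -> agree_upto (size a) x y.
Proof. by rewrite agree_wordP !cylinderP => -> ->. Qed.

Lemma agree_cylinder a x y : agree_upto (size a) x y -> cyl a x -> cyl a y.
Proof. by rewrite agree_wordP !cylinderP => ->. Qed.

Lemma open_agree (A : set X) :
  (forall x, A x -> exists k, agree_upto k x `<=` A) -> open A.
Proof. by move=> hA; rewrite openE => x /hA ?; exact/shift_nbhsP. Qed.

Lemma agree_open (A : set X) x : open A -> A x ->
  exists k, agree_upto k x `<=` A.
Proof. by move=> oA Ax; apply/shift_nbhsP; exact: open_nbhs_nbhs. Qed.

Lemma open_measurable_shift (A : set X) : open A -> measurable A.
Proof. by move=> oA; exact: sub_sigma_algebra. Qed.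

Lemma measurable_agree (A : set X) :
  (forall x, A x -> exists k, agree_upto k x `<=` A) -> measurable A.
Proof. by move=> /open_agree; exact: open_measurable_shift. Qed.

Lemma open_cylinder a : open (cyl a).
Proof. by apply: open_agree => x ax; exists (size a) => y /agree_cylinder; apply. Qed.

Lemma measurable_cylinder a : measurable (cyl a).
Proof. apply: open_measurable_shift; exact: open_cylinder. Qed.

Lemma measurable_fun_agree d (Y : measurableType d) (f : X -> Y) :
  (forall x, exists k, forall y, agree_upto k x y -> f y = f x) ->
  measurable_fun setT f.
Proof.
move=> hf _ B mB; rewrite setTI; apply: measurable_agree => x Bx.
by have [k xk] := hf x; exists k => y /xk; rewrite /preimage/= => ->.
Qed.

Lemma measurable_fun_continuous (R : realType) (f : X -> R) :
  continuous f -> measurable_fun setT f.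
Proof.
move=> cf; apply: (measurability _ (RGenOpens.measurableE R)).
move=> _ [_ [u [v ->]] <-]; rewrite setTI; apply: open_measurable_shift.
by apply: open_comp => [y _|]; [exact: cf|exact: interval_open].
Qed.

Lemma continuous_agree (R : realType) (f : X -> R) :
  (forall x e, (0 < e)%R ->
    exists k, forall y, agree_upto k x y -> (`|f x - f y| < e)%R) ->
  continuous f.
Proof.
move=> hf x; apply: (proj2 (@cvgrPdist_lt R R X _ (nbhs_filter x) _ _)) => e e0.
apply/shift_nbhsP.
by have [k xk] := hf x e e0; exists k => y /xk.
Qed.

Lemma agree_continuous (R : realType) (f : X -> R) x e : continuous f ->
  (0 < e)%R -> exists k, forall y, agree_upto k x y -> (`|f x - f y| < e)%R.
Proof.
move=> /(_ x) /(proj1 (@cvgrPdist_lt R R X _ (nbhs_filter x) _ _))/(_ e)/[apply].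
move=> /shift_nbhsP[k xk].
by exists k => y /xk.
Qed.

Lemma measurable_fun_shift_open (f : X -> X) :
  (forall A, open A -> open (f @^-1` A)) -> measurable_fun setT f.
Proof.
move=> hf; apply: (@measurability _ _ _ _ _ f (@open X)) => //.
by move=> _ [A oA <-]; rewrite setTI; by apply: open_measurable_shift; exact: hf.
Qed.

Lemma measurable_left_shift : measurable_fun setT T.
Proof.
apply: measurable_fun_shift_open => A oA.
apply: open_agree => x Ax; have [k kA] := agree_open oA Ax.
by exists k.+1 => y /agree_shift/kA.
Qed.

Lemma measurable_iter_shift n : measurable_fun setT (iter n T).
Proof.
elim: n => [|n IHn]; first exact: measurable_id.
exact: (measurableT_comp measurable_left_shift).
Qed.

Lemma measurable_preimage_iter n (A : set X) :
  measurable A -> measurable (iter n T @^-1` A).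
Proof.
by move=> mA; have := measurable_iter_shift n measurableT mA; rewrite setTI.
Qed.

Lemma measurable_prepend s : measurable_fun setT (prepend s).
Proof.
apply: measurable_fun_shift_open => A oA.
apply: open_agree => x Ax; have [sx|/negP sx] := boolP (allowed s x).
  have [k kA] := agree_open oA Ax; exists k.+1 => y xy; apply: kA.
  exact: (agree_le (leqW (leqnSn k)) (agree_prepend sx _ xy)).
(* Where [s] cannot precede [x], [prepend s] is the default point on the whole one-letter cylinder
   of [x], hence locally constant. *)
exists 1%N => y xy /=; suff -> : prepend s y = prepend s x by [].
have nadm z : ~ allowed s z -> prepend s z = point.
  move=> nsz; rewrite /prepend /of_states; case: pselect => //= zP.
  by exfalso; apply: nsz; exact: (zP 0%N).
by rewrite !nadm// (agree_allowed s _ xy).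
Qed.

(** Indexed by codes in [nat], with the empty set at codes of no state, so that countable additivity
    applies directly to this partition of [X]. *)
Definition state_cylinder (i : nat) : set X :=
  if @pickle_inv S i is Some s then cyl [:: s] else set0.

Lemma measurable_state_cylinder i : measurable (state_cylinder i).
Proof.
rewrite /state_cylinder; case: pickle_inv => // s; exact: measurable_cylinder.
Qed.

Lemma state_cylinderP i x :
  state_cylinder i x <-> i = pickle (state_at x 0).
Proof.
split=> [|->]; last by rewrite /state_cylinder pickleK_inv; exact/cylinder1.
have := @pickle_invK S i; rewrite /state_cylinder.
by case: (@pickle_inv S i) => //= s <- /cylinder1 <-.
Qed.

Lemma trivIset_state_cylinder : trivIset setT state_cylinder.
Proof.
apply/trivIsetP => i j _ _; apply: contra_neqP => /eqP/set0P[x []].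
by move=> /state_cylinderP -> /state_cylinderP ->.
Qed.

Lemma bigcup_state_cylinder : \bigcup_i state_cylinder i = setT.
Proof.
apply/seteqP; split => // x _; exists (pickle (state_at x 0)) => //.
exact/state_cylinderP.
Qed.

Lemma measure_state_cylinder (R : realType) (mu : {measure set X -> \bar R})
    (A : set X) : measurable A ->
  \sum_(i <oo) mu (state_cylinder i `&` A) = mu A.
Proof.
move=> mA; rewrite -[in RHS](setTI A) -bigcup_state_cylinder setI_bigcupl.
rewrite measure_bigcup//; first by apply: eq_eseriesl => i; rewrite in_setT.
- by move=> i _; apply: measurableI => //; exact: measurable_state_cylinder.
- by apply: trivIset_setIr; exact: trivIset_state_cylinder.
Qed.

Lemma integral_state_cylinder (R : realType) (mu : {measure set X -> \bar R})
    (f : X -> \bar R) : (forall x, 0 <= f x) -> measurable_fun setT f ->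
  \int[mu]_x f x = \sum_(i <oo) \int[mu]_(x in state_cylinder i) f x.
Proof.
move=> f0 mf; rewrite -[in LHS]bigcup_state_cylinder ge0_integral_bigcup//.
- by move=> i; exact: measurable_state_cylinder.
- exact: measurable_funTS.
- exact: trivIset_state_cylinder.
Qed.

End shift_space.

(** * The transfer operator *)

Section transfer_operator.
Context (S : countType) (t : rel S) (X0 : admissible t !=set0) (R : realType).
Local Notation X := (markov_shift X0).
Local Notation T := (@left_shift S t X0).
Local Notation cyl := (@cylinder S t X0).
Implicit Types (x y z : X) (s : S) (a b w : seq S).
Variable psi : X -> R.

(* The states are enumerated by [pickle_inv], so that the sum over the
   preimages of a point becomes a series over [nat]. *)
Definition weight (i : nat) x : \bar R :=
  if pickle_inv i is Some s then
    if allowed s x then (expR (psi (prepend s x)))%:E else 0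
  else 0.

Definition branch (i : nat) x : X :=
  if @pickle_inv S i is Some s then prepend s x else x.

Definition transfer (f : X -> \bar R) x : \bar R :=
  \sum_(i <oo) weight i x * f (branch i x).

Lemma weight_ge0 i x : 0 <= weight i x.
Proof. by rewrite /weight; case: pickle_inv => // s; case: ifP => // _; rewrite lee_fin expR_ge0. Qed.

Lemma weight_fin_num i x : weight i x \is a fin_num.
Proof. by rewrite /weight; case: pickle_inv => // s; case: ifP. Qed.

Lemma weight_pickle s x : allowed s x ->
  weight (pickle s) x = (expR (psi (prepend s x)))%:E.
Proof. by rewrite /weight pickleK_inv => ->. Qed.

Lemma branch_pickle s x : branch (pickle s) x = prepend s x.
Proof. by rewrite /branch pickleK_inv. Qed.

(** Either a term of the series comes from a true preimage, or its weight is zero and the value at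
    its branch point does not matter. *)
Variant weight_spec i x : X -> \bar R -> Type :=
| WeightPos s of allowed s x & i = pickle s :
    weight_spec i x (prepend s x) (expR (psi (prepend s x)))%:E
| WeightZero : weight_spec i x (branch i x) 0.

Lemma weightP i x : weight_spec i x (branch i x) (weight i x).
Proof.
have := @pickle_invK S i; rewrite /branch /weight.
case E : pickle_inv => [s|] /= is_; last first.
  by have := @WeightZero i x; rewrite /branch E.
case: ifPn => sx; first exact: WeightPos.
by have := @WeightZero i x; rewrite /branch E.
Qed.

Lemma term_ge0 f i x : (forall z, 0 <= f z) -> 0 <= weight i x * f (branch i x).
Proof. by move=> f0; rewrite mule_ge0// weight_ge0. Qed.

Lemma transfer_ge0 f x : (forall z, 0 <= f z) -> 0 <= transfer f x.
Proof. by move=> f0; apply: nneseries_ge0 => i _ _; exact: term_ge0. Qed.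

Lemma le_transfer f g x : (forall z, 0 <= f z) -> (forall z, f z <= g z) ->
  transfer f x <= transfer g x.
Proof.
move=> f0 fg; apply: lee_nneseries => [i _ _|i _]; first exact: term_ge0.
by apply: lee_wpmul2l => //; exact: weight_ge0.
Qed.

Lemma transferD f g x : (forall z, 0 <= f z) -> (forall z, 0 <= g z) ->
  transfer (fun z => f z + g z) x = transfer f x + transfer g x.
Proof.
move=> f0 g0; rewrite -nneseriesD => [|i _ _|i _ _]; try exact: term_ge0.
by apply: eq_eseriesr => i _; rewrite ge0_muleDr.
Qed.

Lemma transferZ (c : R) f x : (forall z, 0 <= f z) ->
  transfer (fun z => c%:E * f z) x = c%:E * transfer f x.
Proof.
move=> f0; rewrite -nneseriesZl => [|i _]; last exact: term_ge0.
by apply: eq_eseriesr => i _; rewrite muleCA.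
Qed.

Lemma transfer_nneseries (f : nat -> X -> \bar R) x :
  (forall k z, 0 <= f k z) ->
  transfer (fun z => \sum_(k <oo) f k z) x = \sum_(k <oo) transfer (f k) x.
Proof.
move=> f0; rewrite -nneseries_interchange => [|k i]; last exact: term_ge0.
apply: eq_eseriesr => i _; have /fineK <- := weight_fin_num i x.
by rewrite -nneseriesZl.
Qed.

(** [T] sends every preimage of [x] back to [x], so a factor that depends on [T z] alone is constant
    along the sum. *)
Lemma transfer_shift (g : X -> R) f x : (forall z, 0 <= f z) ->
  transfer (fun z => (g (T z))%:E * f z) x = (g x)%:E * transfer f x.
Proof.
move=> f0; rewrite -transferZ//; apply: eq_eseriesr => i _.
by case: weightP => [s sx _|]; [rewrite shift_prepend|rewrite !mul0e].
Qed.

Lemma measurable_branch i : measurable_fun setT (branch i).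
Proof.
rewrite /branch; case: pickle_inv => [s|]; first exact: measurable_prepend.
exact: measurable_id.
Qed.

Hypothesis mpsi : measurable_fun setT psi.

Lemma measurable_weight i : measurable_fun setT (weight i).
Proof.
rewrite /weight; case: pickle_inv => [s|]; last exact: measurable_cst.
apply: measurable_fun_ifT => //.
  apply: measurable_fun_agree => x.
  by exists 1%N => y xy; rewrite (agree_allowed s _ xy).
apply/measurable_EFinP; apply: (measurableT_comp (@measurable_expR R)).
exact: (measurableT_comp mpsi (measurable_prepend s)).
Qed.

Lemma measurable_transfer f : (forall z, 0 <= f z) -> measurable_fun setT f ->
  measurable_fun setT (transfer f).
Proof.
move=> f0 mf; apply: (@ge0_emeasurable_sum _ _ _ _ _ xpredT) => [i x _ _|i _].
  exact: term_ge0.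
apply: emeasurable_funM; first exact: measurable_weight.
exact: (measurableT_comp mf (measurable_branch i)).
Qed.

Lemma transfer_term f y : (forall z, 0 <= f z) ->
  (expR (psi y))%:E * f y <= transfer f (T y).
Proof.
move=> f0; set n := pickle (state_at y 0).
rewrite /transfer (@nneseriesD1 _ _ n)// => [|i _]; last exact: term_ge0.
rewrite weight_pickle ?allowed_shift// branch_pickle prepend_shift leeDl//.
by apply: nneseries_ge0 => i _ _; exact: term_ge0.
Qed.

Lemma transfer_branch f s x : (forall z, 0 <= f z) ->
  (forall z, state_at z 0 != s -> f z = 0) ->
  transfer f x = weight (pickle s) x * f (prepend s x).
Proof.
move=> f0 fs; rewrite /transfer (@nneseriesD1 _ _ (pickle s))// => [|i _]; last first.
  exact: term_ge0.
rewrite branch_pickle eseries0 ?adde0// => i _ /= is_.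
case: weightP => [s' s'x is'|]; last by rewrite mul0e.
rewrite fs ?mule0// state_prepend//.
by apply: contra is_ => /eqP <-; rewrite is'.
Qed.

(** Points with a common first letter have the same admissible preimage letters, so the two series
    are compared term by term. Allowing two different functions serves both the stability of
    [log_holder] and the Lipschitz estimate for trajectories. *)
Lemma transfer_comparison f g x y (k : nat) (c D : R) :
  (0 < k)%N -> agree_upto k x y -> (0 <= c)%R ->
  (forall z, 0 <= f z) -> (forall z, 0 <= g z) ->
  (forall s, allowed s x -> (psi (prepend s x) <= psi (prepend s y) + D)%R) ->
  (forall s, allowed s x -> f (prepend s x) <= c%:E * g (prepend s y)) ->
  transfer f x <= (expR D * c)%:E * transfer g y.
Proof.
move=> k0 xy c0 f0 g0 psiD fg.
rewrite -nneseriesZl => [|i _]; last exact: term_ge0.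
apply: lee_nneseries => [i _ _|i _]; first exact: term_ge0.
case: weightP => [s sx ->|]; last first.
  by rewrite mul0e mule_ge0 ?term_ge0// lee_fin mulr_ge0// expR_ge0.
rewrite branch_pickle weight_pickle ?(agree_allowed s k0 xy)//.
rewrite (le_trans (lee_wpmul2l _ (fg _ sx))) ?lee_fin ?expR_ge0//.
rewrite !muleA -EFinM; apply: lee_wpmul2r => //.
rewrite -EFinM lee_fin mulrAC ler_wpM2r// -expRD ler_expR addrC.
exact: psiD.
Qed.

Lemma iter_transfer_ge0 n f x : (forall z, 0 <= f z) ->
  0 <= iter n transfer f x.
Proof. by elim: n x => [//|n IHn] x f0; apply: transfer_ge0 => z; exact: IHn. Qed.

Lemma le_iter_transfer n f g x :
  (forall z, 0 <= f z) -> (forall z, f z <= g z) ->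
  iter n transfer f x <= iter n transfer g x.
Proof.
move=> f0 fg; elim: n x => [//|n IHn] x /=.
by apply: le_transfer => // z; exact: iter_transfer_ge0.
Qed.

Lemma iter_transferD n f g : (forall z, 0 <= f z) -> (forall z, 0 <= g z) ->
  iter n transfer (fun z => f z + g z) =
  (fun x => iter n transfer f x + iter n transfer g x).
Proof.
move=> f0 g0; elim: n => [//|n IHn]; apply/funext => x /=; rewrite IHn.
by rewrite transferD// => z; exact: iter_transfer_ge0.
Qed.

Lemma iter_transferZ n (c : R) f : (forall z, 0 <= f z) ->
  iter n transfer (fun z => c%:E * f z) = (fun x => c%:E * iter n transfer f x).
Proof.
move=> f0; elim: n => [//|n IHn]; apply/funext => x /=; rewrite IHn.
by rewrite transferZ// => z; exact: iter_transfer_ge0.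
Qed.

Lemma iter_transfer_nneseries n (f : nat -> X -> \bar R) :
  (forall k z, 0 <= f k z) ->
  iter n transfer (fun z => \sum_(k <oo) f k z) =
  (fun x => \sum_(k <oo) iter n transfer (f k) x).
Proof.
move=> f0; elim: n => [//|n IHn]; apply/funext => x /=; rewrite IHn.
by rewrite transfer_nneseries// => k z; exact: iter_transfer_ge0.
Qed.

Lemma iter_transfer_shift n (g : X -> R) f : (forall z, 0 <= f z) ->
  iter n transfer (fun z => (g (iter n T z))%:E * f z) =
  (fun x => (g x)%:E * iter n transfer f x).
Proof.
elim: n f => [//|n IHn] f f0; apply/funext => x.
rewrite iterSr [X in iter n transfer X](_ : _ =
    (fun z => (g (iter n T z))%:E * transfer f z)); last first.
  apply/funext => z; rewrite -(transfer_shift (fun u => g (iter n T u)))//; apply: eq_eseriesr => i _.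
  by rewrite iterSr.
rewrite IHn => [|z]; last exact: transfer_ge0.
by rewrite -iterSr.
Qed.

Lemma measurable_iter_transfer n f : (forall z, 0 <= f z) ->
  measurable_fun setT f -> measurable_fun setT (iter n transfer f).
Proof.
move=> f0 mf; elim: n => [//|n IHn]; apply: measurable_transfer => // z.
exact: iter_transfer_ge0.
Qed.

Lemma birkhoffS n x : birkhoff psi n.+1 x = (psi x + birkhoff psi n (T x))%R.
Proof.
rewrite /birkhoff big_ord_recl; congr (_ + _)%R.
by apply: eq_bigr => i _; rewrite -iterSr.
Qed.

Lemma birkhoff_add n k x :
  birkhoff psi (n + k) x = (birkhoff psi n x + birkhoff psi k (iter n T x))%R.
Proof.
elim: n x => [|n IHn] x; first by rewrite /birkhoff big_ord0 add0r.
by rewrite addSn !birkhoffS IHn addrA iterSr.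
Qed.

(** One preimage is kept and the other nonnegative terms are dropped: this is how a single orbit
    segment yields lower bounds on iterates. *)
Lemma iter_transfer_term n f y : (forall z, 0 <= f z) ->
  (expR (birkhoff psi n y))%:E * f y <= iter n transfer f (iter n T y).
Proof.
elim: n f y => [|n IHn] f y f0.
  by rewrite /birkhoff big_ord0 expR0 mul1e.
rewrite iterSr [in leRHS]iterSr.
apply: le_trans (IHn _ (T y) (fun z => transfer_ge0 z f0)).
rewrite birkhoffS addrC expRD EFinM -muleA lee_wpmul2l// ?lee_fin ?expR_ge0//.
exact: transfer_term.
Qed.

(** Only the first [n] letters of [a] can be put before a point, so the iterated sum has at most one
    nonzero term. The induction strips one letter of [a] at each step. *)
Lemma iter_transfer_cylinder n a f (M : R) : (n <= size a)%N -> (0 <= M)%R ->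
  (forall z, 0 <= f z) -> (forall z, ~ cyl a z -> f z = 0) ->
  (forall z, cyl a z -> (expR (birkhoff psi n z))%:E * f z <= M%:E) ->
  forall x, iter n transfer f x <= M%:E * (\1_(cyl (drop n a)) x)%:E.
Proof.
elim: n a f => [|n IHn] a f na M0 f0 fa fM x.
  rewrite drop0 /= indicE; case: (boolP (x \in _)) => /=.
    by rewrite inE mule1 => /[dup] xa /fM; rewrite /birkhoff big_ord0 expR0 mul1e.
  by rewrite notin_setE => /fa ->; rewrite mule0.
case: a na fa fM => [//|s a] na fa fM; rewrite iterSr /=.
have fs z : state_at z 0 != s -> f z = 0.
  by move=> zs; apply: fa => -[/eqP]; rewrite (negbTE zs).
have cyls z : allowed s z -> cyl (s :: a) (prepend s z) -> cyl a z.
  move=> sz; rewrite -cat1s => /cylinder_cat[_].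
  by rewrite /= shift_prepend.
apply: IHn => //.
- by move=> z; exact: transfer_ge0.
- move=> z za; rewrite (transfer_branch z f0 fs).
  have [sz|/negP sz] := boolP (allowed s z).
    by rewrite fa ?mule0// => /(cyls _ sz).
  by rewrite /weight pickleK_inv (negbTE (introN idP sz)) mul0e.
- move=> z za; rewrite (transfer_branch z f0 fs).
  have [sz|/negP sz] := boolP (allowed s z); last first.
    rewrite /weight pickleK_inv (negbTE (introN idP sz)) mul0e mule0.
    by rewrite lee_fin.
  rewrite weight_pickle// muleA -EFinM -expRD addrC.
  rewrite -{2}(shift_prepend sz) -birkhoffS fM// -cat1s.
  by apply/cylinder_cat; rewrite cylinder1 state_prepend//= shift_prepend.
Qed.

End transfer_operator.

(** * Comparison of the Gibbs measure with its images under the dual of the transfer operator *)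

Section gibbs_comparison.
Context (S : countType) (t : rel S) (X0 : admissible t !=set0) (R : realType).
Local Notation X := (markov_shift X0).
Local Notation T := (@left_shift S t X0).
Local Notation cyl := (@cylinder S t X0).
Implicit Types (x y z : X) (s : S) (a b w : seq S).
Variable (psi : X -> R) (m : probability X R) (C : R).
Hypothesis mpsi : measurable_fun setT psi.
Hypothesis C1 : (1 <= C)%R.

Definition mass a : R := fine (m (cyl a)).

Hypothesis mass_le : forall a x, cyl a x ->
  (mass a <= C * expR (birkhoff psi (size a) x))%R.
Hypothesis le_mass : forall a x, cyl a x ->
  (expR (birkhoff psi (size a) x) <= C * mass a)%R.

Let C0 : (0 < C)%R. Proof. exact: lt_le_trans C1. Qed.

Lemma massE a : m (cyl a) = (mass a)%:E.
Proof. by rewrite /mass fineK// fin_num_measure//; exact: measurable_cylinder. Qed.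

Lemma mass_ge0 a : (0 <= mass a)%R.
Proof. exact: fine_ge0. Qed.

Lemma mass_gt0 a x : cyl a x -> (0 < mass a)%R.
Proof.
by move=> /le_mass; move=> /(lt_le_trans (expR_gt0 _)); rewrite pmulr_rgt0.
Qed.

(** Birkhoff sums add up along a concatenation, so the mass is multiplicative up to one factor [C]
    for each of the three cylinders involved. *)
Lemma mass_cat_le b c x : cyl (b ++ c) x ->
  (mass (b ++ c) <= C ^+ 3 * (mass b * mass c))%R.
Proof.
move=> xbc; have /cylinder_cat[xb xc] := xbc.
apply: le_trans (mass_le xbc) _; rewrite size_cat birkhoff_add expRD.
rewrite (_ : C ^+ 3 * _ = C * ((C * mass b) * (C * mass c)))%R; last by ring.
by rewrite ler_pM2l// ler_pM ?expR_ge0 ?le_mass.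
Qed.

Lemma le_mass_cat b c x : cyl (b ++ c) x ->
  (mass b * mass c <= C ^+ 3 * mass (b ++ c))%R.
Proof.
move=> xbc; have /cylinder_cat[xb xc] := xbc.
apply: le_trans (ler_pM (mass_ge0 b) (mass_ge0 c) (mass_le xb) (mass_le xc)) _.
rewrite mulrACA -expRD -birkhoff_add -size_cat exprSr expr2 -[leRHS]mulrA ler_pM2l ?mulr_gt0//.
exact: le_mass.
Qed.

Local Notation L := (transfer psi).

Lemma measurable_indic_cylinder a :
  measurable_fun setT (fun x => (\1_(cyl a) x)%:E : \bar R).
Proof. by apply/measurable_EFinP; apply: measurable_indic; exact: measurable_cylinder. Qed.

Lemma integral_cylinder a : \int[m]_x (\1_(cyl a) x)%:E = (mass a)%:E.
Proof. by rewrite (integral_indic m measurableT (measurable_cylinder a)) setIT; exact: massE. Qed.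

Lemma indic_ge0 (A : set X) x : 0 <= (\1_A x)%:E :> \bar R.
Proof. by rewrite lee_fin indicE. Qed.

Let measurable_indicL n a :
  measurable_fun setT (iter n L (fun x => (\1_(cyl a) x)%:E)).
Proof.
apply: measurable_iter_transfer => //; exact: measurable_indic_cylinder.
Qed.

(** Write [a = b ++ c] with [size b = n]. The image of the indicator of [cyl a] under [L^n] is at
    most [C * mass b] times the indicator of [cyl c], and near-multiplicativity supplies the
    remaining [C ^+ 3]. *)
Lemma integral_transfer_cylinder_le n a : (n <= size a)%N ->
  \int[m]_x iter n L (fun x => (\1_(cyl a) x)%:E) x <= (C ^+ 4 * mass a)%:E.
Proof.
move=> na; have [[z za]|a0] := pselect (cyl a !=set0); last first.
  rewrite integral0_eq ?lee_fin ?mulr_ge0 ?mass_ge0 ?exprn_ge0 ?ltW// => x _.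
  apply/eqP; rewrite eq_le iter_transfer_ge0 ?andbT => [|?]; last exact: indic_ge0.
  have -> : 0 = 0%:E * (\1_(cyl (drop n a)) x)%:E :> \bar R by rewrite mul0e.
  apply: iter_transfer_cylinder => // y ya; first by rewrite indicE memNset.
  by case: a0; exists y.
set b := take n a; set c := drop n a.
have zbc : cyl (b ++ c) z by rewrite cat_take_drop.
have sb : size b = n by rewrite size_take; case: ltngtP na => // ->.
apply: (@le_trans _ _ (\int[m]_x ((C * mass b)%:E * (\1_(cyl c) x)%:E))).
  apply: ge0_le_integral => //.
  - by move=> x _; apply: iter_transfer_ge0 => ?; exact: indic_ge0.
  - by apply: measurable_funeM; exact: measurable_indic_cylinder.
  - move=> x _; apply: iter_transfer_cylinder => //.
    + by rewrite mulr_ge0 ?mass_ge0 ?ltW.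
    + by move=> y ya; rewrite indicE memNset.
    + move=> y ya; rewrite indicE mem_set// mule1 lee_fin -sb; apply: le_mass.
      by move: ya; rewrite -{1}(cat_take_drop n a) => /cylinder_cat[].
rewrite ge0_integralZl_EFin//; first last.
- by rewrite mulr_ge0 ?mass_ge0 ?ltW.
- exact: measurable_indic_cylinder.
rewrite integral_cylinder -EFinM lee_fin exprS -[leLHS]mulrA -[leRHS]mulrA ler_pM2l//.
by rewrite -[in leRHS](cat_take_drop n a); exact: (le_mass_cat zbc).
Qed.

Lemma le_integral_transfer_cylinder n a : (n < size a)%N ->
  (mass a)%:E <= (C ^+ 4)%:E * \int[m]_x iter n L (fun x => (\1_(cyl a) x)%:E) x.
Proof.
move=> na; have I0 : 0 <= \int[m]_x iter n L (fun x => (\1_(cyl a) x)%:E) x.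
  by apply: integral_ge0 => x _; apply: iter_transfer_ge0 => ?; exact: indic_ge0.
have [[z za]|a0] := pselect (cyl a !=set0); last first.
  suff -> : mass a = 0%R by rewrite mule_ge0// lee_fin exprn_ge0// ltW.
  rewrite /mass; suff -> : cyl a = set0 by rewrite measure0.
  by apply/seteqP; split => // y ya; case: a0; exists y.
set b := take n a; set c := drop n a.
have abc : b ++ c = a by rewrite cat_take_drop.
have zbc : cyl (b ++ c) z by rewrite abc.
have sb : size b = n by rewrite size_take na.
have /cylinder_cat[zb zc] := zbc.
(* The strict inequality makes [c] nonempty: its first letter is then common to [x] and to the tail
   of [z], so that [b] can be put before every [x] in [cyl c]. *)
have c0 : (0 < size c)%N by rewrite size_drop subn_gt0.
apply: (@le_trans _ _ ((C ^+ 4)%:E * \int[m]_x ((C^-1 * mass b)%:E * (\1_(cyl c) x)%:E))).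
  rewrite ge0_integralZl_EFin//; first last.
  - by rewrite mulr_ge0 ?mass_ge0 ?invr_ge0 ?ltW.
  - exact: measurable_indic_cylinder.
  rewrite integral_cylinder -!EFinM lee_fin exprSr -mulrA -(mulrA C^-1%R) mulVKf ?gt_eqF//.
  by rewrite -abc; exact: mass_cat_le zbc.
apply: lee_wpmul2l; first by rewrite lee_fin exprn_ge0// ltW.
apply: ge0_le_integral => //.
- by move=> x _; rewrite mule_ge0// lee_fin ?mulr_ge0 ?invr_ge0 ?mass_ge0 ?ltW.
- by apply: measurable_funeM; exact: measurable_indic_cylinder.
- move=> x _; rewrite indicE; case: (boolP (x \in _)) => [|_]; last first.
    by rewrite mule0 iter_transfer_ge0// => ?; exact: indic_ge0.
  rewrite inE mule1 => xc.
  have zx : state_at z n = state_at x 0.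
    by have := cylinder_agree xc zc c0; rewrite sb state_iter_shift addn0.
  have aS : cyl a (splice n z x).
    rewrite -abc; apply/cylinder_cat; rewrite sb shift_splice//; split => //.
    by apply: (agree_cylinder _ zb); rewrite sb; exact: agree_splice.
  rewrite -(shift_splice zx).
  apply: le_trans (iter_transfer_term psi n (splice n z x) (fun y => indic_ge0 (cyl a) y)).
  rewrite indicE mem_set// mule1 lee_fin ler_pdivrMl//.
  by rewrite -[X in birkhoff _ X]sb; apply: mass_le; move: aS; rewrite -abc => /cylinder_cat[].
Qed.

(** Enumerates the partition into cylinders of length [k] by [nat], so that a function of the first
    [k] letters becomes a series of indicators to which [L^n] and the integral apply term by
    term. *)
Definition word_cylinder (k i : nat) : set X :=
  if pickle_inv i is Some a then if size a == k then cyl a else set0 else set0.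

Definition word_value (g : seq S -> R) (i : nat) : R :=
  if pickle_inv i is Some a then g a else 0%R.

Lemma word_seriesE (g : seq S -> R) k x :
  (forall a, 0 <= g a)%R ->
  (g (word k x))%:E =
  \sum_(i <oo) (word_value g i)%:E * (\1_(word_cylinder k i) x)%:E.
Proof.
move=> g0; have v0 i : (0 <= word_value g i)%R.
  by rewrite /word_value; case: pickle_inv.
rewrite (@nneseriesD1 _ _ (pickle (word k x)))// => [|i _]; last first.
  by rewrite mule_ge0 ?lee_fin ?v0.
rewrite eseries0 ?adde0 => [|i _ /= ik].
  rewrite /word_cylinder /word_value pickleK_inv size_word eqxx.
  by rewrite indicE mem_set ?mule1//; exact: cylinder_word.
rewrite indicE memNset ?mule0// /word_cylinder.
have := @pickle_invK (seq S) i; case: pickle_inv => [a|_ []] /= ai.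
case: eqP => [ak /cylinderP xa|_ []].
by move: ik; rewrite -ai -ak xa eqxx.
Qed.

Let v0 (g : seq S -> R) i : (forall a, 0 <= g a)%R -> (0 <= word_value g i)%R.
Proof. by move=> g0; rewrite /word_value; case: pickle_inv. Qed.

Let measurable_word_cylinder k i : measurable (word_cylinder k i).
Proof.
rewrite /word_cylinder; case: pickle_inv => // a; case: ifP => // _.
exact: measurable_cylinder.
Qed.

Lemma measurable_word (g : seq S -> R) k :
  measurable_fun setT (fun x => g (word k x)).
Proof. by apply: measurable_fun_agree => x; exists k => y /agree_wordP ->. Qed.

Lemma integral_word (g : seq S -> R) k n : (forall a, 0 <= g a)%R ->
  \int[m]_x iter n L (fun x => (g (word k x))%:E) x =
  \sum_(i <oo) (word_value g i)%:E *
    \int[m]_x iter n L (fun x => (\1_(word_cylinder k i) x)%:E) x.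
Proof.
move=> g0; pose H i := fun x => (word_value g i)%:E * (\1_(word_cylinder k i) x)%:E.
have H0 i z : 0 <= H i z by rewrite mule_ge0 ?lee_fin ?v0.
rewrite (_ : (fun x => _) = fun x => \sum_(i <oo) H i x); last first.
  by apply/funext => x; exact: word_seriesE.
have mH i : measurable_fun setT (fun x => (\1_(word_cylinder k i) x)%:E : \bar R).
  by apply/measurable_EFinP; exact: measurable_indic.
rewrite iter_transfer_nneseries// integral_nneseries//; first last.
- by move=> i x _; exact: iter_transfer_ge0.
- by move=> i; apply: measurable_iter_transfer => //; exact: measurable_funeM.
apply: eq_eseriesr => i _; rewrite iter_transferZ => [|?]; last exact: indic_ge0.
rewrite ge0_integralZl_EFin ?v0//.
- by move=> x _; apply: iter_transfer_ge0 => ?; exact: indic_ge0.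
- by apply: measurable_iter_transfer => // ?; exact: indic_ge0.
Qed.

Let integral_L0 n : \int[m]_x iter n L (fun x => (\1_set0 x)%:E) x = 0.
Proof.
apply: integral0_eq => x _; elim: n x => [|n IHn] x; first by rewrite /= indicE in_set0.
apply: eseries0 => i _ _; apply/eqP; rewrite mule_eq0; apply/orP; right.
by apply/eqP; exact: IHn.
Qed.

(** [m] need not be fixed by the dual of [L]; this lemma and the next are the substitute, with a
    constant independent of [n] and [k]. *)
Lemma integral_transfer_word_le (g : seq S -> R) k n :
  (n <= k)%N -> (forall a, 0 <= g a)%R ->
  \int[m]_x iter n L (fun x => (g (word k x))%:E) x <=
  (C ^+ 4)%:E * \int[m]_x (g (word k x))%:E.
Proof.
move=> nk g0; rewrite integral_word// (integral_word k 0)//= -nneseriesZl.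
  apply: lee_nneseries => [i _ _|i _].
    rewrite mule_ge0 ?lee_fin ?v0//; apply: integral_ge0 => x _.
    by apply: iter_transfer_ge0 => ?; exact: indic_ge0.
  rewrite muleCA lee_wpmul2l ?lee_fin ?v0// /word_cylinder.
  case: pickle_inv => [a|]; last by rewrite integral_L0 (integral_L0 0) mule0.
  case: eqP => [ak|_]; last by rewrite integral_L0 (integral_L0 0) mule0.
  rewrite integral_cylinder -EFinM; apply: integral_transfer_cylinder_le.
  by rewrite ak.
move=> i _; rewrite mule_ge0 ?lee_fin ?v0//; apply: integral_ge0 => x _.
exact: indic_ge0.
Qed.

Lemma le_integral_transfer_word (g : seq S -> R) k n :
  (n < k)%N -> (forall a, 0 <= g a)%R ->
  \int[m]_x (g (word k x))%:E <=
  (C ^+ 4)%:E * \int[m]_x iter n L (fun x => (g (word k x))%:E) x.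
Proof.
move=> nk g0; rewrite integral_word// (integral_word k 0)//= -nneseriesZl.
  apply: lee_nneseries => [i _ _|i _].
    rewrite mule_ge0 ?lee_fin ?v0//; apply: integral_ge0 => x _.
    exact: indic_ge0.
  rewrite muleCA lee_wpmul2l ?lee_fin ?v0// /word_cylinder.
  case: pickle_inv => [a|]; last by rewrite integral_L0 (integral_L0 0) mule0.
  case: eqP => [ak|_]; last by rewrite integral_L0 (integral_L0 0) mule0.
  rewrite integral_cylinder; apply: le_integral_transfer_cylinder.
  by rewrite ak.
move=> i _; rewrite mule_ge0 ?lee_fin ?v0//; apply: integral_ge0 => x _.
by apply: iter_transfer_ge0 => ?; exact: indic_ge0.
Qed.

(** The infima of [f] over longer and longer cylinders increase to [f] by continuity, so the case of
    functions of finitely many letters passes to the limit by monotone convergence. *)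
Lemma le_integral_transfer_continuous (f : X -> R) n :
  continuous f -> (forall x, 0 <= f x)%R ->
  \int[m]_x (f x)%:E <=
  (C ^+ 4)%:E * \int[m]_x iter n L (fun x => (f x)%:E) x.
Proof.
move=> cf f0.
pose g a := if pselect (cyl a !=set0) then inf (f @` cyl a) else 0%R.
have lb a : has_lbound (f @` cyl a) by exists 0%R => _ [y _ <-].
have ga a x : cyl a x -> g a = inf (f @` cyl a).
  by move=> ax; rewrite /g; case: pselect => // -[]; exists x.
have g0 a : (0 <= g a)%R.
  rewrite /g; case: pselect => // -[x ax]; apply: lb_le_inf.
    by exists (f x); exists x.
  by move=> _ [y _ <-].
(* The lengths start at [n.+1] because the comparison for words needs more than the [n] letters that
   [L^n] removes. *)
pose h k x := (g (word (n.+1 + k) x))%:E.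
have hf k x : h k x <= (f x)%:E.
  rewrite lee_fin (ga _ x) ?ge_inf//; last exact: cylinder_word.
  by exists x => //; exact: cylinder_word.
have hnd x : {homo h^~ x : i j / (i <= j)%N >-> i <= j}.
  move=> i j ij; rewrite lee_fin !(ga _ x); try exact: cylinder_word.
  apply: lb_le_inf.
    by exists (f x); exists x => //; exact: cylinder_word.
  move=> _ [y /cylinder_wordE xy <-]; apply: ge_inf => //; exists y => //.
  by apply/cylinder_wordE; apply: agree_le xy; rewrite leq_add2l.
have hlim x : limn (h^~ x) = (f x)%:E.
  apply/cvg_lim => //; apply/fine_cvgP; split; first exact: nearW.
  apply/cvgrPdist_le => e e0.
  have [k xk] := agree_continuous x cf e0.
  exists k => // j /= kj.
  have h1 : (g (word (n.+1 + j) x) <= f x)%R by rewrite -lee_fin; exact: hf.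
  suff h2 : (f x - e <= g (word (n.+1 + j) x))%R.
    by rewrite ler_norml; apply/andP; split; lra.
  rewrite (ga _ x); last exact: cylinder_word.
  apply: lb_le_inf; first by exists (f x); exists x => //; exact: cylinder_word.
  move=> _ [y /cylinder_wordE xy <-].
  have /xk : agree_upto k x y.
    by apply: agree_le xy; apply: leq_trans kj _; exact: leq_addl.
  by rewrite ltr_norml => /andP[_]; rewrite ltrBlDr -ltrBlDl => /ltW.
have mh k : measurable_fun setT (h k) by by apply/measurable_EFinP; exact: measurable_word.
have h0 k x : 0 <= h k x by rewrite /h lee_fin.
have -> : \int[m]_x (f x)%:E = \int[m]_x limn (h^~ x).
  by apply: eq_integral => x _; rewrite hlim.
rewrite monotone_convergence//.
apply: lime_le.
  apply: ereal_nondecreasing_is_cvgn => i j ij; apply: ge0_le_integral => //.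
  by move=> x _; exact: hnd.
apply: nearW => k; apply: le_trans (@le_integral_transfer_word g (n.+1 + k) n (leq_addr _ _) g0) _.
apply: lee_wpmul2l; first by rewrite lee_fin exprn_ge0// ltW.
apply: ge0_le_integral => //.
- by move=> x _; apply: iter_transfer_ge0 => y; exact: h0.
- by apply: measurable_iter_transfer => [//|y|]; [exact: h0|exact: mh].
- apply: measurable_iter_transfer => //.
  by apply/measurable_EFinP; exact: measurable_fun_continuous.
- by move=> x _; apply: le_iter_transfer => y; [exact: h0|exact: hf].
Qed.

End gibbs_comparison.

(** * Uniform bounds on the iterates of the constant function *)

Section transfer_bounds.
Context (S : countType) (t : rel S) (X0 : admissible t !=set0) (R : realType).
Local Notation X := (markov_shift X0).
Local Notation T := (@left_shift S t X0).
Local Notation cyl := (@cylinder S t X0).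
Implicit Types (x y z : X) (s : S) (a b w : seq S).
Variable (psi : X -> R) (theta A : R).
Hypothesis theta01 : (0 < theta < 1)%R.
Hypothesis A0 : (0 <= A)%R.
Hypothesis psi_holder : forall k x y, (0 < k)%N -> agree_upto k x y ->
  (psi x <= psi y + A * theta ^+ k)%R.
Local Notation L := (transfer psi).

Let th0 : (0 < theta)%R. Proof. by case/andP: theta01. Qed.
Let th1 : (theta < 1)%R. Proof. by case/andP: theta01. Qed.

(* The constant [B] solves [theta * (A + B) = B]. *)
Definition distortion : R := (A * theta / (1 - theta))%R.
Local Notation B := distortion.

Lemma distortion_ge0 : (0 <= B)%R.
Proof. by rewrite /distortion !mulr_ge0 ?invr_ge0 ?subr_ge0// ltW. Qed.

Lemma distortionE : (theta * (A + B) = B)%R.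
Proof. by rewrite /distortion; field; rewrite subr_eq0 gt_eqF. Qed.

Lemma distortion_step k :
  (A * theta ^+ k.+1 + B * theta ^+ k.+1 = B * theta ^+ k)%R.
Proof. by rewrite -mulrDl exprS mulrA [(_ * theta)%R]mulrC distortionE. Qed.

(** The constant [B] is the fixed point of the effect of [L] on such bounds, so this cone is stable
    under [L] and the distortion of [L^n 1] does not grow with [n]. *)
Definition log_holder (f : X -> \bar R) := forall k x y, (0 < k)%N ->
  agree_upto k x y -> f x <= (expR (B * theta ^+ k))%:E * f y.

Lemma log_holder_transfer f : (forall z, 0 <= f z) ->
  log_holder f -> log_holder (L f).
Proof.
move=> f0 hf k x y k0 xy; rewrite -distortion_step expRD.
apply: (transfer_comparison k0) => //.
  move=> s sx; apply: psi_holder => //; exact: agree_prepend.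
by move=> s sx; apply: hf => //; exact: agree_prepend.
Qed.

Lemma log_holder_iter n f : (forall z, 0 <= f z) ->
  log_holder f -> log_holder (iter n L f).
Proof.
move=> f0 hf; elim: n => [//|n IHn]; apply: log_holder_transfer => // z.
exact: iter_transfer_ge0.
Qed.

Lemma log_holder1 : log_holder (fun=> 1).
Proof.
move=> k x y _ _; rewrite mule1 lee_fin -expR0 ler_expR.
by rewrite mulr_ge0 ?distortion_ge0// exprn_ge0// ltW.
Qed.

Lemma log_holder_ratio f x y : (forall z, 0 <= f z) -> log_holder f ->
  agree_upto 1 x y -> f x <= (expR B)%:E * f y.
Proof.
move=> f0 hf xy; apply: le_trans (hf 1%N x y isT xy) _.
rewrite lee_wpmul2r// lee_fin ler_expR expr1.
by rewrite ler_piMr ?distortion_ge0// ltW.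
Qed.

Lemma psi_continuous : continuous psi.
Proof.
apply: continuous_agree => x e e0.
have : (A * theta ^+ k)%R @[k --> \oo] --> (A * 0 : R)%R.
  by apply: cvgMr; apply: cvg_expr; rewrite gtr0_norm.
rewrite mulr0 => /cvgrPdist_lt/(_ e e0)[k _ /(_ k.+1 (leqnSn k))].
rewrite /= sub0r normrN => Ak; exists k.+1 => y xy; apply: le_lt_trans Ak.
have ? : (0 <= A * theta ^+ k.+1)%R by rewrite mulr_ge0// exprn_ge0// ltW.
rewrite [leRHS]ger0_norm// ler_norml; apply/andP; split.
  by rewrite lerBrDl lerBlDr; apply: psi_holder => //; exact: agree_sym.
by rewrite lerBlDl; exact: psi_holder.
Qed.

Let mpsi : measurable_fun setT psi.
Proof. exact: measurable_fun_continuous psi_continuous. Qed.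

Variable (m : probability X R) (C : R).
Hypothesis C1 : (1 <= C)%R.
Hypothesis mass_le : forall a x, cyl a x ->
  (mass m a <= C * expR (birkhoff psi (size a) x))%R.
Hypothesis le_mass : forall a x, cyl a x ->
  (expR (birkhoff psi (size a) x) <= C * mass m a)%R.
Hypothesis minv : invariant_measure T m.

Let C0 : (0 < C)%R. Proof. exact: lt_le_trans C1. Qed.

(** [C ^+ 4] bounds the averages of [L^n 1] over one-letter cylinders, and [expR B] its distortion
    inside such a cylinder. *)
Definition upper_bound : R := (expR B * C ^+ 4)%R.
Local Notation c2 := upper_bound.

Lemma upper_bound_gt0 : (0 < c2)%R.
Proof. by rewrite /upper_bound mulr_gt0 ?expR_gt0 ?exprn_gt0. Qed.

Lemma invariant_iter n (E : set X) : measurable E ->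
  m (iter n T @^-1` E) = m E.
Proof.
elim: n => [//|n IHn] mE.
rewrite (_ : iter n.+1 T @^-1` E = T @^-1` (iter n T @^-1` E)).
  by rewrite minv ?IHn//; exact: measurable_preimage_iter.
by apply/seteqP; split => x; rewrite /preimage/= -iterSr.
Qed.

Local Notation ind s := (fun x => (\1_(cyl [:: s]) x)%:E : \bar R).

Let one n := iter n L (fun=> 1).

Let one_ge0 n x : 0 <= one n x. Proof. exact: iter_transfer_ge0. Qed.

Let mone n : measurable_fun setT (one n).
Proof. by apply: measurable_iter_transfer. Qed.

(* Comparing the total mass of [one n] on a cylinder of length one with the
   mass of its preimage under [iter n T], which is a union of words. *)
Let integral_one n s :
  (C ^- 4 * mass m [:: s])%:E <= \int[m]_x (ind s x * one n x) <=
  (C ^+ 4 * mass m [:: s])%:E.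
Proof.
pose g a : R := (nth s a n == s)%:R.
have g0 a : (0 <= g a)%R by rewrite ler0n.
have gE x : g (word n.+1 x) = \1_(cyl [:: s]) (iter n T x).
  rewrite /g nth_mkseq// indicE; congr ((_ : bool)%:R); apply/eqP/idP => [xs|].
    by rewrite mem_set//; apply/cylinder1; rewrite state_iter_shift addn0.
  by rewrite inE => /cylinder1; rewrite state_iter_shift addn0.
have int1 : \int[m]_x (g (word n.+1 x))%:E = (mass m [:: s])%:E.
  have mE := measurable_preimage_iter n (@measurable_cylinder S t X0 [:: s]).
  rewrite -massE -(invariant_iter n (@measurable_cylinder S t X0 [:: s])).
  rewrite -[X in m X]setIT -(integral_indic m measurableT mE).
  by apply: eq_integral => x _; rewrite gE.
have intL : \int[m]_x iter n L (fun x => (g (word n.+1 x))%:E) x =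
    \int[m]_x (ind s x * one n x).
  apply: eq_integral => x _; rewrite /one.
  have H := iter_transfer_shift psi n (\1_(cyl [:: s])) (f := fun=> 1) (fun=> lee01).
  rewrite -[RHS]/((fun y => (\1_(cyl [:: s]) y)%:E * iter n L (fun=> 1) y) x) -H.
  by congr (iter n _ _ _); apply/funext => z; rewrite gE mule1.
apply/andP; split.
  have := le_integral_transfer_word mpsi C1 mass_le le_mass (ltnSn n) g0.
  by rewrite int1 intL => le1; rewrite EFinM lee_pdivrMl// exprn_gt0.
have := integral_transfer_word_le mpsi C1 mass_le le_mass (leqnSn n) g0.
by rewrite int1 intL.
Qed.

Let mass1_gt0 x : (0 < mass m [:: state_at x 0])%R.
Proof. by apply: (mass_gt0 C1 le_mass (x := x)); exact/cylinder1. Qed.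

Lemma transfer_one_le n x : one n x <= c2%:E.
Proof.
set s := state_at x 0.
rewrite -(@lee_pmul2r _ (mass m [:: s])%:E)// ?lte_fin ?mass1_gt0//.
have /andP[_ int_le] := integral_one n s.
rewrite (_ : c2%:E * _ = (expR B)%:E * (C ^+ 4 * mass m [:: s])%:E); last first.
  by rewrite -!EFinM mulrA.
have eB : 0 <= (expR B)%:E by rewrite lee_fin expR_ge0.
apply: le_trans (lee_wpmul2l eB int_le).
rewrite -integral_cylinder -!ge0_integralZl//; first last.
- exact: measurable_indic_cylinder.
- by move=> y _; rewrite mule_ge0.
- by apply: emeasurable_funM => //; exact: measurable_indic_cylinder.
apply: ge0_le_integral => //.
- by move=> y _; rewrite mule_ge0.
- by apply: emeasurable_funM => //; exact: measurable_indic_cylinder.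
- apply: emeasurable_funM => //; apply: emeasurable_funM => //.
  exact: measurable_indic_cylinder.
move=> y _; rewrite indicE; case: (boolP (y \in _)) => [|_]; last first.
  by rewrite mule0 mul0e mule0.
rewrite inE => /cylinder1 ys; rewrite mule1 mul1e.
apply: log_holder_ratio => //; first exact/log_holder_iter/log_holder1.
by case.
Qed.

Lemma le_transfer_one n x : c2^-1%:E <= one n x.
Proof.
set s := state_at x 0.
rewrite -(@lee_pmul2r _ (mass m [:: s])%:E)// ?lte_fin ?mass1_gt0//.
have /andP[le_int _] := integral_one n s.
rewrite (_ : c2^-1%:E * _ = (expR (- B))%:E * (C ^- 4 * mass m [:: s])%:E); last first.
  by rewrite -!EFinM mulrA expRN -invfM.
have eB : 0 <= (expR (- B))%:E by rewrite lee_fin expR_ge0.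
apply: le_trans (lee_wpmul2l eB le_int) _.
rewrite -integral_cylinder -!ge0_integralZl//; first last.
- by move=> y _; rewrite mule_ge0.
- by apply: emeasurable_funM => //; exact: measurable_indic_cylinder.
- exact: measurable_indic_cylinder.
apply: ge0_le_integral => //.
- by move=> y _; rewrite !mule_ge0// lee_fin expR_ge0.
- apply: emeasurable_funM => //; apply: emeasurable_funM => //.
  exact: measurable_indic_cylinder.
- by apply: emeasurable_funM => //; exact: measurable_indic_cylinder.
move=> y _; rewrite indicE; case: (boolP (y \in _)) => [|_]; last first.
  by rewrite mule0 mul0e mule0.
rewrite inE => /cylinder1 ys; rewrite mule1 mul1e expRN.
rewrite lee_pdivrMl ?expR_gt0//.
apply: log_holder_ratio => //; first exact/log_holder_iter/log_holder1.
by case.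
Qed.

End transfer_bounds.

(** * Minorization and contraction of oscillations *)

Section minorization.
Context (S : countType) (t : rel S) (X0 : admissible t !=set0) (R : realType).
Local Notation X := (markov_shift X0).
Local Notation T := (@left_shift S t X0).
Local Notation cyl := (@cylinder S t X0).
Implicit Types (x y z : X) (s : S) (a b w : seq S).
Variable (psi : X -> R) (m : probability X R) (C c : R).
Hypothesis C1 : (1 <= C)%R.
Hypothesis le_mass : forall a x, cyl a x ->
  (expR (birkhoff psi (size a) x) <= C * mass m a)%R.
Hypothesis mass_le : forall a x, cyl a x ->
  (mass m a <= C * expR (birkhoff psi (size a) x))%R.
Local Notation L := (transfer psi).
Hypothesis c0 : (0 < c)%R.
Hypothesis transfer1_ge : forall x, c%:E <= L (fun=> 1) x.

Let C0 : (0 < C)%R. Proof. exact: lt_le_trans C1. Qed.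

Let weight_bound (i : nat) : R :=
  if @pickle_inv S i is Some s then (C * mass m [:: s])%R else 0%R.

Let weight_le i x : weight psi i x <= (weight_bound i)%:E.
Proof.
case: weightP => [s sx ->|].
  rewrite lee_fin /weight_bound pickleK_inv.
  have := @le_mass [:: s] (prepend s x).
  rewrite birkhoffS /birkhoff big_ord0 addr0; apply.
  by apply/cylinder1; rewrite state_prepend.
rewrite lee_fin /weight_bound; case: pickle_inv => // s.
by rewrite mulr_ge0 ?mass_ge0// ltW.
Qed.

(** The one-letter cylinders partition a probability space, so the Gibbs bounds on the weights sum
    to [C]. *)
Let weight_bound_summable : \sum_(i <oo) (weight_bound i)%:E < +oo.
Proof.
have -> : \sum_(i <oo) (weight_bound i)%:E =
    C%:E * \sum_(i <oo) m (@state_cylinder S t X0 i `&` setT).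
  rewrite -nneseriesZl//; apply: eq_eseriesr => i _.
  rewrite setIT /weight_bound /state_cylinder; case: pickle_inv => [s|].
    by rewrite massE -EFinM.
  by rewrite measure0 mule0.
by rewrite measure_state_cylinder// [X in _ * X]probability_setT mule1 ltry.
Qed.

(** Takes the place of compactness. The weights at [x] add up to at least [c], and the letters with
    code at least [n] contribute less than [c / 2] whatever [x] is, so one of the remaining letters
    has a weight bounded below uniformly in [x]. *)
Let big_weight : exists n, exists2 e : R, (0 < e)%R & forall x,
  exists s, [/\ (pickle s < n)%N, allowed s x & (e <= expR (psi (prepend s x)))%R].
Proof.
have b0 i : 0 <= (weight_bound i)%:E.
  exact: le_trans (weight_ge0 psi i point) (weight_le i point).
have /fine_cvgP[_] := nneseries_tail_cvg weight_bound_summable (fun i _ => b0 i).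
move=> /cvgrPdist_lt/(_ (c / 2)%R (divr_gt0 c0 (ltr0n _ 2)))[n _ tail].
have {}tail : \sum_(n <= k <oo) (weight_bound k)%:E < (c / 2)%:E.
  have := tail n (leqnn n); rewrite /= sub0r normrN => tn.
  rewrite -[ltLHS]fineK ?lte_fin ?(le_lt_trans (ler_norm _) tn)//.
  rewrite ge0_fin_numE; last by apply: nneseries_ge0 => i _ _; exact: b0.
  apply: le_lt_trans weight_bound_summable.
  rewrite (@nneseries_split _ _ 0 n)// add0n leeDr//.
  by apply: sume_ge0 => i _; exact: b0.
(* If all letters with code below [n] fell short of this value, the head of the series would be at
   most [c / 2]; [n.+1] avoids a division by zero. *)
exists n, (c / 2 / n.+1%:R)%R; first by rewrite !divr_gt0.
move=> x; apply: contrapT => nos.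
have := transfer1_ge x; apply/negP; rewrite -ltNge.
have t0 i : 0 <= weight psi i x * 1 by rewrite mule1 weight_ge0.
rewrite /transfer (@nneseries_split _ _ 0 n) => [|k _//].
have head : \sum_(0 <= k < n) weight psi k x * 1 <= (c / 2)%:E.
  apply: (@le_trans _ _ (\sum_(0 <= k < n) (c / 2 / n.+1%:R)%:E)).
    rewrite !big_mkord; apply: lee_sum => i _; rewrite mule1.
    case: weightP => [s sx ii|]; last by rewrite lee_fin !divr_ge0// ltW.
    rewrite lee_fin leNgt; apply/negP => /ltW es; apply: nos; exists s.
    by rewrite -ii.
  rewrite sumEFin lee_fin big_const_nat iter_addr addr0 subn0.
  have c20 : (0 < c / 2)%R by rewrite divr_gt0.
  rewrite -[leLHS]mulr_natr -[leLHS]mulrA -[leRHS]mulr1 ler_pM2l//.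
  by rewrite mulrC ler_pdivrMr// mul1r ler_nat.
have cc : c = (c / 2 + c / 2)%R by rewrite -splitr.
rewrite [in ltRHS]cc EFinD add0n lee_ltD//.
  rewrite ge0_fin_numE; first exact: le_lt_trans head (ltry _).
  by apply: sume_ge0.
apply: le_lt_trans tail; apply: lee_nneseries => i _; first by [].
by rewrite mule1 weight_le.
Qed.

Lemma exists_pos_lower_bound (d : nat -> R) n : (forall i, 0 < d i)%R ->
  exists2 e, (0 < e)%R & forall i, (i < n)%N -> (e <= d i)%R.
Proof.
move=> d0; elim: n => [|n [e e0 ed]]; first by exists 1%R.
exists (Num.min e (d n)); first by rewrite lt_min e0 d0.
move=> i; rewrite ltnS leq_eqVlt ge_min => /orP[/eqP ->|/ed ->//].
by rewrite lexx orbT.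
Qed.

Hypothesis mixing : topologically_mixing T.

(** By mixing, each of the finitely many letters of [big_weight] is reached from [cyl w] after a
    common number [N] of steps. For any [x], one of them leads to [x] with a weight bounded below,
    and the Gibbs property bounds below the weight of the path before it. *)
Lemma exists_minorization w : cyl w !=set0 ->
  exists N, exists2 e : R, (0 < e)%R & forall x,
    e%:E <= iter N.+1 L (fun z => (\1_(cyl w) z)%:E) x.
Proof.
move=> w0; have [n [e e0 ne]] := big_weight.
have mix i : exists N, forall s, i = pickle s -> cyl [:: s] !=set0 ->
    forall k, (N <= k)%N -> exists2 z, cyl w z & state_at z k = s.
  have := @pickle_invK S i; case E : pickle_inv => [s|] /= is_; last first.
    by exists 0%N => s si; move: E; rewrite si pickleK_inv.
  have [s0|s0] := pselect (cyl [:: s] !=set0); last first.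
    exists 0%N => s' is'; suff -> : s' = s by [].
    by apply: (pcan_inj pickleK_inv); rewrite -is' is_.
  have [N HN] := mixing (@open_cylinder _ _ X0 w) (@open_cylinder _ _ X0 [:: s]) w0 s0.
  exists N => s' is' _ k /HN[z [wz /cylinder1]].
  rewrite state_iter_shift addn0 => zs; exists z => //; rewrite zs.
  by apply: (pcan_inj pickleK_inv); rewrite -is' is_.
have [Nf mixN] := choice mix.
(* The maximum makes the length common to all letters; adding [size w] ensures that the first [N]
   letters of a path contain all of [w]. *)
pose N := (size w + \max_(i < n) Nf i)%N.
have Nle i : (i < n)%N -> (Nf i <= N)%N.
  move=> ni; apply: leq_trans (leq_addl _ _).
  exact: (leq_bigmax (Ordinal ni)).
have low i : exists d, (0 < d)%R /\ ((i < n)%N -> forall s, i = pickle s ->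
    cyl [:: s] !=set0 -> exists z, [/\ cyl w z, state_at z N = s &
      (d <= C^-1 * mass m (word N z))%R]).
  have := @pickle_invK S i; case E : pickle_inv => [s|] /= is_; last first.
    by exists 1%R; split=> // _ s si; move: E; rewrite si pickleK_inv.
  have [[s0 ni]|H] := pselect (cyl [:: s] !=set0 /\ (i < n)%N); last first.
    exists 1%R; split => // ni s' is'; suff -> : s' = s by move=> s0; case: H.
    by apply: (pcan_inj pickleK_inv); rewrite -is' is_.
  have [z zw zN] := mixN i s (esym is_) s0 N (Nle i ni).
  exists (C^-1 * mass m (word N z))%R; split.
    by rewrite mulr_gt0 ?invr_gt0// (mass_gt0 C1 le_mass (cylinder_word N z)).
  move=> _ s' is' _; exists z; split => //; rewrite zN.
  by apply: (pcan_inj pickleK_inv); rewrite -is' is_.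
have [d dP] := choice low.
have [e' e'0 e'd] := exists_pos_lower_bound n (fun i => proj1 (dP i)).
exists N, (e' * e)%R; first by rewrite mulr_gt0.
move=> x; have [s [sn sx es]] := ne x.
have s0 : cyl [:: s] !=set0.
  by exists (prepend s x); apply/cylinder1; rewrite state_prepend.
have [z [zw zN dz]] := (dP (pickle s)).2 sn s erefl s0.
set y := splice N z (prepend s x).
have zx : state_at z N = state_at (prepend s x) 0 by rewrite state_prepend.
have yN : iter N T y = prepend s x by exact: shift_splice.
have zy : agree_upto N z y by exact: agree_splice.
have <- : iter N.+1 T y = x by rewrite iterS yN shift_prepend.
apply: le_trans (iter_transfer_term psi N.+1 y _); last by move=> ?; exact: indic_ge0.
rewrite indicE mem_set; last first.
  by apply: (agree_cylinder _ zw); apply: agree_le zy; exact: leq_addr.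
rewrite mule1 lee_fin -addn1 birkhoff_add yN expRD.
have [e'0' e0'] := (ltW e'0, ltW e0); apply: ler_pM => //.
  apply: le_trans (e'd _ sn) _; apply: le_trans dz _.
  rewrite ler_pdivrMl// -[X in birkhoff _ X](size_word N z); apply: mass_le.
  by apply/cylinder_wordE.
by rewrite birkhoffS /birkhoff big_ord0 addr0.
Qed.

End minorization.

Lemma expR_sub1_le (R : realType) (u : R) : (expR u - 1 <= u * expR u)%R.
Proof.
have := expR_ge1Dx (- u); rewrite -(ler_pM2r (expR_gt0 u)) -expRD addNr expR0.
rewrite mulrDl mul1r mulNr; lra.
Qed.

Lemma bernoulli_ineq (R : realType) (u : R) n : (0 <= u <= 1)%R ->
  (1 - n%:R * u <= (1 - u) ^+ n)%R.
Proof.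
case/andP=> u0 u1; elim: n => [|n IHn]; first by rewrite mul0r subr0 expr0.
rewrite exprS; have u1' : (0 <= 1 - u)%R by rewrite subr_ge0.
apply: le_trans (ler_wpM2l u1' IHn).
have nu : (0 <= n%:R * (u * u))%R by rewrite mulr_ge0// mulr_ge0.
rewrite -natr1; nra.
Qed.

(** * Contraction of oscillations along trajectories *)

Section contraction.
Context (S : countType) (t : rel S) (X0 : admissible t !=set0) (R : realType).
Local Notation X := (markov_shift X0).
Local Notation T := (@left_shift S t X0).
Local Notation cyl := (@cylinder S t X0).
Implicit Types (x y z : X) (s : S) (w : seq S).
Variable (psi : X -> R) (theta A : R).
Hypothesis theta01 : (0 < theta < 1)%R.
Hypothesis A0 : (0 <= A)%R.
Hypothesis psi_holder : forall k x y, (0 < k)%N -> agree_upto k x y ->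
  (psi x <= psi y + A * theta ^+ k)%R.
Local Notation L := (transfer psi).
Local Notation B := (distortion theta A).
Variable c2 : R.
Hypothesis c2_gt0 : (0 < c2)%R.
Hypothesis minorization : forall w, cyl w !=set0 ->
  exists N, exists2 e : R, (0 < e)%R & forall x,
    e%:E <= iter N.+1 L (fun z => (\1_(cyl w) z)%:E) x.

Let th0 : (0 < theta)%R. Proof. by case/andP: theta01. Qed.
Let th1 : (theta < 1)%R. Proof. by case/andP: theta01. Qed.
Let th0' : (0 <= theta)%R. Proof. exact: ltW. Qed.
Let B0 : (0 <= B)%R. Proof. exact: distortion_ge0. Qed.

Definition osc_le (f : X -> R) (d : R) := forall x y, (f x <= f y + d)%R.

Definition lip_le (f : X -> R) (l : R) := forall k x y, (0 < k)%N ->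
  agree_upto k x y -> (f x <= f y + l * theta ^+ k)%R.

(* The operators [f |-> L (f * v k) / v k.+1] are Markov operators, and [f]
   is a trajectory of this non-stationary sequence. *)
Definition trajectory (v f : nat -> X -> R) :=
  [/\ forall k x, (c2^-1 <= v k x <= c2)%R,
      forall k, log_holder theta A (fun x => (v k x)%:E),
      forall k x, L (fun z => (v k z)%:E) x = (v k.+1 x)%:E,
      forall k x, (0 <= f k x)%R &
      forall k x, L (fun z => (f k z * v k z)%:E) x = (f k.+1 x * v k.+1 x)%:E].

Lemma osc_le_bounds (f : X -> R) d : (forall x, 0 <= f x)%R -> osc_le f d ->
  exists2 a, (0 <= a)%R & forall x, (a <= f x <= a + d)%R.
Proof.
move=> f0 fd.
have lb : has_lbound (range f) by exists 0%R => _ [x _ <-].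
have ne : range f !=set0.
  by exists (f point); exists point.
exists (inf (range f)); first by apply: lb_le_inf => // _ [x _ <-].
move=> x; rewrite ge_inf//=; last by exists x.
rewrite -lerBlDr; apply: lb_le_inf => // _ [y _ <-].
by rewrite lerBlDr; exact: fd.
Qed.

Lemma bounds_osc_le (f : X -> R) a d : (forall x, a <= f x <= a + d)%R ->
  osc_le f d.
Proof.
move=> fad x y; have /andP[_ xd] := fad x; have /andP[ya _] := fad y.
by apply: le_trans xd _; rewrite lerD2r.
Qed.

Section steps.
Variables v f : nat -> X -> R.
Hypothesis vf : trajectory v f.

Let v_gt0 k x : (0 < v k x)%R.
Proof.
case: vf => vb _ _ _ _; have /andP[c2v _] := vb k x.
by apply: lt_le_trans c2v; rewrite invr_gt0.
Qed.

Let v_ge0 k x : (0 <= v k x)%R. Proof. exact: ltW. Qed.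

Let f_ge0 k x : (0 <= f k x)%R. Proof. by case: vf. Qed.

Let iter_v n k x : iter n L (fun z => (v k z)%:E) x = (v (k + n)%N x)%:E.
Proof.
case: vf => _ _ vL _ _; elim: n x => [|n IHn] x; first by rewrite addn0.
by rewrite iterS (_ : iter n _ _ = fun z => (v (k + n)%N z)%:E) ?vL ?addnS//;
  apply/funext => z; rewrite IHn.
Qed.

Let iter_cv n k (b : R) x :
  iter n L (fun z => b%:E * (v k z)%:E) x = (b * v (k + n)%N x)%:E.
Proof.
rewrite iter_transferZ => [|z]; last by rewrite lee_fin.
by rewrite iter_v.
Qed.

Let iter_f n k x : iter n L (fun z => (f k z * v k z)%:E) x =
  (f (k + n)%N x * v (k + n)%N x)%:E.
Proof.
case: vf => _ _ _ _ fL; elim: n x => [|n IHn] x; first by rewrite addn0.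
rewrite iterS (_ : iter n _ _ =
  fun z => (f (k + n)%N z * v (k + n)%N z)%:E) ?fL ?addnS//.
by apply/funext => z; rewrite IHn.
Qed.

Let minorized (W : set X) n (e : R) :=
  forall x, e%:E <= iter n L (fun z => (\1_W z)%:E) x.

(** One factor [c2] bounds [v k] from below on [W], the other bounds [v (k + n)] from above. *)
Let iter_indicv W n e k x : (0 <= e)%R -> minorized W n e ->
  (e / c2 ^+ 2 * v (k + n)%N x)%:E <=
  iter n L (fun z => (\1_W z * v k z)%:E) x.
Proof.
move=> e0 We; case: vf => vb _ _ _ _.
have c2V : (0 <= c2^-1)%R by rewrite invr_ge0 ltW.
apply: (@le_trans _ _ (iter n L (fun z => c2^-1%:E * (\1_W z)%:E) x)); last first.
  apply: le_iter_transfer => z; first by rewrite mule_ge0.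
  rewrite -EFinM lee_fin mulrC ler_wpM2l//.
  by have /andP[] := vb k z.
rewrite iter_transferZ//; apply: le_trans (lee_wpmul2l _ (We x)); last first.
  by rewrite lee_fin.
rewrite -EFinM lee_fin expr2 invfM mulrA mulrAC mulrC -!mulrA ler_wpM2l//.
rewrite ler_piMr// mulrC ler_pdivrMr// mul1r.
by have /andP[] := vb (k + n)%N x.
Qed.

(** Positivity alone: the hypothesis is multiplied by [v k] and pushed through [L^n], and the
    minorization spreads the gap [g] from [W] to every point. *)
Lemma trajectory_upper W n (e b g : R) k : (0 <= e)%R -> (0 <= g)%R ->
  (0 <= b)%R -> minorized W n e ->
  (forall x, f k x + g * \1_W x <= b)%R ->
  forall x, (f (k + n)%N x + g * (e / c2 ^+ 2) <= b)%R.
Proof.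
move=> e0 g0 b0 We fb x.
rewrite -(ler_pM2r (v_gt0 (k + n) x)) mulrDl -lee_fin EFinD -iter_f.
rewrite -[leRHS]iter_cv.
apply: (@le_trans _ _ (iter n L (fun z => (f k z * v k z)%:E +
    g%:E * (\1_W z * v k z)%:E) x)).
  rewrite iter_transferD//; first last.
  - by move=> z; rewrite ?mule_ge0 ?lee_fin ?mulr_ge0.
  - by move=> z; rewrite ?mule_ge0 ?lee_fin ?mulr_ge0.
  rewrite leeD2l// iter_transferZ => [|z]; last by rewrite lee_fin mulr_ge0.
  by rewrite -mulrA EFinM lee_wpmul2l//; exact: iter_indicv.
apply: le_iter_transfer => z.
  by rewrite -EFinM -EFinD lee_fin addr_ge0// !mulr_ge0.
by rewrite -!EFinM -EFinD lee_fin mulrA -mulrDl ler_wpM2r.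
Qed.

Lemma trajectory_lower W n (e b g : R) k : (0 <= e)%R -> (0 <= g)%R ->
  (0 <= b)%R -> minorized W n e ->
  (forall x, b + g * \1_W x <= f k x)%R ->
  forall x, (b + g * (e / c2 ^+ 2) <= f (k + n)%N x)%R.
Proof.
move=> e0 g0 b0 We fb x.
rewrite -(ler_pM2r (v_gt0 (k + n) x)) mulrDl -lee_fin EFinD -iter_f.
rewrite -[X in X + _ <= _]iter_cv.
apply: (@le_trans _ _ (iter n L (fun z => b%:E * (v k z)%:E +
    g%:E * (\1_W z * v k z)%:E) x)).
  rewrite iter_transferD//; first last.
  - by move=> z; rewrite ?mule_ge0 ?lee_fin ?mulr_ge0.
  - by move=> z; rewrite ?mule_ge0 ?lee_fin ?mulr_ge0.
  rewrite leeD2l// iter_transferZ => [|z]; last by rewrite lee_fin mulr_ge0.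
  by rewrite -mulrA EFinM lee_wpmul2l//; exact: iter_indicv.
apply: le_iter_transfer => z.
  by rewrite -!EFinM -EFinD lee_fin addr_ge0// !mulr_ge0.
by rewrite -!EFinM -EFinD lee_fin mulrA -mulrDl ler_wpM2r.
Qed.

Lemma trajectory_bounds k a d : (0 <= a)%R ->
  (forall x, a <= f k x <= a + d)%R -> forall x, (a <= f k.+1 x <= a + d)%R.
Proof.
move=> a0 fad x.
(* With [W] empty and no gap, the two lemmas above become the maximum principle. *)
have min0 : minorized set0 1 0.
  by move=> z; apply: iter_transfer_ge0 => z'; rewrite lee_fin.
have d0 : (0 <= a + d)%R by have /andP[+ ] := fad x; lra.
rewrite -[in f k.+1 x]addn1; apply/andP; split.
  have := @trajectory_lower set0 1 0 a 0 k (lexx _) (lexx _) a0 min0.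
  rewrite mul0r addr0; apply => z; rewrite mul0r addr0.
  by have /andP[] := fad z.
have := @trajectory_upper set0 1 0 (a + d) 0 k (lexx _) (lexx _) d0 min0.
rewrite mul0r.
move=> /(_ _ x); rewrite addr0; apply => z; rewrite mul0r addr0.
by have /andP[] := fad z.
Qed.

Lemma trajectory_osc k d : osc_le (f k) d -> osc_le (f k.+1) d.
Proof.
move=> /(osc_le_bounds (f_ge0 k))[a a0 /(trajectory_bounds a0)].
exact: bounds_osc_le.
Qed.

(** The first term comes from the bound on [E * E - 1] in the proof of [trajectory_lip], where [E]
    is the distortion factor; the added 1 keeps the constant positive when [B = 0]. *)
Definition lip_const : R := (2 * B * expR (2 * B) + 1)%R.

(** A Doeblin-Fortet inequality with the oscillation in place of the sup norm: the distortion acts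
    on [f k - a] only, where [a] is a lower bound of [f k], and this difference is at most [d]. *)
Lemma trajectory_lip k d l : (0 <= d)%R -> (0 <= l)%R ->
  osc_le (f k) d -> lip_le (f k) l ->
  lip_le (f k.+1) (theta * l + lip_const * d).
Proof.
move=> d0 l0 fd fl j x y j0 xy.
have [a a0 fad] := osc_le_bounds (f_ge0 k) fd.
have /andP[aS Sd] := trajectory_bounds a0 fad y.
case: (vf) => vb vlog vL _ fL.
(* At a preimage of [x], the excess of [f k] over [u] is at most [f k - a] at the corresponding
   preimage of [y]; only this excess has to be compared multiplicatively. *)
pose u := (a + l * theta ^+ j.+1)%R.
have u0 : (0 <= u)%R by rewrite addr_ge0// mulr_ge0// exprn_ge0.
pose F z : R := Num.max 0%R (f k z - u)%R.
have F0 z : (0 <= F z)%R by rewrite le_max lexx.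
have Fle z : (f k z <= u + F z)%R by rewrite -lerBlDl le_max lexx orbT.
have fa0 z : (0 <= f k z - a)%R by rewrite subr_ge0; have /andP[] := fad z.
(* [transfer] is handled on nonnegative functions only, so the subtraction of [a] is obtained from
   additivity. *)
have LyE : L (fun z => ((f k z - a) * v k z)%:E) y =
    ((f k.+1 y - a) * v k.+1 y)%:E.
  have : L (fun z => (f k z * v k z)%:E) y =
      L (fun z => ((f k z - a) * v k z)%:E) y + a%:E * (v k.+1 y)%:E.
    transitivity (L (fun z => ((f k z - a) * v k z)%:E + a%:E * (v k z)%:E) y).
      congr (transfer _ _ _); apply/funext => z.
      by rewrite -EFinM -EFinD; congr (_%:E); ring.
    rewrite transferD => [|z|z]; last 2 first.
    - by rewrite lee_fin mulr_ge0.
    - by rewrite mule_ge0 ?lee_fin.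
    by rewrite transferZ ?vL// => z; rewrite lee_fin.
  rewrite fL -EFinM => /eqP; rewrite -sube_eq ?fin_num_adde_defl//.
  by rewrite -EFinB => /eqP <-; congr (_%:E); ring.
have LF : L (fun z => (F z * v k z)%:E) x <=
    (expR (B * theta ^+ j) * ((f k.+1 y - a) * v k.+1 y))%:E.
  rewrite EFinM -LyE -distortion_step// expRD.
  apply: (transfer_comparison j0 xy); rewrite ?expR_ge0//.
  - by move=> z; rewrite lee_fin mulr_ge0.
  - by move=> z; rewrite lee_fin mulr_ge0.
  - by move=> s sx; apply: psi_holder => //; exact: agree_prepend.
  move=> s sx; have sxy := agree_prepend sx j0 xy.
  have FS : (F (prepend s x) <= f k (prepend s y) - a)%R.
    by rewrite ge_max fa0/= /u; have := fl _ _ _ (ltn0Sn j) sxy; lra.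
  have := vlog k _ _ _ (ltn0Sn j) sxy; rewrite -EFinM !lee_fin => vS.
  by rewrite mulrCA; apply: ler_pM.
have main : (f k.+1 x * v k.+1 x <=
    u * v k.+1 x + expR (B * theta ^+ j) * ((f k.+1 y - a) * v k.+1 y))%R.
  rewrite -lee_fin -fL; apply: (@le_trans _ _
      (L (fun z => u%:E * (v k z)%:E + (F z * v k z)%:E) x)).
    apply: le_transfer => z; first by rewrite lee_fin mulr_ge0.
    by rewrite -EFinM -EFinD lee_fin -mulrDl ler_wpM2r.
  rewrite transferD => [|z|z]; last 2 first.
  - by rewrite mule_ge0 ?lee_fin.
  - by rewrite lee_fin mulr_ge0.
  rewrite transferZ => [|z]; last by rewrite lee_fin.
  by rewrite vL [leRHS]EFinD -EFinM leeD2l.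
have vyx : (v k.+1 y <= expR (B * theta ^+ j) * v k.+1 x)%R.
  by rewrite -lee_fin; apply: vlog => //; exact: agree_sym.
set E := expR (B * theta ^+ j) in main vyx.
have E0 : (0 < E)%R by exact: expR_gt0.
have fx : (f k.+1 x <= u + E * E * (f k.+1 y - a))%R.
  rewrite -(ler_pM2r (v_gt0 k.+1 x)); apply: le_trans main _.
  rewrite [leRHS]mulrDl lerD2l.
  rewrite [leRHS](_ : _ = E * ((f k.+1 y - a) * (E * v k.+1 x)))%R; last by ring.
  rewrite ler_pM2l//.
  by apply: ler_wpM2l => //; rewrite subr_ge0.
apply: le_trans fx _.
have thj : (0 <= theta ^+ j)%R by rewrite exprn_ge0.
have thj1 : (theta ^+ j <= 1)%R by rewrite exprn_ile1// ltW.
have B2 : (0 <= 2 * B)%R by rewrite mulr_ge0.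
have EE : (E * E - 1 <= 2 * B * theta ^+ j * expR (2 * B))%R.
  have -> : (E * E = expR (2 * (B * theta ^+ j)))%R.
    by rewrite /E -expRD; congr expR; ring.
  apply: le_trans (expR_sub1_le _) _; rewrite mulrA; apply: ler_wpM2l.
    by rewrite mulr_ge0.
  by rewrite ler_expR ler_piMr.
have fya : (f k.+1 y - a <= d)%R by lra.
have fya0 : (0 <= f k.+1 y - a)%R by rewrite subr_ge0.
have : ((E * E - 1) * (f k.+1 y - a) <= 2 * B * theta ^+ j * expR (2 * B) * d)%R.
  apply: le_trans (ler_wpM2r fya0 EE) _; apply: ler_wpM2l.
    by rewrite mulr_ge0 ?expR_ge0// mulr_ge0.
  exact: fya.
have dth : (0 <= d * theta ^+ j)%R by rewrite mulr_ge0.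
by rewrite /u /lip_const exprS; nra.
Qed.

Lemma trajectory_osc_le k n d : osc_le (f k) d -> osc_le (f (k + n)) d.
Proof.
move=> fd; elim: n => [|n IHn]; first by rewrite addn0.
by rewrite addnS; exact: trajectory_osc.
Qed.

Lemma lip_const_ge1 : (1 <= lip_const)%R.
Proof.
have B2 : (0 <= 2 * B)%R by rewrite mulr_ge0.
by rewrite /lip_const lerDr mulr_ge0// expR_ge0.
Qed.

Lemma trajectory_lip_iter k n d l : (0 <= d)%R -> (0 <= l)%R ->
  osc_le (f k) d -> lip_le (f k) l ->
  lip_le (f (k + n)) (theta ^+ n * l + lip_const / (1 - theta) * d).
Proof.
move=> d0 l0 fd fl; have c0 : (0 <= lip_const)%R.
  exact: le_trans lip_const_ge1.
have th1' : (0 < 1 - theta)%R by rewrite subr_gt0.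
elim: n => [|n IHn].
  move=> j x y j0 xy; rewrite addn0 mul1r; apply: le_trans (fl _ _ _ j0 xy) _.
  by rewrite lerD2l ler_wpM2r ?exprn_ge0// lerDl mulr_ge0// divr_ge0// ltW.
have l' : (0 <= theta ^+ n * l + lip_const / (1 - theta) * d)%R.
  by rewrite addr_ge0// mulr_ge0// ?exprn_ge0// divr_ge0// ltW.
have := trajectory_lip d0 l' (trajectory_osc_le n fd) IHn.
rewrite -addnS; congr (lip_le _ _).
by rewrite exprS; field; rewrite subr_eq0 gt_eqF.
Qed.

End steps.

Definition lip_bound : R := (lip_const / (1 - theta))%R.

Let lip_bound_gt0 : (0 < lip_bound)%R.
Proof.
by rewrite divr_gt0 ?subr_gt0// (lt_le_trans ltr01)//; exact: lip_const_ge1.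
Qed.

(* [M] is chosen before [N] and [e]: the oscillation of [f] on a fixed cylinder
   of length [M] is at most [2 * l * theta ^+ M], which has to be small with
   respect to [lip_bound] but not with respect to [e]. *)
Let block : exists N, exists2 e : R, (0 < e <= 1)%R &
  forall v f k d l, trajectory v f -> (0 <= d)%R -> (0 <= l)%R ->
    osc_le (f k) d -> lip_le (f k) l ->
    exists d' l', [/\ (0 <= d')%R, (0 <= l')%R, osc_le (f (k + N.+1)%N) d',
      lip_le (f (k + N.+1)%N) l' &
      (2 * lip_bound * d' + e * l' <=
        Num.max (1 - e / 2) ((1 + theta) / 2) * (2 * lip_bound * d + e * l))%R].
Proof.
have [M M0 thM] : exists2 M, (0 < M)%N &
    (theta ^+ M <= (1 - theta) / (8 * lip_bound))%R.
  have : (theta ^+ n)%R @[n --> \oo] --> (0 : R)%R by apply: cvg_expr; rewrite gtr0_norm.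
  have e0 : (0 < (1 - theta) / (8 * lip_bound))%R.
    by rewrite divr_gt0 ?subr_gt0// mulr_gt0.
  move=> /cvgrPdist_lt/(_ _ e0)[n _ /(_ n.+1 (leqnSn n))].
  rewrite /= sub0r normrN gtr0_norm ?exprn_gt0// => /ltW ?; by exists n.+1.
pose y : X := point.
have w0 : cyl (word M y) !=set0 by exists y; exact: cylinder_word.
have [N [e1 e1_gt0 We1]] := minorization w0.
have c22 : (0 < c2 ^+ 2)%R by rewrite exprn_gt0.
pose e0 : R := Num.min e1 (c2 ^+ 2)%R.
have e0_gt0 : (0 < e0)%R by rewrite lt_min e1_gt0.
have We0 x : e0%:E <= iter N.+1 L (fun z => (\1_(cyl (word M y)) z)%:E) x.
  by apply: le_trans (We1 x); rewrite lee_fin ge_min lexx.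
pose e := (e0 / c2 ^+ 2)%R.
have e_gt0 : (0 < e)%R by rewrite divr_gt0.
have e_le1 : (e <= 1)%R by rewrite ler_pdivrMr// mul1r ge_min lexx orbT.
exists N, e; first by rewrite e_gt0.
move=> v f k d l vf d0 l0 fd fl.
have f0 j x : (0 <= f j x)%R by case: vf.
have thM0 : (0 <= theta ^+ M)%R by rewrite exprn_ge0.
have [a a0 fad] := osc_le_bounds (f0 k) fd.
pose tau := f k y; pose r := (l * theta ^+ M)%R.
have r0 : (0 <= r)%R by rewrite mulr_ge0.
have fW z : cyl (word M y) z -> (tau - r <= f k z <= tau + r)%R.
  move=> /cylinder_wordE yz; apply/andP; split; last exact: fl (agree_sym yz).
  by rewrite lerBlDr; exact: fl.
pose g1 := Num.max 0%R (a + d - tau - r)%R.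
pose g2 := Num.max 0%R (tau - r - a)%R.
have up : forall x, (f (k + N.+1)%N x + g1 * e <= a + d)%R.
  apply: (trajectory_upper vf (W := cyl (word M y)) (ltW e0_gt0)) => //.
  - by rewrite le_max lexx.
  - by rewrite addr_ge0.
  move=> z; have /andP[az zd] := fad z; rewrite indicE.
  case: (boolP (z \in _)) => [|_]; last by rewrite mulr0 addr0.
  rewrite inE mulr1 => /fW/andP[_ zr].
  by rewrite -lerBrDl ge_max; apply/andP; split; lra.
have low : forall x, (a + g2 * e <= f (k + N.+1)%N x)%R.
  apply: (trajectory_lower vf (W := cyl (word M y)) (ltW e0_gt0)) => //.
    by rewrite le_max lexx.
  move=> z; have /andP[az zd] := fad z; rewrite indicE.
  case: (boolP (z \in _)) => [|_]; last by rewrite mulr0 addr0.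
  rewrite inE mulr1 => /fW/andP[zr _].
  by rewrite -lerBrDl ge_max; apply/andP; split; lra.
exists ((1 - e) * d + 2 * e * r)%R, (theta ^+ N.+1 * l + lip_bound * d)%R.
(* On the cylinder, [f k] is within [r] of [tau]; wherever [tau] lies, its distances to the two
   bounds add up to [d], so the two gaps recover almost all of the oscillation. *)
have gg : (d - 2 * r <= g1 + g2)%R.
  have : (a + d - tau - r <= g1)%R by rewrite le_max lexx orbT.
  have : (tau - r - a <= g2)%R by rewrite le_max lexx orbT.
  lra.
have thN : (theta ^+ N.+1 <= theta)%R.
  by rewrite exprS ler_piMr// exprn_ile1// ltW.
have thN0 : (0 <= theta ^+ N.+1)%R by rewrite exprn_ge0.
split.
- have ed : (0 <= (1 - e) * d)%R by rewrite mulr_ge0// subr_ge0.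
  have er : (0 <= e * r)%R by rewrite mulr_ge0// ltW.
  lra.
- have tl : (0 <= theta ^+ N.+1 * l)%R by rewrite mulr_ge0.
  by rewrite addr_ge0// mulr_ge0// ltW.
- move=> x z; have := up x; have := low z.
  by have := ler_wpM2r (ltW e_gt0) gg; nra.
- exact: (trajectory_lip_iter vf (k := k) N.+1 d0 l0 fd fl).
have rM : (8 * lip_bound * r <= (1 - theta) * l)%R.
  have b8 : (0 < 8 * lip_bound)%R by rewrite mulr_gt0.
  move: thM; rewrite ler_pdivlMr// => thM.
  by rewrite /r [leLHS](_ : _ = theta ^+ M * (8 * lip_bound) * l)%R; [exact: ler_wpM2r|ring].
(* In the weighted sum, the term [lip_bound * d] of [l'] costs half of the gain in [d'], which
   leaves the factor [1 - e / 2]. The choice of [M] limits the effect of [r] to [(1 - theta) / 2],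
   which leaves [(1 + theta) / 2] for [l]. *)
set q := Num.max _ _.
have q1 : (1 - e / 2 <= q)%R by rewrite le_max lexx.
have q2 : ((1 + theta) / 2 <= q)%R by rewrite le_max lexx orbT.
have bd : (0 <= 2 * lip_bound * d)%R by rewrite mulr_ge0// mulr_ge0// ltW.
have el : (0 <= e * l)%R by rewrite mulr_ge0// ltW.
have := ler_wpM2r bd q1; have := ler_wpM2r el q2.
have := ler_wpM2l (ltW e_gt0) rM; have := ler_wpM2r el thN; nra.
Qed.

Let blocks : exists N, exists e q : R, [/\ (0 < e)%R, (0 < q < 1)%R &
  forall v f d l, trajectory v f -> (0 <= d)%R -> (0 <= l)%R ->
    osc_le (f 0%N) d -> lip_le (f 0%N) l ->
    forall j, osc_le (f (j * N.+1)%N) (q ^+ j * (d + e * l))].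
Proof.
have [N [e /andP[e0 e1] He]] := block.
pose q : R := Num.max (1 - e / 2)%R ((1 + theta) / 2)%R.
have b2 : (0 < 2 * lip_bound)%R by rewrite mulr_gt0.
have q0 : (0 < q)%R.
  by rewrite lt_max; apply/orP; right; rewrite divr_gt0// addr_gt0.
exists N, (e / (2 * lip_bound))%R, q; split; first by rewrite divr_gt0.
  rewrite q0 gt_max; apply/andP; split; first by lra.
  by have := th1; lra.
move=> v f d l vf d0 l0 fd fl j.
suff [d' [l' [d'0 l'0 fd' _ dl]]] : exists d' l', [/\ (0 <= d')%R, (0 <= l')%R,
    osc_le (f (j * N.+1)%N) d', lip_le (f (j * N.+1)%N) l' &
    (2 * lip_bound * d' + e * l' <= q ^+ j * (2 * lip_bound * d + e * l))%R].
  move=> x y; apply: le_trans (fd' x y) _; rewrite lerD2l.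
  rewrite -(ler_pM2l b2); apply: (@le_trans _ _ (2 * lip_bound * d' + e * l')%R).
    by rewrite lerDl mulr_ge0// ltW.
  apply: le_trans dl _; rewrite [leRHS]mulrCA ler_pM2l ?exprn_gt0//.
  by rewrite mulrDr lerD2l mulrA mulrCA divff ?mulr1// gt_eqF.
elim: j => [|j [d' [l' [d'0 l'0 fd' fl' dl]]]].
  by exists d, l; split => //; rewrite mul1r.
have [d2 [l2 [d20 l20 fd2 fl2 dl2]]] := He _ _ _ _ _ vf d'0 l'0 fd' fl'.
exists d2, l2; split => //; try by rewrite mulSnr.
by apply: le_trans dl2 _; rewrite exprS -[leRHS]mulrA ler_wpM2l// ltW.
Qed.

Theorem trajectory_contraction : exists K rho : R,
  [/\ (0 < K)%R, (0 < rho < 1)%R & forall v f d l, trajectory v f ->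
    (0 <= d)%R -> (0 <= l)%R -> osc_le (f 0%N) d -> lip_le (f 0%N) l ->
    forall k, osc_le (f k) (K * (d + l) * rho ^+ k)].
Proof.
have [N [e [q [e0 /andP[q0 q1] He]]]] := blocks.
have N0 : (0 < N.+1%:R :> R)%R by rewrite ltr0n.
have N1 : (1 <= N.+1%:R :> R)%R by rewrite ler1n.
(* By Bernoulli's inequality [rho = 1 - u] satisfies [q <= rho ^+ N.+1], and so stands in for an
   [N.+1]-st root of [q]. *)
pose u : R := ((1 - q) / N.+1%:R)%R.
have u0 : (0 < u)%R by rewrite divr_gt0// subr_gt0.
have u1 : (u < 1)%R by rewrite ltr_pdivrMr// mul1r; lra.
pose rho : R := (1 - u)%R.
have r0 : (0 < rho)%R by rewrite subr_gt0.
have r1 : (rho < 1)%R by rewrite ltrBlDr ltrDl.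
have qr : (q <= rho ^+ N.+1)%R.
  apply: le_trans (@bernoulli_ineq R u N.+1 _); last by rewrite !ltW.
  by rewrite /u mulrC divfK ?gt_eqF//; lra.
(* Dividing by [rho ^+ N.+1] pays for the remainder of [k] modulo [N.+1], over which the oscillation
   is only known not to increase. *)
exists ((1 + e) / rho ^+ N.+1)%R, rho; split.
- by rewrite divr_gt0 ?exprn_gt0// addr_gt0.
- by rewrite r0.
move=> v f d l vf d0 l0 fd fl k.
have kE := divn_eq k N.+1; set j := (k %/ N.+1)%N in kE.
have := He v f d l vf d0 l0 fd fl j.
move=> /(trajectory_osc_le vf (k %% N.+1)); rewrite -kE => fk x y.
apply: le_trans (fk x y) _; rewrite lerD2l.
have rk : (q ^+ j <= rho ^+ k / rho ^+ N.+1)%R.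
  rewrite ler_pdivlMr ?exprn_gt0//.
  apply: (@le_trans _ _ (rho ^+ (j * N.+1)%N * rho ^+ N.+1)%R).
    apply: ler_wpM2r; first by rewrite exprn_ge0// ltW.
    rewrite mulnC exprM; apply: lerXn2r => //; rewrite nnegrE ?exprn_ge0//.
      exact: ltW.
    exact: ltW.
  rewrite -exprD; apply: ler_wiXn2l; [exact: ltW|exact: ltW|].
  by rewrite kE leq_add2l ltnW// ltn_mod.
have del : (d + e * l <= (1 + e) * (d + l))%R.
  by have := mulr_ge0 (ltW e0) d0; nra.
have dl0 : (0 <= d + e * l)%R by rewrite addr_ge0// mulr_ge0// ltW.
apply: le_trans (ler_wpM2r dl0 rk) _.
rewrite [leRHS](_ : _ = rho ^+ k / rho ^+ N.+1 * ((1 + e) * (d + l)))%R; last by ring.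
by apply: ler_wpM2l => //; rewrite divr_ge0// exprn_ge0// ltW.
Qed.

End contraction.

(** * The eigenfunction *)

Lemma le_of_geometric (R : realType) (rho a b g : R) : (0 < rho < 1)%R ->
  (forall n, a <= b + g * rho ^+ n)%R -> (a <= b)%R.
Proof.
move=> /andP[r0 r1] H; rewrite leNgt; apply/negP => ba.
have : (g * rho ^+ n)%R @[n --> \oo] --> (g * 0 : R)%R.
  by apply: cvgMr; apply: cvg_expr; rewrite gtr0_norm.
have e0 : (0 < a - b)%R by rewrite subr_gt0.
rewrite mulr0 => /cvgrPdist_lt/(_ _ e0)[n _ /(_ n (leqnn n))] /=.
rewrite sub0r normrN => /(le_lt_trans (ler_norm _)).
by rewrite ltNge => /negP; apply; rewrite lerBlDl; exact: H.
Qed.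

Lemma geometric_limit (R : realType) (rho g : R) (u : nat -> R) :
  (0 < rho < 1)%R ->
  (forall n, `|u n.+1 - u n| <= g * rho ^+ n)%R ->
  exists l, (forall n, `|l - u n| <= g / (1 - rho) * rho ^+ n)%R.
Proof.
move=> /andP[r0 r1] ug; pose E : R := (g / (1 - rho))%R.
have r1' : (0 < 1 - rho)%R by rewrite subr_gt0.
have EE n : (E * rho ^+ n - E * rho ^+ n.+1 = g * rho ^+ n)%R.
  by rewrite /E exprS; field; rewrite gt_eqF.
(* The intervals from [a n] to [b n] are nested, since [E] turns [g * rho ^+ n] into a telescoping
   difference; the limit is their common point. *)
pose a n : R := (u n - E * rho ^+ n)%R; pose b n : R := (u n + E * rho ^+ n)%R.
have aS n k : (a n <= a (n + k)%N)%R.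
  elim: k => [|k IHk]; first by rewrite addn0.
  apply: le_trans IHk _; rewrite addnS /a; have := ug (n + k)%N.
  by rewrite ler_norml => /andP[+ _]; have := EE (n + k)%N; lra.
have bS n k : (b (n + k)%N <= b n)%R.
  elim: k => [|k IHk]; first by rewrite addn0.
  apply: le_trans IHk; rewrite addnS /b; have := ug (n + k)%N.
  by rewrite ler_norml => /andP[_ +]; have := EE (n + k)%N; lra.
have E0 : (0 <= E)%R.
  have := ug 0%N; rewrite expr0 mulr1 => /(le_trans (normr_ge0 _)) g0.
  by rewrite divr_ge0// ltW.
have ab n k : (a n <= b k)%R.
  apply: le_trans (aS n k) _; apply: le_trans (bS k n); rewrite [(k + n)%N]addnC.
  have : (0 <= E * rho ^+ (n + k))%R by rewrite mulr_ge0// exprn_ge0// ltW.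
  by rewrite /a /b; lra.
have ua k : ubound (range a) (b k) by move=> _ [n _ <-].
exists (sup (range a)) => n; rewrite ler_norml; apply/andP; split.
  have : (a n <= sup (range a))%R.
    by apply: ub_le_sup; [exists (b 0%N); exact: ua|exists n].
  by rewrite /a -/E; lra.
have : (sup (range a) <= b n)%R.
  by apply: ge_sup; [exists (a 0%N); exists 0%N|exact: ua].
by rewrite /b -/E; lra.
Qed.

Section gibbs_data.
Context (S : countType) (t : rel S) (X0 : admissible t !=set0) (R : realType).
Local Notation X := (markov_shift X0).
Local Notation T := (@left_shift S t X0).
Local Notation cyl := (@cylinder S t X0).

(* A Gibbs measure for a potential of pressure zero, the Gibbs property being
   also required of the empty word. *)
Record gibbs_data (psi : X -> R) (m : probability X R) (theta A C : R) : Prop :=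
  GibbsData {
    gibbs_theta : (0 < theta < 1)%R;
    gibbs_holder_ge0 : (0 <= A)%R;
    gibbs_holder : forall k x y, (0 < k)%N -> agree_upto k x y ->
      (psi x <= psi y + A * theta ^+ k)%R;
    gibbs_const : (1 <= C)%R;
    gibbs_le : forall a x, cyl a x ->
      (mass m a <= C * expR (birkhoff psi (size a) x))%R;
    gibbs_ge : forall a x, cyl a x ->
      (expR (birkhoff psi (size a) x) <= C * mass m a)%R;
    gibbs_invariant : invariant_measure T m;
    gibbs_mixing : topologically_mixing T }.

End gibbs_data.

Section eigenfunction.
Context (S : countType) (t : rel S) (X0 : admissible t !=set0) (R : realType).
Local Notation X := (markov_shift X0).
Local Notation T := (@left_shift S t X0).
Local Notation cyl := (@cylinder S t X0).
Implicit Types (x y z : X) (s : S) (w : seq S).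
Variable (psi : X -> R) (m : probability X R) (theta A C : R).
Hypothesis G : gibbs_data psi m theta A C.
Local Notation L := (transfer psi).
Local Notation B := (distortion theta A).
Local Notation c2 := (upper_bound theta A C).

Lemma gibbs_continuous : continuous psi.
Proof. by case: G => th A0 hol *; exact: (psi_continuous th A0 hol). Qed.

Lemma gibbs_measurable : measurable_fun setT psi.
Proof. exact: measurable_fun_continuous gibbs_continuous. Qed.

Lemma gibbs_upper_bound_gt0 : (0 < c2)%R.
Proof. by case: G => *; exact: upper_bound_gt0. Qed.

Lemma gibbs_transfer_one_le n x : iter n L (fun=> 1) x <= c2%:E.
Proof. by case: G => th A0 hol C1 gl gg inv mix; exact: (transfer_one_le th A0 hol C1 gl gg inv). Qed.

Lemma gibbs_le_transfer_one n x : c2^-1%:E <= iter n L (fun=> 1) x.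
Proof. by case: G => th A0 hol C1 gl gg inv mix; exact: (le_transfer_one th A0 hol C1 gl gg inv). Qed.

Lemma gibbs_minorization w : cyl w !=set0 ->
  exists N, exists2 e : R, (0 < e)%R & forall x,
    e%:E <= iter N.+1 L (fun z => (\1_(cyl w) z)%:E) x.
Proof.
case: (G) => th A0 hol C1 gl gg inv mix w0.
apply: (exists_minorization C1 gg gl (c := c2^-1%R)) => //.
  by rewrite invr_gt0 gibbs_upper_bound_gt0.
by move=> x; exact: (gibbs_le_transfer_one 1).
Qed.

Lemma gibbs_contraction : exists K rho : R,
  [/\ (0 < K)%R, (0 < rho < 1)%R & forall v f d l,
    trajectory psi theta A c2 v f ->
    (0 <= d)%R -> (0 <= l)%R -> osc_le (f 0%N) d -> lip_le theta (f 0%N) l ->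
    forall k, osc_le (f k) (K * (d + l) * rho ^+ k)].
Proof.
case: (G) => th A0 hol C1 gl gg inv mix.
apply: (trajectory_contraction th A0 hol gibbs_upper_bound_gt0).
exact: gibbs_minorization.
Qed.

Lemma log_holder_lip (f : X -> R) b : (forall x, 0 <= f x <= b)%R ->
  log_holder theta A (fun x => (f x)%:E) -> lip_le theta f (B * expR B * b).
Proof.
case: (G) => th A0 hol C1 gl gg inv mix fb hf k x y k0 xy.
have /andP[fy0 fyb] := fb y; have B0 := distortion_ge0 th A0.
have := hf k x y k0 xy; rewrite -EFinM lee_fin => fxy.
have /andP[t0 t1] := th.
have thk : (0 <= theta ^+ k)%R by rewrite exprn_ge0// ltW.
have thk1 : (theta ^+ k <= 1)%R by rewrite exprn_ile1// ltW.
apply: le_trans fxy _; rewrite -lerBlDl.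
rewrite -{2}[f y]mul1r -mulrBl; apply: (@le_trans _ _ ((B * theta ^+ k) * expR B * f y)%R).
  apply: ler_wpM2r => //; apply: le_trans (expR_sub1_le _) _.
  by apply: ler_wpM2l; [rewrite mulr_ge0|rewrite ler_expR ler_piMr].
rewrite [leRHS](_ : _ = B * theta ^+ k * expR B * b)%R; last by ring.
by apply: ler_wpM2l => //; rewrite mulr_ge0 ?expR_ge0// mulr_ge0.
Qed.

Definition hn (n : nat) x : R := fine (iter n L (fun=> 1) x).

Lemma hnE n x : iter n L (fun=> 1) x = (hn n x)%:E.
Proof.
rewrite /hn fineK// ge0_fin_numE; last exact: iter_transfer_ge0.
exact: le_lt_trans (gibbs_transfer_one_le n x) (ltry _).
Qed.

Lemma hn_bounds n x : (c2^-1 <= hn n x <= c2)%R.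
Proof.
by rewrite -!lee_fin -!hnE gibbs_le_transfer_one gibbs_transfer_one_le.
Qed.

Lemma transfer_hn n x : L (fun z => (hn n z)%:E) x = (hn n.+1 x)%:E.
Proof.
rewrite -hnE /=; congr (transfer _ _ _); apply/funext => z.
by rewrite hnE.
Qed.

Lemma hn_gt0 n x : (0 < hn n x)%R.
Proof.
have /andP[+ _] := hn_bounds n x; apply: lt_le_trans.
by rewrite invr_gt0 gibbs_upper_bound_gt0.
Qed.

Lemma log_holder_hn n : log_holder theta A (fun x => (hn n x)%:E).
Proof.
case: (G) => th A0 hol *; have := @log_holder_iter _ _ X0 _ psi theta A th hol n (fun=> 1).
rewrite (_ : iter n _ _ = fun x => (hn n x)%:E); last first.
  by apply/funext => x; rewrite hnE.
by apply => //; exact: log_holder1.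
Qed.

(** Makes the contraction available for the quotients of consecutive iterates although no
    eigenfunction is known yet. *)
Lemma trajectory_hn :
  trajectory psi theta A c2 hn (fun n x => hn n.+1 x / hn n x)%R.
Proof.
have h0 n x : (hn n x != 0)%R by rewrite gt_eqF// hn_gt0.
split; [exact: hn_bounds|exact: log_holder_hn|exact: transfer_hn| |].
  by move=> n x; rewrite divr_ge0// ltW// hn_gt0.
move=> n x; rewrite divfK// -transfer_hn; congr (transfer _ _ _).
by apply/funext => z; rewrite divfK.
Qed.

(** A uniform gain is preserved by the positive operator [L], so it would repeat at every later step
    and drive [hn] above [c2]. Linear growth is enough for the contradiction. *)
Let growth n (e : R) : (0 < e)%R -> ~ (forall x, (1 + e) * hn n x <= hn n.+1 x)%R.
Proof.
move=> e0 H; have c20 := gibbs_upper_bound_gt0.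
have e1 : (0 <= 1 + e)%R by rewrite addr_ge0// ltW.
have HL j x : ((1 + e) * hn (n + j) x <= hn (n + j).+1 x)%R.
  elim: j x => [|j IHj] x; first by rewrite addn0.
  rewrite addnS -lee_fin -[leRHS]transfer_hn EFinM -transfer_hn -transferZ.
    by apply: le_transfer => z; rewrite -EFinM lee_fin ?mulr_ge0// ltW// hn_gt0.
  by move=> z; rewrite lee_fin ltW// hn_gt0.
have Hj j x : ((1 + j%:R * e) * hn n x <= hn (n + j) x)%R.
  elim: j => [|j IHj]; first by rewrite mul0r addr0 mul1r addn0.
  rewrite addnS; apply: le_trans (HL j x); apply: le_trans (ler_wpM2l e1 IHj).
  rewrite mulrA; apply: ler_wpM2r; first by rewrite ltW// hn_gt0.
  rewrite -natr1; have : (0 <= j%:R * e * e)%R by rewrite !mulr_ge0// ltW.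
  nra.
have j0 : (0 <= c2 ^+ 2 / e)%R by rewrite divr_ge0 ?exprn_ge0// ltW.
have := archi_boundP j0; set j := Num.Def.archi_bound _.
rewrite ltr_pdivrMr// => jc.
have hj := Hj j point; have /andP[hlo _] := hn_bounds n point.
have /andP[_ hup] := hn_bounds (n + j) point.
have je : (0 <= 1 + j%:R * e)%R by rewrite addr_ge0// mulr_ge0// ltW.
have := le_trans (le_trans (ler_wpM2l je hlo) hj) hup.
by rewrite ler_pdivrMr// -expr2; lra.
Qed.

Let decay n (e : R) : (0 < e)%R -> ~ (forall x, (1 + e) * hn n.+1 x <= hn n x)%R.
Proof.
move=> e0 H; have c20 := gibbs_upper_bound_gt0.
have e1 : (0 <= 1 + e)%R by rewrite addr_ge0// ltW.
have HL j x : ((1 + e) * hn (n + j).+1 x <= hn (n + j) x)%R.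
  elim: j x => [|j IHj] x; first by rewrite addn0.
  rewrite addnS -lee_fin -[leRHS]transfer_hn EFinM -transfer_hn -transferZ.
    by apply: le_transfer => z; rewrite -EFinM lee_fin ?mulr_ge0// ltW// hn_gt0.
  by move=> z; rewrite lee_fin ltW// hn_gt0.
have Hj j x : ((1 + j%:R * e) * hn (n + j) x <= hn n x)%R.
  elim: j => [|j IHj]; first by rewrite mul0r addr0 mul1r addn0.
  apply: le_trans IHj; have je : (0 <= 1 + j%:R * e)%R.
    by rewrite addr_ge0// mulr_ge0// ltW.
  apply: le_trans (ler_wpM2l je (HL j x)).
  rewrite mulrA addnS; apply: ler_wpM2r; first by rewrite ltW// hn_gt0.
  rewrite -natr1; have : (0 <= j%:R * e * e)%R by rewrite !mulr_ge0// ltW.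
  nra.
have j0 : (0 <= c2 ^+ 2 / e)%R by rewrite divr_ge0 ?exprn_ge0// ltW.
have := archi_boundP j0; set j := Num.Def.archi_bound _.
rewrite ltr_pdivrMr// => jc.
have hj := Hj j point; have /andP[_ hup] := hn_bounds n point.
have /andP[hlo _] := hn_bounds (n + j) point.
have je : (0 <= 1 + j%:R * e)%R by rewrite addr_ge0// mulr_ge0// ltW.
have := le_trans (le_trans (ler_wpM2l je hlo) hj) hup.
by rewrite ler_pdivrMr// -expr2; lra.
Qed.

(** By [growth] and [decay] the quotients [hn n.+1 / hn n] can be neither all above 1 nor all below
    1 by a uniform margin, so each of them is within their oscillation of 1, and this oscillation
    decays geometrically. *)
Let cauchy : exists D rho : R, (0 < rho < 1)%R /\
  forall n x, (`|hn n.+1 x - hn n x| <= D * rho ^+ n)%R.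
Proof.
have [K [rho [K0 r01 HK]]] := gibbs_contraction.
have [th A0 _ _ _ _ _ _] := G; have B0 := distortion_ge0 th A0.
have c20 := gibbs_upper_bound_gt0.
have h0E x : hn 0 x = 1%R by rewrite /hn.
pose l := (B * expR B * c2)%R.
have l0 : (0 <= l)%R by rewrite mulr_ge0 ?(ltW c20)// mulr_ge0// expR_ge0.
pose E n := (K * (c2 + l) * rho ^+ n)%R.
have r_osc n : osc_le (fun x => hn n.+1 x / hn n x)%R (E n).
  apply: (HK _ _ _ _ trajectory_hn); rewrite ?(ltW c20)//.
  - move=> x y; rewrite !h0E !divr1; have /andP[_ hx] := hn_bounds 1 x.
    by apply: le_trans hx _; rewrite lerDr ltW// hn_gt0.
  - have := @log_holder_lip (hn 1) c2; rewrite /lip_le => H k x y k0 xy.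
    rewrite !h0E !divr1; apply: H => //.
      by move=> z; rewrite ltW ?hn_gt0//; have /andP[_ ->] := hn_bounds 1 z.
    exact: log_holder_hn.
exists (c2 * (K * (c2 + l)))%R, rho; split => // n x.
have hx0 := hn_gt0 n x; have /andP[_ hx2] := hn_bounds n x.
have E0 : (0 <= E n)%R.
  have /andP[/ltW r0 _] := r01.
  by rewrite mulr_ge0 ?exprn_ge0// mulr_ge0 ?addr_ge0// ltW.
have rE : (hn n.+1 x - hn n x = hn n x * (hn n.+1 x / hn n x - 1))%R.
  by rewrite mulrBr mulrCA divff ?mulr1// gt_eqF.
rewrite rE normrM gtr0_norm// -mulrA; apply: ler_pM => //; first exact: ltW.
rewrite -/(E n) ler_norml; apply/andP; split; rewrite leNgt; apply/negP => Hx.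
- apply: (@decay n (1 - E n - hn n.+1 x / hn n x)%R); first by lra.
  move=> y; have := r_osc n y x; set ry := (hn n.+1 y / hn n y)%R.
  have -> : hn n.+1 y = (ry * hn n y)%R by rewrite /ry divfK// gt_eqF// hn_gt0.
  have ry0 : (0 <= ry)%R by rewrite divr_ge0// ltW// hn_gt0.
  move=> ryx; rewrite mulrA -[leRHS]mul1r; apply: ler_wpM2r.
    by rewrite ltW// hn_gt0.
  set e := (1 - E n - _)%R; have ry1 : (ry <= 1 - e)%R by rewrite /e; lra.
  have e1 : (0 <= 1 + e)%R by rewrite /e; lra.
  by have := ler_wpM2l e1 ry1; have := sqr_ge0 e; nra.
- apply: (@growth n (hn n.+1 x / hn n x - E n - 1)%R); first by lra.
  move=> y; have ryx := r_osc n x y; rewrite -ler_pdivlMr ?hn_gt0//.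
  by lra.
Qed.

Theorem exists_eigenfunction : exists h : X -> R,
  [/\ forall x, (c2^-1 <= h x <= c2)%R, log_holder theta A (fun x => (h x)%:E) &
      forall x, L (fun z => (h z)%:E) x = (h x)%:E].
Proof.
have [D [rho [r01 HD]]] := cauchy; have c20 := gibbs_upper_bound_gt0.
have [h hlim] := choice (fun x => geometric_limit r01 (fun n => HD n x)).
pose E := (D / (1 - rho))%R.
have hup x n : (h x <= hn n x + E * rho ^+ n)%R.
  by have := hlim x n; rewrite ler_norml => /andP[_]; rewrite /E; lra.
have hlo x n : (hn n x <= h x + E * rho ^+ n)%R.
  by have := hlim x n; rewrite ler_norml => /andP[+ _]; rewrite /E; lra.
have /andP[r0 r1] := r01.
have hc2 x : (c2^-1 <= h x)%R.
  apply: (@le_of_geometric _ rho _ _ E r01) => n; apply: le_trans (hlo x n).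
  by have /andP[] := hn_bounds n x.
have h0 x : (0 <= h x)%R by apply: le_trans (hc2 x); rewrite invr_ge0 ltW.
have E0 : (0 <= E)%R.
  by have := hlim point 0%N; rewrite expr0 mulr1; exact: le_trans.
exists h; split.
- move=> x; rewrite hc2/=; apply: (@le_of_geometric _ rho _ _ E r01) => n.
  apply: le_trans (hup x n) _; rewrite lerD2r.
  by have /andP[] := hn_bounds n x.
- move=> k x y k0 xy; rewrite -EFinM lee_fin; set e := expR _.
  apply: (@le_of_geometric _ rho _ _ (E + e * E)%R r01) => n.
  have := @log_holder_hn n k x y k0 xy; rewrite -EFinM lee_fin -/e => hxy.
  apply: le_trans (hup x n) _; apply: le_trans (lerD hxy (lexx _)) _.
  have := ler_wpM2l (expR_ge0 (B * theta ^+ k)) (hlo y n); rewrite -/e.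
  by lra.
- have Er n : (0 <= E * rho ^+ n)%R by rewrite mulr_ge0// exprn_ge0// ltW.
  (* The error [E * rho ^+ n] is uniform and [L 1 <= c2], so [L] passes to the limit without a
     convergence theorem. *)
  have LE n x : L (fun=> (E * rho ^+ n)%:E * 1) x <= (E * rho ^+ n * c2)%:E.
    rewrite transferZ// [leRHS]EFinM lee_wpmul2l ?lee_fin//.
    exact: (gibbs_transfer_one_le 1).
  have up n x : L (fun z => (h z)%:E) x <=
      (h x + (E * rho + E * c2) * rho ^+ n)%:E.
    apply: (@le_trans _ _ (L (fun z => (hn n z)%:E + (E * rho ^+ n)%:E * 1) x)).
      apply: le_transfer => z; first by rewrite lee_fin.
      by rewrite mule1 -EFinD lee_fin.
    rewrite transferD => [|z|z]; last 2 first.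
    - by rewrite lee_fin ltW// hn_gt0.
    - by rewrite mule1 lee_fin.
    apply: le_trans (leeD2l _ (LE n x)) _; rewrite transfer_hn -EFinD lee_fin.
    by have := hlo x n.+1; rewrite exprS; lra.
  have low n x : (hn n.+1 x)%:E <= L (fun z => (h z)%:E) x + (E * rho ^+ n * c2)%:E.
    apply: le_trans (leeD2l _ (LE n x)).
    rewrite -transferD => [|z|z]; last 2 first.
    - by rewrite lee_fin.
    - by rewrite mule1 lee_fin.
    rewrite -transfer_hn; apply: le_transfer => z.
      by rewrite lee_fin ltW// hn_gt0.
    by rewrite mule1 -EFinD lee_fin.
  move=> x; have Lfin : L (fun z => (h z)%:E) x \is a fin_num.
    rewrite ge0_fin_numE; first exact: le_lt_trans (up 0%N x) (ltry _).
    by apply: transfer_ge0 => z; rewrite lee_fin.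
  rewrite -(fineK Lfin); congr (_%:E); apply/eqP; rewrite eq_le; apply/andP; split.
    apply: (@le_of_geometric _ rho _ _ (E * rho + E * c2) r01) => n.
    by rewrite -lee_fin fineK//; exact: up.
  apply: (@le_of_geometric _ rho _ _ (E * rho + E * c2) r01) => n.
  have := low n x; rewrite -{1}(fineK Lfin) -EFinD lee_fin.
  by have := hup x n.+1; rewrite exprS; lra.
Qed.

End eigenfunction.

(** * Equidistribution *)

Lemma bounded_integrable d (Y : measurableType d) (R : realType)
    (mu : probability Y R) (f : Y -> R) (b : R) :
  measurable_fun setT f -> (forall x, `|f x| <= b)%R ->
  mu.-integrable setT (EFin \o f).
Proof.
move=> mf fb; apply: (le_integrable measurableT (g := EFin \o cst b)).
- exact/measurable_EFinP.
- by move=> x _; rewrite /= lee_fin (le_trans (fb x))// ler_norm.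
- exact: finite_measure_integrable_cst.
Qed.

Lemma Rintegral_probability_cst d (Y : measurableType d) (R : realType)
    (mu : probability Y R) (c : R) : (\int[mu]_x c)%R = c.
Proof.
rewrite Rintegral_cst//; have -> : fine (mu setT) = 1%R by rewrite probability_setT.
by rewrite mulr1.
Qed.

Lemma ln_ge_quadratic (R : realType) (x : R) : (0 <= x)%R ->
  (x - x ^+ 2 <= ln (1 + x))%R.
Proof.
move=> x0; have x1 : (0 < 1 + x)%R by rewrite ltr_wpDr.
have -> : ln (1 + x) = (- ln (1 + (- (x / (1 + x)))))%R.
  rewrite -lnV ?posrE; last first.
    by rewrite subr_gt0 ltr_pdivrMr// mul1r ltrDr.
  by congr ln; field; rewrite gt_eqF//=; apply/eqP; lra.
rewrite lerNr; apply: le_trans (le_ln1Dx _) _.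
  by rewrite ltrN2 ltr_pdivrMr// mul1r ltrDr.
rewrite lerN2 ler_pdivlMr// expr2.
have : (0 <= x * x * x)%R by rewrite !mulr_ge0.
by nra.
Qed.

Lemma Rintegral_shift (S : countType) (t : rel S) (X0 : admissible t !=set0)
    (R : realType) (m : probability (markov_shift X0) R)
    (f : markov_shift X0 -> R) b :
  invariant_measure (@left_shift S t X0) m -> measurable_fun setT f ->
  (forall x, `|f x| <= b)%R -> (\int[m]_x f (left_shift x) = \int[m]_x f x)%R.
Proof.
move=> inv mf fb; set T := @left_shift S t X0; rewrite /Rintegral; congr fine.
have mT := @measurable_left_shift S t X0.
have mfT : measurable_fun setT (f \o T) by exact: measurableT_comp mT.
have intfT : m.-integrable (T @^-1` setT) ((EFin \o f) \o T).
  by rewrite preimage_setT; apply: (@bounded_integrable _ _ _ m (f \o T) b) => // x; exact: fb.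
have := integral_pushforward mT (_ : measurable_fun setT (EFin \o f)) intfT measurableT.
rewrite preimage_setT => <-; last exact/measurable_EFinP.
apply: eq_measure_integral => E mE _; rewrite /pushforward.
exact: inv.
Qed.

Section normalized_operator.
Context (S : countType) (t : rel S) (X0 : admissible t !=set0) (R : realType).
Local Notation X := (markov_shift X0).
Local Notation T := (@left_shift S t X0).
Local Notation cyl := (@cylinder S t X0).
Implicit Types (x y z : X) (s : S) (w : seq S).
Variable (psi : X -> R) (m : probability X R) (theta A C : R).
Hypothesis G : gibbs_data psi m theta A C.
Local Notation L := (transfer psi).
Local Notation B := (distortion theta A).
Local Notation c2 := (upper_bound theta A C).
Variable h : X -> R.
Hypothesis h_bounds : forall x, (c2^-1 <= h x <= c2)%R.
Hypothesis h_log : log_holder theta A (fun x => (h x)%:E).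
Hypothesis hL : forall x, L (fun z => (h z)%:E) x = (h x)%:E.

Lemma continuous_left_shift : continuous T.
Proof.
apply/continuousP => U oU; apply: open_agree => x Ux.
have [k kU] := agree_open oU Ux.
by exists k.+1 => y /agree_shift/kU.
Qed.

Lemma lip_le_continuous (f : X -> R) l : (0 <= l)%R -> lip_le theta f l ->
  continuous f.
Proof.
case: (G) => th A0 _ _ _ _ _ _ l0 fl.
apply: (psi_continuous th l0) => k x y k0 xy.
exact: fl.
Qed.

Let c20 : (0 < c2)%R. Proof. exact: gibbs_upper_bound_gt0 G. Qed.

Lemma eigen_gt0 x : (0 < h x)%R.
Proof.
by have /andP[+ _] := h_bounds x; apply: lt_le_trans; rewrite invr_gt0.
Qed.

Let h0 x : (0 <= h x)%R. Proof. exact/ltW/eigen_gt0. Qed.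

(** [fine] keeps [Q] real-valued; by [QopE] it does not alter the value when [f] is nonnegative and
    bounded. *)
Definition Qop (f : X -> R) x : R :=
  (fine (L (fun z => (f z * h z)%:E) x) / h x)%R.

Lemma QopE f b x : (forall z, 0 <= f z <= b)%R ->
  L (fun z => (f z * h z)%:E) x = (Qop f x * h x)%:E.
Proof.
move=> fb; rewrite /Qop divfK ?gt_eqF ?eigen_gt0// fineK//.
have f0 z : (0 <= f z)%R by have /andP[] := fb z.
rewrite ge0_fin_numE; last first.
  by apply: transfer_ge0 => z; rewrite lee_fin mulr_ge0.
apply: (@le_lt_trans _ _ (L (fun z => b%:E * (h z)%:E) x)).
  apply: le_transfer => z; first by rewrite lee_fin mulr_ge0.
  by rewrite -EFinM lee_fin ler_wpM2r//; have /andP[] := fb z.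
rewrite transferZ => [|z]; last by rewrite lee_fin.
by rewrite hL -EFinM ltry.
Qed.

Let Qop_eq f g b x : (forall z, 0 <= f z <= b)%R ->
  L (fun z => (f z * h z)%:E) x = (g * h x)%:E -> Qop f x = g.
Proof.
move=> fb; rewrite (QopE x fb) => -[] /eqP.
by rewrite (inj_eq (mulIf (lt0r_neq0 (eigen_gt0 x)))) => /eqP.
Qed.

Lemma Qop_ge0 f b x : (forall z, 0 <= f z <= b)%R -> (0 <= Qop f x)%R.
Proof.
move=> fb; rewrite -(pmulr_lge0 _ (eigen_gt0 x)) -lee_fin -(QopE x fb).
by apply: transfer_ge0 => z; rewrite lee_fin mulr_ge0//; have /andP[] := fb z.
Qed.

(** Linearity is stated in the two forms, here and in [QopB], that keep all functions nonnegative
    and bounded, as [QopE] requires. *)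
Lemma QopDZ f b (a c : R) x : (0 <= a)%R -> (0 <= c)%R ->
  (forall z, 0 <= f z <= b)%R ->
  Qop (fun z => a + c * f z)%R x = (a + c * Qop f x)%R.
Proof.
move=> a0 c0 fb; have f0 z : (0 <= f z)%R by have /andP[] := fb z.
apply: (@Qop_eq _ _ (a + c * b)%R).
  by move=> z; have /andP[? ?] := fb z; rewrite addr_ge0 ?mulr_ge0//= lerD2l ler_wpM2l.
transitivity (L (fun z => a%:E * (h z)%:E + c%:E * (f z * h z)%:E) x).
  by congr (transfer _ _ _); apply/funext => z; rewrite mulrDl EFinD -mulrA !EFinM.
rewrite transferD => [|z|z]; last 2 first.
- by rewrite mule_ge0 ?lee_fin.
- by rewrite mule_ge0 ?lee_fin// mulr_ge0.
rewrite !transferZ => [|z|z]; try by rewrite lee_fin ?mulr_ge0.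
by rewrite hL (QopE x fb) -!EFinM -EFinD mulrDl mulrA.
Qed.

Lemma QopB f b x : (forall z, 0 <= f z <= b)%R ->
  Qop (fun z => b - f z)%R x = (b - Qop f x)%R.
Proof.
move=> fb; have f0 z : (0 <= f z)%R by have /andP[] := fb z.
have bf z : (0 <= b - f z <= b)%R.
  by have /andP[? ?] := fb z; rewrite subr_ge0 lerBlDr lerDl; apply/andP.
have b0 : (0 <= b)%R by have /andP[/le_trans] := fb point; apply.
have : (Qop f x * h x)%:E + (Qop (fun z => b - f z)%R x * h x)%:E = (b * h x)%:E.
  rewrite -(QopE x fb) -(QopE x bf) -transferD => [|z|z]; last 2 first.
  - by rewrite lee_fin mulr_ge0.
  - by rewrite lee_fin mulr_ge0//; have /andP[] := bf z.
  transitivity (L (fun z => b%:E * (h z)%:E) x).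
    congr (transfer _ _ _); apply/funext => z.
    by rewrite -EFinD -EFinM -mulrDl subrKC.
  by rewrite transferZ ?hL// => z; rewrite lee_fin.
rewrite -EFinD -mulrDl => -[] /eqP.
by rewrite (inj_eq (mulIf (lt0r_neq0 (eigen_gt0 x)))) => /eqP; lra.
Qed.

Lemma Qop_le f b x : (forall z, 0 <= f z <= b)%R -> (Qop f x <= b)%R.
Proof.
move=> fb; rewrite -subr_ge0 -(QopB x fb); apply: (@Qop_ge0 _ b) => z.
by have /andP[? ?] := fb z; rewrite subr_ge0 lerBlDr lerDl; apply/andP.
Qed.

Lemma iter_Qop_bounds f b n x : (forall z, 0 <= f z <= b)%R ->
  (0 <= iter n Qop f x <= b)%R.
Proof.
move=> fb; elim: n x => [//|n IHn] x.
by rewrite iterS (Qop_ge0 x IHn) (Qop_le x IHn).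
Qed.

Lemma iter_QopDZ f b (a c : R) n : (0 <= a)%R -> (0 <= c)%R ->
  (forall z, 0 <= f z <= b)%R ->
  iter n Qop (fun z => a + c * f z)%R = (fun x => a + c * iter n Qop f x)%R.
Proof.
move=> a0 c0 fb; elim: n => [//|n IHn]; apply/funext => x; rewrite iterS IHn.
by rewrite (@QopDZ _ b)// => z; exact: iter_Qop_bounds.
Qed.

Lemma iter_QopB f b n : (forall z, 0 <= f z <= b)%R ->
  iter n Qop (fun z => b - f z)%R = (fun x => b - iter n Qop f x)%R.
Proof.
move=> fb; elim: n => [//|n IHn]; apply/funext => x; rewrite iterS IHn.
by rewrite (@QopB _ b)// => z; exact: iter_Qop_bounds.
Qed.

Lemma trajectory_Qop f b : (forall z, 0 <= f z <= b)%R ->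
  trajectory psi theta A c2 (fun=> h) (fun n => iter n Qop f).
Proof.
move=> fb; split => //.
  by move=> k x; have /andP[] := iter_Qop_bounds k x fb.
by move=> k x; rewrite (@QopE _ b)// => z; exact: iter_Qop_bounds.
Qed.

Lemma Qop_contraction : exists K rho : R,
  [/\ (0 < K)%R, (0 < rho < 1)%R & forall f b l,
    (forall z, 0 <= f z <= b)%R -> (0 <= l)%R -> lip_le theta f l ->
    forall k, osc_le (iter k Qop f) (K * (b + l) * rho ^+ k)].
Proof.
have [K [rho [K0 r01 HK]]] := gibbs_contraction G.
exists K, rho; split => // f b l fb l0 fl.
have b0 : (0 <= b)%R by have /andP[/le_trans] := fb point; apply.
apply: (HK _ _ _ _ (trajectory_Qop fb)) => //.
by apply: (@bounds_osc_le _ _ _ _ _ 0%R) => z; rewrite add0r; exact: fb.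
Qed.

Lemma iter_Qop_lip f b l n : (forall z, 0 <= f z <= b)%R -> (0 <= l)%R ->
  lip_le theta f l ->
  exists2 l', (0 <= l')%R & lip_le theta (iter n Qop f) l'.
Proof.
case: (G) => th A0 hol _ _ _ _ _ fb l0 fl.
have b0 : (0 <= b)%R by have /andP[/le_trans] := fb point; apply.
have osc0 : osc_le (iter 0 Qop f) b.
  by apply: (@bounds_osc_le _ _ _ _ _ 0%R) => z; rewrite add0r; exact: fb.
have fl0 : lip_le theta (iter 0 Qop f) l by [].
have cl := lip_const_ge1 th A0; have /andP[t0 t1] := th.
exists (theta ^+ n * l + lip_const theta A / (1 - theta) * b)%R; last first.
  exact: (trajectory_lip_iter th A0 hol c20 (trajectory_Qop fb) (k := 0) n b0 l0 osc0 fl0).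
rewrite addr_ge0// mulr_ge0// ?exprn_ge0 ?(ltW t0)// divr_ge0//.
  exact: le_trans cl.
by rewrite subr_ge0 ltW.
Qed.

Lemma Rintegral_birkhoff (f : X -> R) b n : measurable_fun setT f ->
  (forall x, `|f x| <= b)%R ->
  [/\ measurable_fun setT (birkhoff f n),
      forall x, (`|birkhoff f n x| <= n%:R * b)%R &
      (\int[m]_x birkhoff f n x = n%:R * \int[m]_x f x)%R].
Proof.
move=> mf fb; elim: n => [|n [IH1 IH2 IH3]].
  have -> : birkhoff f 0 = fun=> 0%R by apply/funext => x; rewrite /birkhoff big_ord0.
  split; [exact: measurable_cst|by move=> x; rewrite normr0 mul0r|].
  by rewrite mul0r Rintegral_probability_cst.
have -> : birkhoff f n.+1 = (f \+ (birkhoff f n \o T))%R.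
  by apply/funext => x; rewrite birkhoffS.
have mB : measurable_fun setT (birkhoff f n \o T).
  exact: measurableT_comp (@measurable_left_shift S t X0).
have nS : (n.+1%:R * b = b + n%:R * b)%R by rewrite -natr1 mulrDl mul1r addrC.
split; first exact: measurable_funD.
  move=> x; rewrite nS; apply: le_trans (ler_normD _ _) _.
  by apply: lerD => //; exact: IH2.
rewrite RintegralD//; first last.
- by apply: (@bounded_integrable _ _ _ _ _ (n%:R * b)%R) => // x; exact: IH2.
- exact: bounded_integrable fb.
rewrite /= (Rintegral_shift (gibbs_invariant G) IH1 IH2) IH3; lra.
Qed.

Lemma birkhoff_continuous (f : X -> R) n : continuous f ->
  continuous (birkhoff f n).
Proof.
move=> cf; elim: n => [|n IHn].
  have -> : birkhoff f 0 = fun=> 0%R by apply/funext => x; rewrite /birkhoff big_ord0.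
  exact: cst_continuous.
have -> : birkhoff f n.+1 = (f \+ (birkhoff f n \o T))%R.
  by apply/funext => x; rewrite birkhoffS.
move=> x; apply: (@cvgD R R X (nbhs x) (nbhs_filter x) _ _ _ _ (cf x)).
apply: continuous_comp; [exact: continuous_left_shift|exact: IHn].
Qed.

Lemma continuous_ln_ge1 (u : X -> R) : continuous u -> (forall x, 1 <= u x)%R ->
  continuous (fun x => ln (u x)).
Proof.
move=> cu u1 x; apply: continuous_comp; first exact: cu.
by apply: continuous_ln; exact: lt_le_trans (u1 x).
Qed.

Let ln_bounds (v b : R) : (1 <= v <= b)%R -> (`|ln v| <= ln b)%R.
Proof.
move=> /andP[v1 vb]; have b1 := le_trans v1 vb.
rewrite ger0_norm ?ln_ge0// ler_ln// posrE; exact: lt_le_trans ltr01 _.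
Qed.

(* With [Y = u / (Qop u \o T)] the products [P_n] of the [Y \o T^i], [i < n],
   satisfy [Q^n P_n = 1]; the Gibbs property bounds their integrals uniformly in
   [n], whereas by Jensen's inequality these are at least
   [exp (n * \int ln Y)]. *)
Lemma Rintegral_ln_le_Qop (u : X -> R) b l : (forall x, 1 <= u x <= b)%R ->
  (0 <= l)%R -> lip_le theta u l ->
  (\int[m]_x ln (u x) <= \int[m]_x ln (Qop u x))%R.
Proof.
move=> ub l0 ul; have u1 x : (1 <= u x)%R by have /andP[] := ub x.
have ub0 x : (0 <= u x <= b)%R.
  by have /andP[ux ->] := ub x; rewrite (le_trans ler01 ux).
have b1 : (1 <= b)%R by have /andP[/le_trans] := ub point; apply.
have Qb x : (1 <= Qop u x <= b)%R.
  rewrite (Qop_le x ub0) andbT.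
  have uE : u = fun z => (1 + 1 * (u z - 1))%R by apply/funext => z; lra.
  have v0 z : (0 <= u z - 1 <= b)%R.
    by have /andP[? ?] := ub z; apply/andP; split; lra.
  by rewrite uE (QopDZ _ _ _ v0)// mul1r lerDl (Qop_ge0 x v0).
have Q1 x : (1 <= Qop u x)%R by have /andP[] := Qb x.
have cu : continuous u := lip_le_continuous l0 ul.
have [l' l'0 Ql] := iter_Qop_lip 1 ub0 l0 ul.
have cQ : continuous (Qop u) := lip_le_continuous l'0 Ql.
pose y x := (ln (u x) - ln (Qop u (T x)))%R.
have clu := continuous_ln_ge1 cu u1; have clQ := continuous_ln_ge1 cQ Q1.
have cy : continuous y.
  move=> x; apply: (@cvgB R R X (nbhs x) (nbhs_filter x) _ _ _ _ (clu x)).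
  apply: (@continuous_comp _ _ _ T (fun z => ln (Qop u z))).
    exact: continuous_left_shift.
  exact: clQ.
have lnb0 : (0 <= ln b)%R by exact: ln_ge0.
have yb x : (`|y x| <= ln b + ln b)%R.
  by apply: le_trans (ler_normB _ _) _; apply: lerD; apply: ln_bounds.
have my := measurable_fun_continuous cy.
pose P n x := expR (birkhoff y n x).
have PS n x : P n.+1 x = (u x / Qop u (T x) * P n (T x))%R.
  rewrite /P birkhoffS expRD; congr (_ * _)%R.
  by rewrite /y expRD expRN !lnK// posrE; exact: lt_le_trans ltr01 _.
have Pge0 n x : (0 <= P n x)%R by exact: expR_ge0.
have LP n x : iter n L (fun z => (P n z * h z)%:E) x = (h x)%:E.
  elim: n x => [|n IHn] x; first by rewrite /P /birkhoff /= big_ord0 expR0 mul1r.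
  rewrite iterSr (_ : L _ = fun z => (P n z * h z)%:E) ?IHn//.
  apply/funext => z; transitivity
      (L (fun v => (P n (T v) / Qop u (T v))%:E * (u v * h v)%:E) z).
    congr (transfer _ _ _); apply/funext => v; rewrite PS -EFinM.
    by congr (_%:E); rewrite mulrA; congr (_ * _)%R; ring.
  rewrite (transfer_shift psi (fun v => P n v / Qop u v)%R) => [|v]; last first.
    by rewrite lee_fin mulr_ge0//; have /andP[] := ub0 v.
  rewrite (QopE z ub0) -EFinM; congr (_%:E); rewrite mulrA divfK//.
  by rewrite gt_eqF//; exact: lt_le_trans ltr01 _.
pose K : R := (C ^+ 4 * (c2 * c2))%R.
have [th A0 hol C1 gl gg inv mix] := G.
have C4 : (0 < C ^+ 4)%R by rewrite exprn_gt0//; exact: lt_le_trans ltr01 _.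
have K0 : (0 < K)%R by rewrite mulr_gt0// mulr_gt0.
have mpsi := gibbs_measurable G.
have intP n : \int[m]_x (P n x)%:E <= K%:E.
  have cP : continuous (P n).
    move=> x; apply: continuous_comp; last exact: continuous_expR.
    exact: birkhoff_continuous.
  have mP : measurable_fun setT (P n) := measurable_fun_continuous cP.
  have := le_integral_transfer_continuous mpsi C1 gl gg n cP (Pge0 n).
  move=> /le_trans; apply; rewrite /K [leRHS]EFinM; apply: lee_wpmul2l.
    by rewrite lee_fin ltW.
  apply: (@le_trans _ _ (\int[m]_x (c2 * c2)%:E)); last first.
    by rewrite integral_cst// [X in _ * X]probability_setT mule1.
  apply: ge0_le_integral => //.
  - by move=> x _; apply: iter_transfer_ge0 => z; rewrite lee_fin.
  - apply: measurable_iter_transfer => // [z|]; first by rewrite lee_fin.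
    exact/measurable_EFinP.
  move=> x _; apply: (@le_trans _ _ (iter n L (fun z => c2%:E * (P n z * h z)%:E) x)).
    apply: le_iter_transfer => z; first by rewrite lee_fin.
    rewrite -EFinM lee_fin mulrCA ler_peMr//.
    have /andP[hz _] := h_bounds z.
    by rewrite -(mulfV (lt0r_neq0 c20)) ler_pM2l.
  rewrite iter_transferZ => [|z]; last by rewrite lee_fin mulr_ge0.
  by rewrite LP -EFinM lee_fin ler_pM2l//; have /andP[] := h_bounds x.
have main n : (n%:R * \int[m]_x y x <= ln K)%R.
  have [mB Bb BE] := Rintegral_birkhoff n my yb.
  rewrite -BE; have intB := bounded_integrable m mB Bb.
  have PE x : P n x = expR (birkhoff y n x) by [].
  have mP : measurable_fun setT (P n) by exact: measurableT_comp mB.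
  have Pb x : (`|P n x| <= expR (n%:R * (ln b + ln b)))%R.
    by rewrite ger0_norm// ler_expR (le_trans (ler_norm _))//; exact: Bb.
  have iP := bounded_integrable m mP Pb.
  have RP : (\int[m]_x P n x <= K)%R.
    by rewrite -lee_fin /Rintegral fineK ?intP//; exact: integrable_fin_num.
  have iZ1 : m.-integrable setT (EFin \o (fun x => K^-1 * P n x)%R).
    exact: (integrableZl measurableT _ iP).
  have iZ2 : m.-integrable setT (EFin \o (fun=> ln K - 1)%R).
    exact: finite_measure_integrable_cst.
  have iZ : m.-integrable setT (EFin \o (fun x => K^-1 * P n x + (ln K - 1))%R).
    exact: (integrableD measurableT iZ1 iZ2).
  (* Jensen's inequality in tangent form: [1 + v <= expR v] at [v = birkhoff y n x - ln K] turns the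
     bound [K] on the integral of [P n] into the bound [ln K]. *)
  apply: (@le_trans _ _ (\int[m]_x (K^-1 * P n x + (ln K - 1)))%R).
    apply: le_Rintegral => // x _.
    have := expR_ge1Dx (birkhoff y n x - ln K).
    by rewrite expRD expRN lnK ?posrE// -PE mulrC; lra.
  rewrite RintegralD// RintegralZl// Rintegral_probability_cst.
  have : (K^-1 * \int[m]_x P n x <= 1)%R by rewrite ler_pdivrMl// mulr1.
  by lra.
(* The bound [ln K] does not depend on [n], which rules out a positive integral of [y]. *)
have y0 : (\int[m]_x y x <= 0)%R.
  rewrite leNgt; apply/negP => yp.
  have j0 : (0 <= `|ln K| / \int[m]_x y x)%R by rewrite divr_ge0// ltW.
  have := archi_boundP j0; rewrite ltr_pdivrMr//.
  by rewrite ltNge => /negP; apply; apply: le_trans (main _) (ler_norm _).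
have ilu : m.-integrable setT (EFin \o (fun x => ln (u x))).
  apply: (@bounded_integrable _ _ _ _ _ (ln b)) => [|x]; last exact: ln_bounds.
  exact: measurable_fun_continuous.
have mlQ : measurable_fun setT (fun x => ln (Qop u x)).
  exact: measurable_fun_continuous.
have lQb x : (`|ln (Qop u x)| <= ln b)%R by exact: ln_bounds.
have ilQ : m.-integrable setT (EFin \o (fun x => ln (Qop u (T x)))).
  apply: (@bounded_integrable _ _ _ _ _ (ln b)) => [|x]; last exact: lQb.
  exact: (measurableT_comp mlQ (@measurable_left_shift S t X0)).
move: y0; rewrite /y RintegralB// subr_le0.
by rewrite (Rintegral_shift (gibbs_invariant G) mlQ lQb).
Qed.

Lemma Rintegral_ln_le_iter_Qop (u : X -> R) b l n :
  (forall x, 1 <= u x <= b)%R -> (0 <= l)%R -> lip_le theta u l ->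
  (\int[m]_x ln (u x) <= \int[m]_x ln (iter n Qop u x))%R.
Proof.
move=> ub l0 ul; have ub0 x : (0 <= u x <= b)%R.
  by have /andP[ux ->] := ub x; rewrite (le_trans ler01 ux).
have uE : u = fun z => (1 + 1 * (u z - 1))%R by apply/funext => z; lra.
have v0 z : (0 <= u z - 1 <= b)%R.
  by have /andP[? ?] := ub z; apply/andP; split; lra.
elim: n => [//|n IHn]; apply: le_trans IHn _.
have [l' l'0 Ql] := iter_Qop_lip n ub0 l0 ul.
apply: (@Rintegral_ln_le_Qop _ b l') => // x.
have /andP[_ ->] := iter_Qop_bounds n x ub0; rewrite andbT uE.
rewrite (iter_QopDZ _ _ _ v0)// mul1r lerDl.
by have /andP[] := iter_Qop_bounds n x v0.
Qed.

(** For small [e], [ln (1 + e * f)] is [e * f] up to [e ^+ 2 * b ^+ 2]. The inequality for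
    logarithms is divided by [e], and [iter n Qop f] exceeds its value at [x] by at most its
    oscillation. *)
Let Rintegral_le_iter_Qop (K rho : R) : (0 < rho < 1)%R ->
  (forall f b l, (forall z, 0 <= f z <= b)%R -> (0 <= l)%R -> lip_le theta f l ->
    forall k, osc_le (iter k Qop f) (K * (b + l) * rho ^+ k)) ->
  forall f b l, (forall z, 0 <= f z <= b)%R -> (0 <= l)%R -> lip_le theta f l ->
    forall n x, (\int[m]_z f z <= iter n Qop f x + K * (b + l) * rho ^+ n)%R.
Proof.
move=> r01 HK f b l fb l0 fl n x; have /andP[r0 r1] := r01.
have f0 z : (0 <= f z)%R by have /andP[] := fb z.
have b0 : (0 <= b)%R by have /andP[/le_trans] := fb point; apply.
have cf := lip_le_continuous l0 fl; have mf := measurable_fun_continuous cf.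
have fb' z : (`|f z| <= b)%R by rewrite ger0_norm//; have /andP[] := fb z.
have intf := bounded_integrable m mf fb'.
(* The size of the perturbation is taken to be [rho ^+ k], so that the second-order term is the
   geometric error that this lemma removes. *)
apply: (@le_of_geometric _ rho _ _ (b ^+ 2) r01) => k.
set e := (rho ^+ k)%R; have e0 : (0 < e)%R by rewrite exprn_gt0.
have e0' := ltW e0.
pose u z := (1 + e * f z)%R.
have ub z : (1 <= u z <= 1 + e * b)%R.
  by rewrite /u lerDl lerD2l mulr_ge0//= ler_wpM2l//; have /andP[] := fb z.
have ul : lip_le theta u (e * l).
  move=> j y z j0 yz; have := ler_wpM2l e0' (fl j y z j0 yz).
  by rewrite /u; lra.
have el0 : (0 <= e * l)%R by rewrite mulr_ge0.
have mlu : measurable_fun setT (fun z => ln (u z)).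
  apply: measurable_fun_continuous; apply: continuous_ln_ge1 => [|z].
    exact: lip_le_continuous el0 ul.
  by have /andP[] := ub z.
have ilu : m.-integrable setT (EFin \o (fun z => ln (u z))).
  by apply: (@bounded_integrable _ _ _ _ _ (ln (1 + e * b))) => // z; exact: ln_bounds.
have QuE : iter n Qop u = fun z => (1 + e * iter n Qop f z)%R.
  exact: iter_QopDZ fb.
have Qfb z := iter_Qop_bounds n z fb.
have [l' l'0 Ql] := iter_Qop_lip n fb l0 fl.
pose q := (iter n Qop f x + K * (b + l) * rho ^+ n)%R.
have up : (\int[m]_z ln (u z) <= e * q)%R.
  apply: le_trans (Rintegral_ln_le_iter_Qop n ub el0 ul) _.
  rewrite QuE -(Rintegral_probability_cst m (e * q)).
  have v1 z : (1 <= 1 + e * iter n Qop f z <= 1 + e * b)%R.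
    by have /andP[? ?] := Qfb z; rewrite lerDl mulr_ge0//= lerD2l ler_wpM2l.
  apply: le_Rintegral => //.
  - apply: (@bounded_integrable _ _ _ _ _ (ln (1 + e * b))) => [|z]; last exact: ln_bounds.
    apply: measurable_fun_continuous; apply: continuous_ln_ge1 => z.
      apply: (@cvgD R R X (nbhs z) (nbhs_filter z)); first exact: cvg_cst.
      apply: (@cvgMr R X (nbhs z) (nbhs_filter z)).
      exact: (lip_le_continuous l'0 Ql).
    by have /andP[] := v1 z.
  - exact: finite_measure_integrable_cst.
  move=> z _; apply: le_trans (le_ln1Dx _) _.
    by apply: lt_le_trans (_ : 0 <= _)%R; [rewrite oppr_lt0|rewrite mulr_ge0//; have /andP[] := Qfb z].
  by apply: ler_wpM2l => //; exact: HK.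
have low : (e * \int[m]_z f z - e * (e * b ^+ 2) <= \int[m]_z ln (u z))%R.
  rewrite -RintegralZl// -[X in (_ - X)%R](Rintegral_probability_cst m).
  have i1 : m.-integrable setT (EFin \o (fun z => e * f z)%R).
    exact: (integrableZl measurableT _ intf).
  have i2 : m.-integrable setT (EFin \o (fun=> e * (e * b ^+ 2))%R).
    exact: finite_measure_integrable_cst.
  rewrite -RintegralB//; apply: le_Rintegral => //.
    exact: (integrableB measurableT i1 i2).
  move=> z _; have ef0 : (0 <= e * f z)%R by rewrite mulr_ge0.
  apply: le_trans (ln_ge_quadratic ef0); rewrite lerD2l lerN2.
  rewrite exprMn expr2 -mulrA ler_pM2l// ler_pM2l// lerXn2r ?nnegrE//.
  by have /andP[] := fb z.
have := le_trans low up; rewrite -mulrBr ler_pM2l// => H.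
by rewrite -/q -/e mulrC; lra.
Qed.

Theorem Qop_equidistribution : exists K rho : R,
  [/\ (0 < K)%R, (0 < rho < 1)%R & forall f b l,
    (forall z, 0 <= f z <= b)%R -> (0 <= l)%R -> lip_le theta f l ->
    forall n, osc_le (iter n Qop f) (K * (b + l) * rho ^+ n) /\
    forall x, (`|\int[m]_z f z - iter n Qop f x| <= K * (b + l) * rho ^+ n)%R].
Proof.
have [K [rho [K0 r01 HK]]] := Qop_contraction.
exists K, rho; split => // f b l fb l0 fl n; split; first exact: HK.
move=> x; rewrite ler_norml; apply/andP; split; last first.
  by rewrite lerBlDl; exact: Rintegral_le_iter_Qop.
have b0 : (0 <= b)%R by have /andP[/le_trans] := fb point; apply.
(* The lower bound on the difference is the upper bound for [b - f]. *)
have gb z : (0 <= b - f z <= b)%R.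
  by have /andP[? ?] := fb z; rewrite subr_ge0 lerBlDr lerDl; apply/andP.
have gl : lip_le theta (fun z => b - f z)%R l.
  by move=> j y z j0 yz; have := fl j z y j0 (agree_sym yz); lra.
have cf := lip_le_continuous l0 fl; have mf := measurable_fun_continuous cf.
have fb' z : (`|f z| <= b)%R.
  by have /andP[? ?] := fb z; rewrite ger0_norm.
have := Rintegral_le_iter_Qop r01 HK gb l0 gl n x.
rewrite (iter_QopB n fb) RintegralB//; first last.
- exact: bounded_integrable fb'.
- exact: finite_measure_integrable_cst.
by rewrite Rintegral_probability_cst; lra.
Qed.

End normalized_operator.

(** * Conditional measures given the future *)

Section density.
Context d d' (Y : measurableType d) (Z : measurableType d') (R : realType).
Variables (mu : {measure set Y -> \bar R}) (phi : Y -> Z) (A : set Y).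
Variable p : Z -> \bar R.
Hypothesis mphi : measurable_fun setT phi.
Hypothesis mA : measurable A.
Hypothesis mp : measurable_fun setT p.
Hypothesis p_ge0 : forall z, 0 <= p z.
Hypothesis p_fin : forall z, p z \is a fin_num.
Hypothesis pE : forall B, measurable B ->
  mu (A `&` phi @^-1` B) = \int[mu]_(y in phi @^-1` B) p (phi y).

Import HBNNSimple.

Let mpre B : measurable B -> measurable (phi @^-1` B).
Proof. by move=> mB; have := mphi measurableT mB; rewrite setTI. Qed.

Let mpphi : measurable_fun setT (p \o phi).
Proof. exact: measurableT_comp mphi. Qed.

Let density_indic B : measurable B ->
  \int[mu]_(y in A) (\1_B (phi y))%:E = \int[mu]_y ((\1_B (phi y))%:E * p (phi y)).
Proof.
move=> mB; transitivity (mu (A `&` phi @^-1` B)).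
  by rewrite setIC -(integral_indic _ mA (mpre mB)).
rewrite pE// integral_mkcond; apply: eq_integral => y _.
rewrite patchE indicE; case: (boolP (y \in _)); rewrite ?inE ?notin_setE => yB.
  by rewrite mem_set ?mul1e.
by rewrite memNset ?mul0e.
Qed.

(** [pE] is the case of indicators; simple functions and monotone convergence give the rest.
    Finiteness of [p] allows the limit to be taken inside the product. *)
Lemma ge0_integral_density (g : Z -> \bar R) : (forall z, 0 <= g z) ->
  measurable_fun setT g ->
  \int[mu]_(y in A) g (phi y) = \int[mu]_y (g (phi y) * p (phi y)).
Proof.
move=> g0 mg; pose h := nnsfun_approx measurableT mg.
have mh n : measurable_fun setT (EFin \o h n \o phi).
  by apply: measurableT_comp mphi; exact/measurable_EFinP.
have h0 n z : 0 <= (h n z)%:E by rewrite lee_fin.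
have nd z : {homo (fun n => (h n z)%:E) : i j / (i <= j)%N >-> i <= j}.
  by move=> i j ij; rewrite lee_fin; exact/lefP/nd_nnsfun_approx.
have hg z : (h n z)%:E @[n --> \oo] --> g z.
  by apply: cvg_nnsfun_approx => // z' _; exact: g0.
have -> : \int[mu]_(y in A) g (phi y) =
    limn (fun n => \int[mu]_(y in A) (h n (phi y))%:E).
  rewrite -monotone_convergence//; last first.
    by move=> n; apply: measurable_funTS; exact: mh.
  by apply: eq_integral => y _; apply/esym/cvg_lim => //; exact: hg.
have -> : \int[mu]_y (g (phi y) * p (phi y)) =
    limn (fun n => \int[mu]_y ((h n (phi y))%:E * p (phi y))).
  rewrite -monotone_convergence//; last 3 first.
  - by move=> n; apply: emeasurable_funM => //; exact: mh.
  - by move=> n y _; rewrite mule_ge0.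
  - by move=> y _ i j ij; apply: lee_wpmul2r => //; exact: nd.
  apply: eq_integral => y _; apply/esym/cvg_lim => //.
  by apply: cvgeZr; [exact: p_fin|exact: hg].
congr (limn _); apply/funext => n.
have mi r : measurable_fun setT (fun y => (r * \1_(h n @^-1` [set r]) (phi y))%:E).
  apply/measurable_EFinP; apply: measurable_funM => //.
  by apply: measurableT_comp mphi; exact: measurable_indic.
transitivity (\int[mu]_(y in A)
    (\sum_(r \in range (h n)) (r * \1_(h n @^-1` [set r]) (phi y))%:E)).
  by apply: eq_integral => y _; rewrite fimfunE -fsumEFin.
rewrite ge0_integral_fsum//; last 2 first.
- by move=> r; apply: measurable_funTS; exact: mi.
- by move=> r y _; exact: nnfun_muleindic_ge0.
transitivity (\int[mu]_y (\sum_(r \in range (h n))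
    ((r * \1_(h n @^-1` [set r]) (phi y))%:E * p (phi y)))); last first.
  apply: eq_integral => y _.
  rewrite -ge0_mule_fsuml => [|r]; last exact: nnfun_muleindic_ge0.
  by rewrite fsumEFin// -(fimfunE _ (phi y)).
rewrite ge0_integral_fsum//; last 2 first.
- by move=> r; apply: emeasurable_funM => //; exact: mi.
- by move=> r y _; rewrite mule_ge0// nnfun_muleindic_ge0.
apply: eq_fsbigr => r; rewrite inE => -[z _ hz].
have r0 : (0 <= r)%R by rewrite -hz.
have mr : measurable (h n @^-1` [set r]) by exact: measurable_sfunP.
under eq_integral do rewrite EFinM.
under [RHS]eq_integral do rewrite EFinM -muleA.
have m1 : measurable_fun setT (fun y => (\1_(h n @^-1` [set r]) (phi y))%:E : \bar R).
  by apply/measurable_EFinP; apply: measurableT_comp mphi; exact: measurable_indic.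
rewrite ge0_integralZl_EFin//; last exact: measurable_funTS.
rewrite ge0_integralZl_EFin//; last 2 first.
- by move=> y _; rewrite mule_ge0.
- exact: emeasurable_funM.
by rewrite density_indic.
Qed.

End density.

Section preimage_measure.
Context d d' (Y : measurableType d) (Z : measurableType d') (R : realType).
Variables (mu : probability Y R) (phi : Y -> Z) (A : set Y).
Hypotheses (mphi : measurable_fun setT phi) (mA : measurable A).

(* The measurability proofs are arguments so that the measure structure can be
   inferred. *)
Definition restr_image (_ : measurable_fun setT phi) (_ : measurable A) (B : set Z) :=
  mu (A `&` phi @^-1` B).

Local Notation nu := (restr_image mphi mA).

Let mpre B : measurable B -> measurable (A `&` phi @^-1` B).
Proof.
by move=> mB; have := mphi measurableT mB; rewrite setTI; exact: measurableI.
Qed.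

Let nu0 : nu set0 = 0.
Proof. by rewrite /nu preimage_set0 setI0 measure0. Qed.

Let nu_ge0 B : 0 <= nu B. Proof. exact: measure_ge0. Qed.

Let nu_sigma_additive : semi_sigma_additive nu.
Proof.
move=> F mF tF mUF; rewrite /nu preimage_bigcup setI_bigcupr.
apply: measure_semi_sigma_additive.
- by move=> n; exact: mpre.
- apply/trivIsetP => /= i j _ _ ij; rewrite setIACA -preimage_setI.
  by move/trivIsetP : tF => /(_ _ _ _ _ ij) ->//; rewrite preimage_set0 setI0.
- by rewrite -setI_bigcupr -preimage_bigcup; exact: mpre.
Qed.

HB.instance Definition _ := isMeasure.Build _ _ _ nu nu0 nu_ge0 nu_sigma_additive.

Let nu_fin : fin_num_fun nu.
Proof. by move=> B mB; rewrite fin_num_measure//; exact: mpre. Qed.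

HB.instance Definition _ := @Measure_isFinite.Build _ Z _ nu nu_fin.

End preimage_measure.

Section future.
Context (S : countType) (t : rel S) (X0 : admissible t !=set0) (R : realType).
Local Notation X := (markov_shift X0).
Local Notation T := (@left_shift S t X0).
Local Notation cyl := (@cylinder S t X0).
Local Notation F := (@future_sigma_algebra S t X0).
Implicit Types (x y z : X) (s : S) (w : seq S).

Definition future_generators : set (set X) :=
  [set A | exists j s, (1 <= j)%N /\ A = iter j T @^-1` cyl [:: s]].

(** A second measurable structure on the points of [X], under which measurability with respect to
    the future is an ordinary [measurable_fun]. *)
Definition future_type : Type := g_sigma_algebraType future_generators.

HB.instance Definition _ := Measurable.on future_type.

(** The generators are preimages under [T], and such preimages form a sigma-algebra. With
    [future_shift], this identifies the future events with the preimages of Borel sets under [T]. *)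
Lemma future_preimage B : F B -> exists2 B', measurable B' & B = T @^-1` B'.
Proof.
suff : F `<=` preimage_set_system setT T (@measurable _ X).
  by move=> /[apply] -[B' mB' <-]; exists B' => //; rewrite setTI.
apply: smallest_sub.
  apply: sigma_algebra_preimage; split => [|A mA|A mA].
  - exact: measurable0.
  - by rewrite setTD; exact: measurableC.
  - exact: bigcupT_measurable.
move=> _ [j [s [j1 ->]]]; case: j j1 => // j _; exists (iter j T @^-1` cyl [:: s]).
  by apply: measurable_preimage_iter; exact: measurable_cylinder.
by rewrite setTI; apply/seteqP; split => x; rewrite /preimage/= -iterSr.
Qed.

Lemma measurable_future_shift : measurable_fun [set: future_type] (T : future_type -> X).
Proof.
apply: (@measurability _ _ _ _ _ (T : future_type -> X) (@open X)) => //.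
move=> _ [U oU <-]; rewrite setTI.
have mc w : measurable ((T : future_type -> X) @^-1` cyl w).
  elim/last_ind: w => [|w s IHw].
    by rewrite (_ : _ @^-1` _ = setT)//; apply/seteqP.
  rewrite (_ : _ @^-1` _ = (T : future_type -> X) @^-1` cyl w `&`
      ((iter (size w).+1 T : future_type -> X) @^-1` cyl [:: s])).
    apply: measurableI => //; apply: sub_sigma_algebra.
    by exists (size w).+1, s; split.
  apply/seteqP; split => x.
    by rewrite /preimage/= -cats1 => /cylinder_cat; rewrite -iterSr.
  by rewrite /preimage/= => xs; rewrite -cats1; apply/cylinder_cat; rewrite -iterSr.
(* An open set is the countable union of the cylinders that it contains. *)
pose V i : set X := if @pickle_inv (seq S) i is Some w then
  if `[< cyl w `<=` U >] then cyl w else set0 else set0.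
have -> : U = \bigcup_i V i.
  apply/seteqP; split => [x Ux|x [i _]]; last first.
    rewrite /V; case: (@pickle_inv (seq S) i) => [w|//].
    by case: asboolP => [wU|//]; exact: wU.
  have [k kU] := agree_open oU Ux; exists (pickle (word k x)) => //.
  rewrite /V pickleK_inv; case: asboolP => [_|[]]; first exact: cylinder_word.
  by move=> y /cylinder_wordE/kU.
rewrite preimage_bigcup; apply: bigcupT_measurable => i; rewrite /V.
case: (@pickle_inv (seq S) i) => [w|]; last by rewrite preimage_set0.
by case: asboolP => _; [exact: mc|rewrite preimage_set0].
Qed.

Lemma future_shift B : measurable B -> F (T @^-1` B).
Proof.
by move=> mB; have := measurable_future_shift measurableT mB; rewrite setTI.
Qed.

Lemma future_measurable B : F B -> measurable B.
Proof.
move=> /future_preimage[B' mB' ->].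
exact: (measurable_preimage_iter 1 mB').
Qed.

Lemma measurable_fun_future (f : X -> \bar R) :
  (forall B : set (\bar R), measurable B -> F (f @^-1` B)) ->
  measurable_fun [set: future_type] (f : future_type -> \bar R).
Proof. by move=> fF _ B mB; rewrite setTI; exact: fF. Qed.

Lemma measurable_future_id : measurable_fun setT (id : X -> future_type).
Proof. by move=> _ B mB; rewrite setTI; exact: future_measurable. Qed.

End future.

Section conditional.
Context (S : countType) (t : rel S) (X0 : admissible t !=set0) (R : realType).
Local Notation X := (markov_shift X0).
Local Notation T := (@left_shift S t X0).
Local Notation cyl := (@cylinder S t X0).
Local Notation F := (@future_sigma_algebra S t X0).
Local Notation E := (@state_cylinder S t X0).
Implicit Types (x y z : X) (s : S) (w : seq S).
Variable mu : probability X R.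
Hypothesis muT : invariant_measure T mu.

Lemma ge0_integral_shift (B : set X) (f : X -> \bar R) : measurable B ->
  (forall x, 0 <= f x) -> measurable_fun setT f ->
  \int[mu]_(x in T @^-1` B) f (T x) = \int[mu]_(x in B) f x.
Proof.
move=> mB f0 mf; have mT := @measurable_left_shift S t X0.
rewrite -[LHS]/(\int[mu]_(x in T @^-1` B) (f \o T) x).
rewrite -(ge0_integral_pushforward mT)//; last exact: measurable_funTS.
by apply: eq_measure_integral => A mA _; exact: muT.
Qed.

Lemma state_cylinder_branch i x : E i x -> branch i (T x) = x.
Proof. by move=> /state_cylinderP ->; rewrite branch_pickle prepend_shift. Qed.

(** The conditional measure is a sum of point masses at the preimages of [y = T x]; the mass at
    [branch i y] is the Radon-Nikodym derivative at [y] of the image under [T] of [mu] restricted to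
    the letter [i]. Composing with [T] makes it depend on the future only. *)
Lemma exists_conditional_measures :
  exists k : X -> probability X R, is_conditional_measures mu F k.
Proof.
have mT := @measurable_left_shift S t X0.
have mE i : measurable (E i) := measurable_state_cylinder i.
pose nu i : {finite_measure set X -> \bar R} := restr_image mu mT (mE i).
have nu_dom i : nu i `<< mu.
  apply/null_content_dominatesP => B mB muB.
  have mTB : measurable (T @^-1` B) := measurable_preimage_iter 1 mB.
  have muTB : mu (T @^-1` B) = 0 := etrans (muT mB) muB.
  apply/eqP; rewrite eq_le measure_ge0 andbT -muTB.
  apply: le_measure; rewrite ?inE//.
  exact: measurableI.
have [h] := choice (fun i => radon_nikodym_sigma_finite (nu_dom i)).
move=> /all_and4[h0 hfin hint hE].
have mh i : measurable_fun setT (h i) := measurable_int _ (hint i).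
pose hn i y : {nonneg R} := NngNum (fine_ge0 (h0 i y)).
pose nuy y : {measure set X -> \bar R} :=
  mseries (fun i => mscale (hn i y) (dirac (branch i y))) 0.
have nuyE y A : nuy y A = \sum_(i <oo) h i y * (\1_A (branch i y))%:E.
  by apply: eq_eseriesr => i _; rewrite -[in RHS](fineK (hfin i y)).
pose N y := nuy y setT.
have mnuy A : measurable A -> measurable_fun setT (fun y => nuy y A).
  move=> mA; rewrite (_ : (fun y => _) =
      fun y => \sum_(i <oo) h i y * (\1_A (branch i y))%:E); last first.
    by apply/funext => y; exact: nuyE.
  apply: (@ge0_emeasurable_sum _ _ _ _ _ xpredT) => [i y _ _|i _].
    by rewrite mule_ge0.
  apply: emeasurable_funM => //; apply/measurable_EFinP.
  by apply: measurableT_comp (measurable_branch _); exact: measurable_indic.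
pose pn y : probability X R := mnormalize (nuy y) mu.
(* The point masses add up to 1 only almost everywhere; elsewhere the default [mu] keeps [k y] a
   probability. *)
pose k y : probability X R := if N y == 1 then pn y else mu.
have kE y A : k y A = if N y == 1 then nuy y A else mu A.
  rewrite /k; case: eqP => // N1.
  transitivity (mnormalize (nuy y) mu A) => //.
  by rewrite /mnormalize [nuy y setT]N1 onee_eq0/= invr1 mule1.
have mN : measurable_fun setT N by exact: mnuy.
have mk A : measurable A -> measurable_fun setT (fun y => k y A).
  move=> mA; rewrite (_ : (fun y => _) =
      fun y => if N y == 1 then nuy y A else mu A); last first.
    by apply/funext => y; exact: kE.
  apply: measurable_fun_ifT => //; last exact: mnuy.
  apply: (measurable_fun_bool true); rewrite setTI.
  rewrite (_ : _ @^-1` _ = N @^-1` [set 1]).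
    by rewrite -[X in measurable X]setTI; apply: mN => //; exact: emeasurable_set1.
  by apply/seteqP; split => y; rewrite /preimage/= => /eqP.
have int_nuy A B : measurable A -> measurable B ->
    \int[mu]_(y in B) nuy y A = mu (A `&` T @^-1` B).
  move=> mA mB; have mTB : measurable (T @^-1` B) := measurable_preimage_iter 1 mB.
  have mbr i : measurable (branch i @^-1` A).
    by rewrite -[X in measurable X]setTI; exact: measurable_branch.
  rewrite (eq_integral (fun y => \sum_(i <oo) h i y * (\1_A (branch i y))%:E)); last first.
    by move=> y _; exact: nuyE.
  have mindic i : measurable_fun setT (fun y => h i y * (\1_A (branch i y))%:E).
    apply: emeasurable_funM => //; apply/measurable_EFinP.
    by apply: measurableT_comp (measurable_branch _); exact: measurable_indic.
  rewrite integral_nneseries//; last 2 first.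
  - by move=> i; apply: measurable_funTS; exact: mindic.
  - by move=> i y _; rewrite mule_ge0.
  rewrite -(measure_state_cylinder _ (measurableI _ _ mA mTB)).
  apply: eq_eseriesr => i _.
  transitivity (nu i (B `&` branch i @^-1` A)); last first.
    transitivity (mu (E i `&` T @^-1` (B `&` branch i @^-1` A))) => //.
    congr (mu _); apply/seteqP; split => x [Ex []]; rewrite /preimage/=.
      by rewrite state_cylinder_branch.
    by move=> Ax Bx; rewrite state_cylinder_branch.
  rewrite hE; last exact: measurableI.
  rewrite [RHS]integral_mkcondr; apply: eq_integral => y _.
  rewrite patchE indicE; case: (boolP (y \in _)); rewrite ?inE ?notin_setE => yB.
    by rewrite mem_set ?mule1.
  by rewrite memNset ?mule0.
(* Both functions have the same integral over every Borel set [B], namely [mu B] by invariance. *)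
have N1 : ae_eq mu setT N (cst 1).
  apply: integral_ae_eq => //.
    apply/integrableP; split => //.
    rewrite (eq_integral N) => [|y _]; last by rewrite gee0_abs.
    by rewrite int_nuy// setTI preimage_setT [X in X < _]probability_setT ltry.
  move=> B _ mB; rewrite int_nuy// setTI muT// integral_cst//.
  by rewrite mul1e.
exists (fun x => k (T x)) => A mA; split.
  move=> B mB; apply: (@future_shift _ _ _ ((fun y => k y A) @^-1` B)).
  by rewrite -[X in measurable X]setTI; exact: mk.
move=> _ /future_preimage[B mB ->].
rewrite (@ge0_integral_shift B (fun y => k y A))//; last exact: mk.
rewrite -int_nuy//; apply: ge0_ae_eq_integral => //.
- by apply: measurable_funTS; exact: mnuy.
- by apply: measurable_funTS; exact: mk.
apply: (filterS _ N1) => y /= Ny _; rewrite kE.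
by have -> : N y = 1 by [exact: Ny]; rewrite eqxx.
Qed.

End conditional.

(** * The conditional probability of the first letter *)

Section cond_prob.
Context (S : countType) (t : rel S) (X0 : admissible t !=set0) (R : realType).
Local Notation X := (markov_shift X0).
Local Notation T := (@left_shift S t X0).
Local Notation cyl := (@cylinder S t X0).
Local Notation F := (@future_sigma_algebra S t X0).
Local Notation E := (@state_cylinder S t X0).
Implicit Types (x y z : X) (s : S) (w : seq S).
Variables (mu : probability X R) (k : X -> probability X R).
Hypothesis muT : invariant_measure T mu.
Hypothesis kP : is_conditional_measures mu F k.

Definition cond_prob x : R := fine (k x (cyl [:: state_at x 0])).

Let q i x := k x (E i).

Let mE i : measurable (E i). Proof. exact: measurable_state_cylinder. Qed.

Let q_fin i x : q i x \is a fin_num.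
Proof. exact: fin_num_measure. Qed.

Let mqF i : measurable_fun [set: future_type X0] (q i : future_type X0 -> \bar R).
Proof. by apply: measurable_fun_future => B /((kP (mE i)).1). Qed.

Let mq i : measurable_fun setT (q i).
Proof. exact: (measurableT_comp (mqF i) (@measurable_future_id S t X0)). Qed.

Let qE i B : F B -> mu (E i `&` B) = \int[mu]_(x in B) q i x.
Proof. exact: (kP (mE i)).2. Qed.

Lemma cond_probE i x : E i x -> cond_prob x = fine (q i x).
Proof.
by move=> /state_cylinderP ->; rewrite /q /state_cylinder pickleK_inv.
Qed.

Lemma cond_prob_ge0 x : (0 <= cond_prob x)%R.
Proof. exact: fine_ge0. Qed.

Lemma measurable_cond_prob : measurable_fun setT cond_prob.
Proof.
apply/measurable_EFinP.
rewrite (_ : _ \o _ = fun x => \sum_(i <oo) (\1_(E i) x)%:E * q i x).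
  apply: (@ge0_emeasurable_sum _ _ _ _ _ xpredT) => [i x _ _|i _].
    by rewrite mule_ge0.
  by apply: emeasurable_funM => //; apply/measurable_EFinP; exact: measurable_indic.
apply/funext => x /=; pose j := pickle (state_at x 0).
have xj : E j x by exact/state_cylinderP.
rewrite (@nneseriesD1 _ _ j)// => [|i _]; last by rewrite mule_ge0.
rewrite indicE mem_set// mul1e eseries0 ?adde0; first by rewrite (cond_probE xj) fineK.
move=> i _ /= ij; rewrite indicE memNset ?mul0e// => /state_cylinderP ij'.
by rewrite ij' eqxx in ij.
Qed.

(** The set where [q i] vanishes is a future event, so the measure of its intersection with [E i] is
    the integral of [q i] over it, which is zero. *)
Lemma cond_prob_gt0 : {ae mu, forall x, (0 < cond_prob x)%R}.
Proof.
have mZ i : F (q i @^-1` [set 0]).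
  by apply: (kP (mE i)).1; exact: emeasurable_set1.
pose Z := cond_prob @^-1` [set 0%R].
have mZ' : measurable Z.
  by rewrite -[X in measurable X]setTI; exact: measurable_cond_prob.
exists Z; split => //.
- rewrite -measure_state_cylinder//; apply: eseries0 => i _ _.
  rewrite (_ : E i `&` Z = E i `&` q i @^-1` [set 0]).
    by apply: (etrans (qE i (mZ i))); apply: integral0_eq => x ->.
  apply/seteqP; split => x [xE]; rewrite /Z /preimage/= => qx.
    by split => //; rewrite (cond_probE xE) in qx; rewrite /preimage/= -(fineK (q_fin i x)) qx.
  by split => //; rewrite /preimage/= (cond_probE xE) qx.
move=> x /= /negP; rewrite -leNgt => px.
by apply/eqP; rewrite eq_le px cond_prob_ge0.
Qed.

Variable psi : X -> R.
Hypothesis mpsi : measurable_fun setT psi.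
Local Notation L := (transfer psi).

(** On [E i] the integrand is a function of [T x] divided by [q i], and conditioning on the future
    replaces the restriction to [E i] by the factor [q i], which cancels. Equality can fail because
    terms with [q i x = 0] are lost. *)
Lemma integral_cond_prob_le (f : X -> \bar R) : (forall x, 0 <= f x) ->
  measurable_fun setT f ->
  \int[mu]_x ((expR (psi x - ln (cond_prob x)))%:E * f x) <= \int[mu]_x L f x.
Proof.
move=> f0 mf; have mT := @measurable_left_shift S t X0.
have mlnp : measurable_fun setT (fun x => ln (cond_prob x)).
  exact: (measurableT_comp (@measurable_ln R) measurable_cond_prob).
have mw i : measurable_fun setT (fun x => weight psi i x * f (branch i x)).
  apply: emeasurable_funM; first exact: measurable_weight.
  exact: measurableT_comp (measurable_branch i).
rewrite integral_state_cylinder; last 2 first.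
- by move=> x; rewrite mule_ge0// lee_fin expR_ge0.
- apply: emeasurable_funM => //; apply/measurable_EFinP.
  by apply: (measurableT_comp (@measurable_expR R)); exact: measurable_funB.
have -> : \int[mu]_x L f x = \int[mu]_x L f (T x).
  have := @ge0_integral_shift _ _ _ _ _ muT setT (L f) measurableT.
  rewrite preimage_setT => -> //; first by move=> x; exact: transfer_ge0.
  exact: measurable_transfer.
rewrite integral_nneseries//; last 2 first.
- by move=> i; exact: (measurableT_comp (mw i) mT).
- by move=> i x _; exact: term_ge0.
apply: lee_nneseries => [i _ _|i _].
  by apply: integral_ge0 => x _; rewrite mule_ge0// lee_fin expR_ge0.
(* Agrees with the integrand on [E i], but is defined everywhere and measurable with respect to the
   future, as the change of density requires. *)
pose g (x : future_type X0) : \bar R :=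
  weight psi i (T x) * f (branch i (T x)) * (expR (- ln (fine (q i x))))%:E.
have g0 x : 0 <= g x by rewrite mule_ge0 ?term_ge0// lee_fin expR_ge0.
have mg : measurable_fun setT g.
  apply: emeasurable_funM.
    exact: (measurableT_comp (mw i) (@measurable_future_shift S t X0)).
  apply/measurable_EFinP; apply: (measurableT_comp (@measurable_expR R)).
  apply: measurable_funN; apply: (measurableT_comp (@measurable_ln R)).
  exact: (measurableT_comp (@fine_measurable R setT measurableT) (mqF i)).
have gE x : E i x -> (expR (psi x - ln (cond_prob x)))%:E * f x = g x.
  move=> xE; rewrite /g state_cylinder_branch//.
  have -> : weight psi i (T x) = (expR (psi x))%:E.
    move/state_cylinderP : (xE) => ->.
    by rewrite weight_pickle ?prepend_shift//; exact: allowed_shift.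
  by rewrite -(cond_probE xE) expRD EFinM muleAC.
rewrite (eq_integral (fun x : X => g x)) => [|x]; last by rewrite inE => /gE ->.
have -> : \int[mu]_(x in E i) g x = \int[mu]_x (g x * q i x).
  apply: (@ge0_integral_density _ _ X (future_type X0) R mu id (E i) (q i)) => //.
    exact: measurable_future_id.
  by move=> B mB; exact: qE.
apply: ge0_le_integral => //.
- by move=> x _; rewrite mule_ge0.
- apply: emeasurable_funM => //.
  exact: (measurableT_comp mg (@measurable_future_id S t X0)).
- exact: (measurableT_comp (mw i) mT).
move=> x _; rewrite /g -muleA -[leRHS]mule1; apply: lee_wpmul2l.
  exact: term_ge0.
rewrite -[q i x]fineK// -EFinM lee_fin.
have [q0|q0] := leP (fine (q i x)) 0%R.
  by apply: le_trans ler01; rewrite mulr_ge0_le0// expR_ge0.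
by rewrite expRN lnK// mulVf// gt_eqF.
Qed.

End cond_prob.

(** * The entropy deficit *)

(* Follows from [(1 - s) ^+ 2 <= - u - 1 + s ^+ 2] with [s = exp (u / 2)]. *)
Lemma max_sub_expR_le (R : realType) (u e : R) : (0 < e)%R ->
  (Num.max 0 (1 - expR u) <=
    (2 * e)^-1 * (expR u - 1 - u) + e * (1 + expR u))%R.
Proof.
move=> e0; set s := expR (u / 2).
have sE : expR u = (s * s)%R by rewrite -expRD -splitr.
have s0 : (0 < s)%R := expR_gt0 _.
have us : (1 + u / 2 <= s)%R := expR_ge1Dx _.
have ie0 : (0 < (2 * e)^-1)%R by rewrite invr_gt0 mulr_gt0.
rewrite sE; set r := ((2 * e)^-1)%R in ie0 *.
have er : (2 * e * r = 1)%R by rewrite /r divff// gt_eqF// mulr_gt0.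
have h1 : (r * ((1 - s) ^+ 2) <= r * (s * s - 1 - u))%R.
  by rewrite ler_pM2l//; lra.
have h2 : (0 <= r * (1 - s - e * (1 + s)) ^+ 2)%R by rewrite mulr_ge0 ?sqr_ge0// ltW.
have h2E : (r * (1 - s - e * (1 + s)) ^+ 2 =
   r * (1 - s) ^+ 2 - (1 - s) * (1 + s) * (2 * e * r) + e * (1 + s) ^+ 2 * (2 * e * r) / 2)%R.
  by field.
rewrite h2E er in h2.
have h3 : (0 <= r * (1 - s) ^+ 2)%R by rewrite mulr_ge0 ?sqr_ge0// ltW.
have h4 : (0 <= e * (1 - s) ^+ 2)%R by rewrite mulr_ge0 ?sqr_ge0// ltW.
have h5 : (0 <= e * (1 + s * s))%R.
  by rewrite mulr_ge0 ?(ltW e0)// addr_ge0// mulr_ge0// ltW.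
rewrite ge_max; apply/andP; split; first by lra.
by nra.
Qed.

Lemma ge0_bounded_integrable d (Y : measurableType d) (R : realType)
    (mu : probability Y R) (f : Y -> R) (b : R) :
  measurable_fun setT f -> (forall x, 0 <= f x <= b)%R ->
  mu.-integrable setT (EFin \o f).
Proof.
move=> mf fb; apply: (bounded_integrable mu mf (b := b)) => x.
by have /andP[f0 ?] := fb x; rewrite ger0_norm.
Qed.

Lemma Rintegral_affine d (Y : measurableType d) (R : realType)
    (mu : probability Y R) (u v : Y -> R) (a b c : R) :
  mu.-integrable setT (EFin \o u) -> mu.-integrable setT (EFin \o v) ->
  mu.-integrable setT (EFin \o (fun x => a * u x + b * v x + c)%R) /\
  (\int[mu]_x (a * u x + b * v x + c) = a * \int[mu]_x u x + b * \int[mu]_x v x + c)%R.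
Proof.
move=> iu iv.
have iau : mu.-integrable setT (EFin \o (fun x => a * u x)%R).
  by apply: eq_integrable (integrableZl measurableT a iu).
have ibv : mu.-integrable setT (EFin \o (fun x => b * v x)%R).
  by apply: eq_integrable (integrableZl measurableT b iv).
have iuv : mu.-integrable setT (EFin \o (fun x => a * u x + b * v x)%R).
  by apply: eq_integrable (integrableD measurableT iau ibv).
have ic : mu.-integrable setT (EFin \o (fun=> c)).
  exact: finite_measure_integrable_cst.
split; first by apply: eq_integrable (integrableD measurableT iuv ic).
by rewrite !RintegralD// !RintegralZl// Rintegral_probability_cst.
Qed.

Section entropy.
Context (S : countType) (t : rel S) (X0 : admissible t !=set0) (R : realType).
Local Notation X := (markov_shift X0).
Local Notation T := (@left_shift S t X0).
Local Notation cyl := (@cylinder S t X0).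
Local Notation F := (@future_sigma_algebra S t X0).
Implicit Types (x y z : X) (s : S) (w : seq S).
Variable (psi : X -> R) (m : probability X R) (theta A C : R).
Hypothesis G : gibbs_data psi m theta A C.
Local Notation L := (transfer psi).
Local Notation c2 := (upper_bound theta A C).
Variable h : X -> R.
Hypothesis h_bounds : forall x, (c2^-1 <= h x <= c2)%R.
Hypothesis h_log : log_holder theta A (fun x => (h x)%:E).
Hypothesis hL : forall x, L (fun z => (h z)%:E) x = (h x)%:E.
Variable mu : probability X R.
Hypothesis muT : invariant_measure T mu.
Local Notation kappa := (conditional_measures mu F).
Local Notation p := (cond_prob kappa).
Local Notation Q := (Qop psi h).

Lemma conditional_measuresP : is_conditional_measures mu F kappa.
Proof.
have [k kP] := exists_conditional_measures muT.
by apply: (@xgetPex _ (fun=> mu) [set k | is_conditional_measures mu F k]); exists k.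
Qed.

Let c20 : (0 < c2)%R. Proof. exact: gibbs_upper_bound_gt0 G. Qed.

Let hgt0 x : (0 < h x)%R. Proof. exact: (eigen_gt0 G h_bounds x). Qed.

Let mpsi : measurable_fun setT psi. Proof. exact: gibbs_measurable G. Qed.

Lemma eigen_continuous : continuous h.
Proof.
have [th A0 _ _ _ _ _ _] := G; have B0 := distortion_ge0 th A0.
apply: (lip_le_continuous G (l := (distortion theta A * expR (distortion theta A) * c2)%R)).
  by rewrite mulr_ge0 ?(ltW c20)// mulr_ge0// expR_ge0.
apply: (log_holder_lip G) => // x.
by have /andP[_ ->] := h_bounds x; rewrite (ltW (hgt0 x)).
Qed.

Let mh : measurable_fun setT h.
Proof. exact: measurable_fun_continuous eigen_continuous. Qed.

Let mT := @measurable_left_shift S t X0.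

Let mlnh : measurable_fun setT (fun x => ln (h x)).
Proof. exact: (measurableT_comp (@measurable_ln R)). Qed.

Let mp : measurable_fun setT p.
Proof. exact: measurable_cond_prob conditional_measuresP. Qed.

Let mlnp : measurable_fun setT (fun x => ln (p x)).
Proof. exact: (measurableT_comp (@measurable_ln R)). Qed.

(* [ln (g / p)], where [g = exp psi * h / (h \o T)] is the transition
   probability of the equilibrium state and [p] that of [mu]. *)
Definition log_ratio x : R := (psi x - ln (p x) + ln (h x) - ln (h (T x)))%R.
Local Notation lr := log_ratio.

Lemma measurable_log_ratio : measurable_fun setT lr.
Proof.
apply: measurable_funB; last exact: (measurableT_comp mlnh mT).
by apply: measurable_funD => //; exact: measurable_funB.
Qed.

(** [integral_cond_prob_le] is applied to [f * h / (h \o T)]: the factor [1 / (h \o T)] comes out of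
    [L] as [1 / h], which leaves [L (f * h) / h = Q f]. *)
Lemma integral_ratio_le (f : X -> R) b : (forall x, 0 <= f x <= b)%R ->
  measurable_fun setT f ->
  \int[mu]_x (expR (lr x) * f x)%:E <= \int[mu]_x (Q f x)%:E.
Proof.
move=> fb mf; have f0 x : (0 <= f x)%R by have /andP[] := fb x.
have h0 x : (0 <= h x)%R := ltW (hgt0 x).
pose u x : \bar R := ((h (T x))^-1)%:E * (f x * h x)%:E.
have u0 x : 0 <= u x by rewrite /u -EFinM lee_fin; apply: mulr_ge0; rewrite ?invr_ge0 ?mulr_ge0.
have mu' : measurable_fun setT u.
  rewrite /u; apply: emeasurable_funM; apply/measurable_EFinP.
    rewrite (_ : (fun x => (h (T x))^-1)%R = fun x => expR (- ln (h (T x)))).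
      apply: (measurableT_comp (@measurable_expR R)); apply: measurable_funN.
      exact: (measurableT_comp mlnh mT).
    by apply/funext => x; rewrite expRN lnK ?posrE.
  exact: measurable_funM.
have := integral_cond_prob_le muT conditional_measuresP mpsi u0 mu'.
rewrite (eq_integral (fun x => (expR (lr x) * f x)%:E)); last first.
  move=> x _; rewrite /u -!EFinM; congr (_%:E).
  rewrite /lr -addrA [in RHS]expRD [expR (ln _ - _)]expRD expRN !lnK ?posrE//.
  by ring.
move=> /le_trans; apply; rewrite le_eqVlt; apply/orP; left; apply/eqP.
apply: eq_integral => x _.
rewrite /u (transfer_shift psi (fun z => (h z)^-1)%R) => [|z]; last first.
  by rewrite lee_fin mulr_ge0.
rewrite (QopE G h_bounds hL x fb) -EFinM; congr (_%:E).
by rewrite mulrC mulfK// gt_eqF.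
Qed.

Let ratio_integral_le1 : \int[mu]_x (expR (lr x))%:E <= 1.
Proof.
have one01 x : (0 <= (1 : R) <= 1)%R by rewrite ler01 lexx.
have := integral_ratio_le one01 (measurable_cst _).
under eq_integral do rewrite mulr1.
move=> /le_trans; apply; rewrite -[leRHS](@probability_setT _ _ _ mu).
rewrite -[leRHS]mul1e -integral_cst// le_eqVlt; apply/orP; left; apply/eqP.
apply: eq_integral => x _; congr (_%:E); rewrite /Qop.
under [fun z => _]eq_fun do rewrite mul1r.
by rewrite hL /= divff// gt_eqF.
Qed.

Let mratio : measurable_fun setT (fun x => expR (lr x)).
Proof. exact: (measurableT_comp (@measurable_expR R) measurable_log_ratio). Qed.

Lemma integrable_ratio : mu.-integrable setT (EFin \o (fun x => expR (lr x))).
Proof.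
apply/integrableP; split; first exact/measurable_EFinP.
rewrite (eq_integral (fun x => (expR (lr x))%:E)) => [|x _].
  exact: le_lt_trans ratio_integral_le1 (ltry _).
by rewrite /= ger0_norm// expR_ge0.
Qed.

Lemma Rintegral_ratio_le1 : (\int[mu]_x expR (lr x) <= 1)%R.
Proof.
rewrite -lee_fin /Rintegral fineK//.
exact: integrable_fin_num integrable_ratio.
Qed.

Let shortfall x : R := (Num.max 0 (1 - expR (lr x)))%R.

Let mshortfall : measurable_fun setT shortfall.
Proof.
apply: measurable_maxr; first exact: measurable_cst.
exact: measurable_funB.
Qed.

Let shortfall_bounds x : (0 <= shortfall x <= 1)%R.
Proof.
by rewrite /shortfall le_max lexx ge_max ler01 /= lerBlDr lerDl expR_ge0.
Qed.

Let ishortfall : mu.-integrable setT (EFin \o shortfall).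
Proof.
exact: ge0_bounded_integrable shortfall_bounds.
Qed.

(* Pinsker's inequality for the relative entropy [- \int lr]. *)
Lemma Rintegral_shortfall_le : mu.-integrable setT (EFin \o lr) ->
  (\int[mu]_x shortfall x <= 2 * Num.sqrt (- \int[mu]_x lr x))%R.
Proof.
move=> ilr; set D := (- _)%R.
have key e : (0 < e)%R -> (\int[mu]_x shortfall x <= (2 * e)^-1 * D + 2 * e)%R.
  move=> e0; have := Rintegral_affine ((2 * e)^-1 + e) (- (2 * e)^-1)
    (e - (2 * e)^-1) integrable_ratio ilr.
  set u := (fun x => _)%R => -[iu uE].
  have /le_trans -> // : (\int[mu]_x shortfall x <= \int[mu]_x u x)%R.
    apply: le_Rintegral => // x _; apply: le_trans (max_sub_expR_le _ e0) _.
    by rewrite /u le_eqVlt; apply/orP; left; apply/eqP; ring.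
  rewrite uE /D; have ie0 : (0 < (2 * e)^-1)%R by rewrite invr_gt0 mulr_gt0.
  have k0 : (0 <= (2 * e)^-1 + e)%R by rewrite addr_ge0// ltW.
  have := ler_wpM2l k0 Rintegral_ratio_le1; rewrite mulr1.
  by set I := (_ * \int[mu]_x expR _)%R; lra.
have [D0|D0] := ltP 0%R D.
  have s0 : (0 < Num.sqrt D)%R by rewrite sqrtr_gt0.
  have := sqr_sqrtr (ltW D0); set s := Num.sqrt D in s0 * => sE.
  (* The choice [e = s / 2] minimizes [(2 * e)^-1 * D + 2 * e], with value [2 * s]. *)
  apply: le_trans (key (s / 2)%R _) _; first by rewrite divr_gt0.
  rewrite mulrCA divff ?pnatr_eq0// mulr1 -sE expr2 mulKf ?gt_eqF//.
  by lra.
(* For [D <= 0] the square root is 0, and [key] bounds the integral by every positive [e]. *)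
rewrite ler0_sqrtr// mulr0; apply/ler_addgt0Pr => e e0; rewrite add0r.
apply: le_trans (key (e / 2)%R _) _; first by rewrite divr_gt0.
rewrite mulrCA divff ?pnatr_eq0// mulr1 gerDr mulr_ge0_le0// invr_ge0 ltW//.
Qed.

Let Rintegral_sub_Qop_le1 (f : X -> R) d : (forall x, 0 <= f x <= d)%R ->
  measurable_fun setT f -> measurable_fun setT (Q f) ->
  (\int[mu]_x f x - \int[mu]_x Q f x <= d * \int[mu]_x shortfall x)%R.
Proof.
move=> fd mf mQf; have f0 x : (0 <= f x)%R by have /andP[] := fd x.
have d0 : (0 <= d)%R by have /andP[/le_trans] := fd point; apply.
have Qd x : (0 <= Q f x <= d)%R.
  by rewrite (Qop_ge0 G h_bounds hL x fd) (Qop_le G h_bounds hL x fd).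
have iQf := ge0_bounded_integrable mu mQf Qd.
have if_ := ge0_bounded_integrable mu mf fd.
pose g x : R := (expR (lr x) * f x)%R.
have ig : mu.-integrable setT (EFin \o g).
  apply: (le_integrable measurableT (g := fun x => d%:E * (expR (lr x))%:E)).
  - by apply/measurable_EFinP; exact: measurable_funM.
  - move=> x _; rewrite /= lee_fin /g !normrM !ger0_norm ?expR_ge0// mulrC.
    by rewrite ler_wpM2r ?expR_ge0//; have /andP[] := fd x.
  exact: integrableZl integrable_ratio.
have gQ : (\int[mu]_x g x <= \int[mu]_x Q f x)%R.
  rewrite /Rintegral fine_le//.
  - exact: integrable_fin_num ig.
  - exact: integrable_fin_num iQf.
  exact: integral_ratio_le fd mf.
have : (\int[mu]_x f x <= \int[mu]_x (1 * g x + d * shortfall x + 0))%R.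
  have [i1 _] := Rintegral_affine 1 d 0 ig ishortfall.
  apply: le_Rintegral => // x _; rewrite addr0 mul1r /g -lerBlDl.
  rewrite -{1}[f x]mul1r -mulrBl mulrC; have /andP[_ fxd] := fd x.
  apply: le_trans (ler_wpM2l (f0 x) (_ : _ <= shortfall x)%R) _.
    by rewrite /shortfall le_max lexx orbT.
  by apply: ler_wpM2r => //; have /andP[] := shortfall_bounds x.
by rewrite (Rintegral_affine 1 d 0 ig ishortfall).2; lra.
Qed.

Lemma Rintegral_sub_Qop_le (f : X -> R) (a d : R) :
  (0 <= a)%R -> (forall x, a <= f x <= a + d)%R ->
  measurable_fun setT f -> measurable_fun setT (Q f) ->
  mu.-integrable setT (EFin \o lr) ->
  (`|\int[mu]_x f x - \int[mu]_x Q f x| <= d * (2 * Num.sqrt (- \int[mu]_x lr x)))%R.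
Proof.
move=> a0 fa mf mQf ilr.
have d0 : (0 <= d)%R.
  by rewrite -(lerD2l a) addr0; have /andP[/le_trans] := fa point; apply.
apply: (@le_trans _ _ (d * \int[mu]_x shortfall x)%R); last first.
  by apply: ler_wpM2l => //; exact: Rintegral_shortfall_le.
pose u x : R := (f x - a)%R.
have ud x : (0 <= u x <= d)%R.
  by have /andP[? ?] := fa x; rewrite /u subr_ge0 lerBlDl; apply/andP.
(* The one-sided bound for [u] and for its reflection [d - u] gives both signs; subtracting [a]
   first makes the constant the oscillation and not the supremum. *)
have vd x : (0 <= d - u x <= d)%R.
  by have /andP[? ?] := ud x; apply/andP; split; lra.
have fE : f = fun x => (a + 1 * u x)%R by apply/funext => x; rewrite /u; ring.
have QfE x : Q u x = (Q f x - a)%R.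
  have -> : Q f x = (a + 1 * Q u x)%R.
    by rewrite {1}fE (QopDZ G h_bounds hL x a0 ler01 ud).
  by ring.
have QvE x : Q (fun z => d - u z)%R x = (d - Q u x)%R.
  exact: (QopB G h_bounds hL x ud).
have mu_ : measurable_fun setT u by exact: measurable_funB.
have mQu : measurable_fun setT (Q u).
  by have -> := funext QfE; exact: measurable_funB.
have mv : measurable_fun setT (fun z => d - u z)%R by exact: measurable_funB.
have mQv : measurable_fun setT (Q (fun z => d - u z)%R).
  by have -> := funext QvE; exact: measurable_funB.
have iu := ge0_bounded_integrable mu mu_ ud.
have Qud x : (0 <= Q u x <= d)%R.
  by rewrite (Qop_ge0 G h_bounds hL x ud) (Qop_le G h_bounds hL x ud).
have iQu := ge0_bounded_integrable mu mQu Qud.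
have := Rintegral_sub_Qop_le1 ud mu_ mQu.
have := Rintegral_sub_Qop_le1 vd mv mQv.
have icst c : mu.-integrable setT (EFin \o (fun=> c)).
  exact: finite_measure_integrable_cst.
under [X in (_ - X <= _)%R -> _]eq_Rintegral do rewrite QvE.
have -> : (\int[mu]_x f x = a + \int[mu]_x u x)%R.
  by rewrite fE; under eq_Rintegral do rewrite mul1r; rewrite RintegralD// Rintegral_probability_cst.
have -> : (\int[mu]_x Q f x = a + \int[mu]_x Q u x)%R.
  rewrite (_ : Q f = fun x => a + Q u x)%R; last by apply/funext => x; rewrite QfE; ring.
  by rewrite RintegralD// Rintegral_probability_cst.
rewrite (RintegralB measurableT (icst d) iu) (RintegralB measurableT (icst d) iQu).
rewrite !Rintegral_probability_cst => h1 h2.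
by rewrite ler_norml; apply/andP; split; lra.
Qed.

End entropy.

(** The majorant makes the positive part integrable, so only the negative part can have an infinite
    integral. This is the dichotomy between finite metric pressure and [-oo]. *)
Lemma integrable_or_integral_Ny d (Y : measurableType d) (R : realType)
    (mu : probability Y R) (f g : Y -> R) : measurable_fun setT f ->
  mu.-integrable setT (EFin \o g) -> (forall x, f x <= g x)%R ->
  mu.-integrable setT (EFin \o f) \/ \int[mu]_x (f x)%:E = -oo.
Proof.
move=> mf ig fg; have mf' : measurable_fun setT (EFin \o f) by exact/measurable_EFinP.
have pfin : \int[mu]_x (EFin \o f)^\+ x < +oo.
  have [mg _] := integrableP _ _ _ (integrable_funepos measurableT ig).
  apply: le_lt_trans (_ : \int[mu]_x (EFin \o g)^\+ x < +oo); last first.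
    by rewrite -ge0_fin_numE ?integral_ge0// integrable_pos_fin_num.
  apply: ge0_le_integral => //; first exact: measurable_funepos.
  move=> x _; rewrite !funeposE /= -!EFin_max lee_fin.
  by rewrite ge_max !le_max fg lexx orbT.
have pge0 : 0 <= \int[mu]_x (EFin \o f)^\+ x by exact: integral_ge0.
have [nfin|ninf] := ltP (\int[mu]_x (EFin \o f)^\- x) +oo; [left|right].
  apply/integrableP; split => //.
  under eq_integral => x _ do rewrite -[`| _ |]/((abse \o (EFin \o f)) x) fune_abse.
  rewrite ge0_integralD//.
  - by rewrite lte_add_pinfty.
  - exact: measurable_funepos.
  - exact: measurable_funeneg.
move: ninf; rewrite leye_eq => /eqP nE; rewrite integralE nE.
by move: pge0 pfin; case: (\int[mu]_x _).
Qed.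

(** * Metric pressure as relative entropy, and summation along the iterates of the Markov
    operator *)

Section pressure.
Context (S : countType) (t : rel S) (X0 : admissible t !=set0) (R : realType).
Local Notation X := (markov_shift X0).
Local Notation T := (@left_shift S t X0).
Local Notation cyl := (@cylinder S t X0).
Local Notation F := (@future_sigma_algebra S t X0).
Implicit Types (x y z : X) (s : S) (w : seq S).
Variable (psi : X -> R) (m : probability X R) (theta A C : R).
Hypothesis G : gibbs_data psi m theta A C.
Local Notation L := (transfer psi).
Local Notation c2 := (upper_bound theta A C).
Variable h : X -> R.
Hypothesis h_bounds : forall x, (c2^-1 <= h x <= c2)%R.
Hypothesis h_log : log_holder theta A (fun x => (h x)%:E).
Hypothesis hL : forall x, L (fun z => (h z)%:E) x = (h x)%:E.
Local Notation Q := (Qop psi h).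
Variables (phi : X -> R) (P : R).
Hypothesis psiE : forall x, psi x = (phi x - P)%R.

(** The integrand of the metric pressure is [P + lr] plus the coboundary of [ln h], which integrates
    to 0. It has an integrable majorant because [lr <= expR lr - 1] and [expR lr] is integrable. *)
Lemma metric_pressure_log_ratio (mu : probability X R) :
  invariant_measure T mu ->
  metric_pressure mu phi = -oo \/
  mu.-integrable setT (EFin \o log_ratio psi h mu) /\
  metric_pressure mu phi = (P + \int[mu]_x log_ratio psi h mu x)%:E.
Proof.
move=> muT; set lr := log_ratio psi h mu; have kP := conditional_measuresP muT.
set k := conditional_measures mu F in kP.
have c20 : (0 < c2)%R := gibbs_upper_bound_gt0 G.
have h0 x : (0 < h x)%R := eigen_gt0 G h_bounds x.
have mT := @measurable_left_shift S t X0.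
have mphi : measurable_fun setT phi.
  rewrite (_ : phi = fun x => psi x + P)%R; last by apply/funext => x; rewrite psiE subrK.
  by apply: measurable_funD => //; exact: gibbs_measurable G.
have mh : measurable_fun setT h.
  exact: measurable_fun_continuous (eigen_continuous G h_bounds h_log).
have mlnh : measurable_fun setT (fun x => ln (h x)).
  exact: (measurableT_comp (@measurable_ln R)).
have mp := measurable_cond_prob kP.
have mlnp : measurable_fun setT (fun x => ln (cond_prob k x)).
  exact: (measurableT_comp (@measurable_ln R)).
pose a x : R := (phi x - ln (cond_prob k x))%R.
have ma : measurable_fun setT a by exact: measurable_funB.
have pressE : metric_pressure mu phi = \int[mu]_x (a x)%:E.
  (* [lne 0 = -oo] makes the information infinite where the conditional probability is 0; that set
     is negligible by [cond_prob_gt0]. *)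
  have infoE x : information mu x + (phi x)%:E =
      if (cond_prob k x <= 0)%R then +oo else (a x)%:E.
    rewrite /information -/k /a /cond_prob.
    have : k x (cyl [:: state_at x 0]) \is a fin_num.
      by apply: fin_num_measure; exact: measurable_cylinder.
    move=> /fineK <- /=; case: ifP => _ //=.
    by rewrite addrC.
  rewrite /metric_pressure; apply: ae_eq_integral => //.
  - under eq_fun do rewrite infoE.
    apply: measurable_fun_ifT => //; first exact: measurable_fun_ler.
    exact/measurable_EFinP.
  - exact/measurable_EFinP.
  apply: filterS (cond_prob_gt0 kP) => x p0 _.
  by rewrite infoE leNgt p0.
pose w x : R := (ln (h (T x)) - ln (h x))%R.
have aE x : a x = (P + lr x + w x)%R.
  by rewrite /a /w /lr /log_ratio psiE; ring.
pose b := `|ln c2|%R.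
have hb x : (`|ln (h x)| <= b)%R.
  have /andP[h1 h2] := h_bounds x; rewrite ler_norml; apply/andP; split.
    have : (ln c2^-1 <= ln (h x))%R by rewrite ler_ln ?posrE ?invr_gt0.
    by rewrite lnV ?posrE//; apply: le_trans; rewrite lerN2 ler_norm.
  by apply: le_trans (ler_norm _); rewrite ler_ln ?posrE.
have ilnh := bounded_integrable mu mlnh hb.
have ilnhT : mu.-integrable setT (EFin \o (fun x => ln (h (T x)))).
  by apply: (@bounded_integrable _ _ _ _ _ b) => //; exact: (measurableT_comp mlnh mT).
have iw : mu.-integrable setT (EFin \o w).
  by apply: eq_integrable (integrableB measurableT ilnhT ilnh).
have w0 : (\int[mu]_x w x = 0)%R.
  by rewrite RintegralB// (Rintegral_shift muT mlnh hb) subrr.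
have ir : mu.-integrable setT (EFin \o (fun x => expR (lr x))).
  exact: (integrable_ratio G h_bounds h_log hL muT).
have [ig gE] := Rintegral_affine 1 1 P ir iw.
have alr x : (a x <= 1 * expR (lr x) + 1 * w x + P)%R.
  by rewrite aE; have := expR_ge1Dx (lr x); lra.
rewrite pressE; have [ia|->] := integrable_or_integral_Ny ma ig alr; [right|by left].
have [ilr lrE] := Rintegral_affine 1 (-1) (- P) ia iw.
have lrE' : (fun x => 1 * a x + -1 * w x - P)%R = lr.
  by apply/funext => x; rewrite aE; ring.
rewrite lrE' in ilr lrE; split => //.
have -> : \int[mu]_x (a x)%:E = (\int[mu]_x a x)%:E.
  by rewrite /Rintegral fineK//; exact: integrable_fin_num ia.
by congr (_%:E); rewrite lrE w0; ring.
Qed.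

Theorem Rintegral_sub_le_deficit : exists2 K0 : R, (0 < K0)%R &
  forall mu : probability X R, invariant_measure T mu ->
  metric_pressure mu phi = -oo \/
  exists D : R, metric_pressure mu phi = (P - D)%:E /\
  forall f b l, (forall z, 0 <= f z <= b)%R -> (0 <= l)%R -> lip_le theta f l ->
  (`|\int[m]_x f x - \int[mu]_x f x| <= K0 * (b + l) * Num.sqrt D)%R.
Proof.
have [K [rho [K0 r01 HK]]] := Qop_equidistribution G h_bounds h_log hL.
have /andP[r0 r1] := r01; have r1' : (0 < 1 - rho)%R by rewrite subr_gt0.
(* Passing from the [n]-th iterate to the next costs [2 * K * (b + l) * rho ^+ n] times the square
   root, and [1 / (1 - rho)] sums the series. *)
exists (K * 2 / (1 - rho))%R; first by rewrite divr_gt0// mulr_gt0.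
move=> mu muT; have [->|[ilr ->]] := metric_pressure_log_ratio muT; [by left|right].
set lr := log_ratio psi h mu in ilr *.
exists (- \int[mu]_x lr x)%R; rewrite opprK; split => // f b l fb l0 fl.
set D := (- \int[mu]_x lr x)%R; have b0 : (0 <= b)%R by have /andP[/le_trans] := fb point; apply.
have bl0 : (0 <= K * (b + l))%R by rewrite mulr_ge0 ?addr_ge0// ltW.
have s0 : (0 <= Num.sqrt D)%R by exact: sqrtr_ge0.
have fnb n x := iter_Qop_bounds G h_bounds hL n x fb.
have mfn n : measurable_fun setT (iter n Q f).
  have [l' l'0 Ql] := iter_Qop_lip G h_bounds h_log hL n fb l0 fl.
  exact: measurable_fun_continuous (lip_le_continuous G l'0 Ql).
pose I n : R := (\int[mu]_x iter n Q f x)%R.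
have step n : (`|I n - I n.+1| <= K * (b + l) * rho ^+ n * (2 * Num.sqrt D))%R.
  have [osc _] := HK f b l fb l0 fl n.
  have fn0 x : (0 <= iter n Q f x)%R by have /andP[] := fnb n x.
  have [a a0 fa] := osc_le_bounds fn0 osc.
  exact: (Rintegral_sub_Qop_le G h_bounds h_log hL muT a0 fa (mfn n) (mfn n.+1) ilr).
pose M : R := (K * 2 / (1 - rho) * (b + l) * Num.sqrt D)%R.
have ME : (M * (1 - rho) = K * (b + l) * (2 * Num.sqrt D))%R.
  by rewrite /M; field; rewrite gt_eqF.
have M0 : (0 <= M)%R.
  by rewrite -(pmulr_lge0 _ r1') ME; apply: mulr_ge0 => //; exact: mulr_ge0.
have tele n : (`|I 0%N - I n| <= M * (1 - rho ^+ n))%R.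
  elim: n => [|n IHn]; first by rewrite expr0 !subrr mulr0 normr0.
  rewrite (_ : I 0%N - I n.+1 = (I 0%N - I n) + (I n - I n.+1))%R; last by ring.
  apply: le_trans (ler_normD _ _) _; apply: le_trans (lerD IHn (step n)) _.
  rewrite exprS le_eqVlt; apply/orP; left; apply/eqP.
  rewrite [X in (_ + X)%R](_ : _ = M * (1 - rho) * rho ^+ n)%R; first by ring.
  by rewrite ME; ring.
have tail n : (`|\int[m]_x f x - I n| <= K * (b + l) * rho ^+ n)%R.
  have [_ close] := HK f b l fb l0 fl n; set c := (\int[m]_x f x)%R in close *.
  have ifn := ge0_bounded_integrable mu (mfn n) (fnb n).
  have icst c' : mu.-integrable setT (EFin \o (fun=> c')).
    exact: finite_measure_integrable_cst.
  rewrite -(Rintegral_probability_cst mu c) -(Rintegral_probability_cst mu (_ * _)).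
  rewrite -RintegralB//.
  have ic : mu.-integrable setT (EFin \o (fun x => c - iter n Q f x)%R).
    by apply: eq_integrable (integrableB measurableT (icst c) ifn).
  apply: le_trans (le_normr_Rintegral _ _ ) _ => //.
  apply: le_Rintegral => //.
  by apply: eq_integrable (integrable_norm ic).
apply: (@le_of_geometric _ rho _ _ (K * (b + l)) r01) => n.
rewrite (_ : _ - _ = (\int[m]_x f x - I n) - (I 0%N - I n))%R; last by rewrite /I; ring.
apply: le_trans (ler_normB _ _) _; rewrite addrC; apply: lerD => //.
apply: le_trans (tele n) _; rewrite -/M ler_piMr// lerBlDr lerDl exprn_ge0//.
exact: ltW.
Qed.

End pressure.

(** * Gurevich pressure *)

Section gurevich.
Context (S : countType) (t : rel S) (X0 : admissible t !=set0) (R : realType).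
Local Notation X := (markov_shift X0).
Local Notation T := (@left_shift S t X0).
Local Notation cyl := (@cylinder S t X0).
Implicit Types (x y z : X) (s : S) (w : seq S).
Variable (psi : X -> R) (m : probability X R) (theta A C : R).
Hypothesis G : gibbs_data psi m theta A C.
Local Notation L := (transfer psi).
Local Notation c2 := (upper_bound theta A C).

(** Distinct words of equal length have disjoint cylinders. Passing to codes turns the sum over a
    set of points into a series over [nat], where countable additivity applies. *)
Lemma esum_cylinder_word (c : R) n (D : set X) : (0 <= c)%R ->
  set_inj D (word n) ->
  \esum_(x in D) (c%:E * m (cyl (word n x))) =
    c%:E * m (\bigcup_(x in D) cyl (word n x)).
Proof.
move=> c0 inj; pose e x := pickle (word n x).
have e_inj : set_inj D e.
  by move=> x y xD yD /(pcan_inj pickleK_inv); exact: inj.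
pose F i : set X := if @pickle_inv (seq S) i is Some w then cyl w else set0.
have Fe x : F (e x) = cyl (word n x) by rewrite /F /e pickleK_inv.
pose H i : set X := if i \in e @` D then F i else set0.
have mH i : measurable (H i).
  rewrite /H; case: ifP => _ //; rewrite /F.
  by case: (@pickle_inv (seq S) i) => [w|//]; exact: measurable_cylinder.
have HP i x : H i x -> exists2 y, D y & i = e y /\ agree_upto n y x.
  rewrite /H; case: ifPn => // /set_mem[y Dy <-].
  by rewrite Fe => /cylinder_wordE; exists y.
have tH : trivIset setT H.
  apply/trivIsetP => i j _ _; apply: contra_neqP => /eqP/set0P[x [/HP + /HP]].
  move=> [y Dy [-> /agree_wordP xy]] [z Dz [-> /agree_wordP xz]].
  by rewrite /e -xy -xz.
have UH : \bigcup_(x in D) cyl (word n x) = \bigcup_i H i.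
  apply/seteqP; split => [x [y Dy xy]|x [i _ /HP[y Dy [_ xy]]]].
    by exists (e y) => //; rewrite /H ifT ?Fe// inE; exists y.
  by exists y => //; exact/cylinder_wordE.
rewrite UH measure_bigcup// -nneseriesZl//.
rewrite nneseries_esum ?set_mem_set; last by move=> i; rewrite mule_ge0.
transitivity (\esum_(j in e @` D) (c%:E * m (F j))).
  by rewrite esum_image//; apply: eq_esum => x Dx; rewrite Fe.
rewrite esum_mkcond; apply: eq_esum => i _; rewrite /H.
by case: ifP => // _; rewrite measure0 mule0.
Qed.

Definition periodic n s : set X := [set x | iter n T x = x /\ cyl [:: s] x].

(** A point fixed by [iter n T] repeats its first [n] letters. *)
Lemma periodic_inj n s : (0 < n)%N -> set_inj (periodic n s) (word n).
Proof.
move=> n0 x y /set_mem[xT xs] /set_mem[yT ys] xy; apply: state_at_inj.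
have per z i : iter n T z = z -> state_at z i = state_at z (i %% n).
  move=> zT; rewrite {1}(divn_eq i n) addnC.
  elim: (i %/ n)%N => [|k IHk]; first by rewrite addn0.
  by rewrite mulSn addnCA -state_iter_shift zT.
move=> i; rewrite (per x i xT) (per y i yT); have ni : (i %% n < n)%N by rewrite ltn_mod.
by symmetry; apply: (agree_wordP n x y).2 => //.
Qed.

Definition return_set n s : set X := cyl [:: s] `&` iter n T @^-1` cyl [:: s].

(** Repeating the first [n] letters of [x] for ever is admissible because [x_n = s = x_0], and gives
    a periodic point in the same cylinder of length [n]. *)
Lemma return_set_sub n s : (0 < n)%N ->
  return_set n s `<=` \bigcup_(x in periodic n s) cyl (word n x).
Proof.
move=> n0 x [/cylinder1 xs /cylinder1]; rewrite state_iter_shift addn0 => xn.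
have adm : admissible t (fun i => state_at x (i %% n)).
  move=> i /=; have ni : (i %% n < n)%N by rewrite ltn_mod.
  rewrite -addn1 -modnDml addn1; move: (ni); rewrite leq_eqVlt => /orP[/eqP E|].
    by have := state_admissible x (i %% n)%N; rewrite E modnn xs xn.
  by move=> /modn_small ->; exact: state_admissible.
pose y : X := of_states X0 (fun i => state_at x (i %% n)).
have yE i : state_at y i = state_at x (i %% n) by rewrite of_statesK.
exists y; last first.
  by apply/cylinder_wordE/agree_sym => i /modn_small ni; rewrite yE ni.
split; last by apply/cylinder1; rewrite yE mod0n.
by apply: state_at_inj => i; rewrite state_iter_shift !yE modnDl.
Qed.

Lemma measurable_return_set n s : measurable (return_set n s).
Proof.
apply: measurableI; first exact: measurable_cylinder.
by apply: measurable_preimage_iter; exact: measurable_cylinder.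
Qed.

(** The indicator of the return set is [(1_s \o T^n) * 1_s], which [L^n] takes to [1_s * L^n 1_s].
    The minorization bounds this below, and the comparison of [m] with its images brings the bound
    back to the return set. *)
Lemma measure_return_set_ge s : cyl [:: s] !=set0 ->
  exists N, exists2 c : R, (0 < c)%R &
    forall n, (N <= n)%N -> c%:E <= m (return_set n s).
Proof.
move=> s0; have [N [d d0 Hd]] := gibbs_minorization G s0.
have [_ _ _ C1 gl gg _ _] := G; have mpsi := gibbs_measurable G.
have C0 : (0 < C)%R by rewrite (lt_le_trans ltr01).
have c20 := gibbs_upper_bound_gt0 G.
have ms0 : (0 < mass m [:: s])%R by have [x xs] := s0; exact: (mass_gt0 C1 gg xs).
pose f x : \bar R := (\1_(cyl [:: s]) x)%:E.
have f0 x : 0 <= f x by rewrite lee_fin.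
(* The first [N.+1] applications of [L] give the minorization, and the remaining ones the lower
   bound on iterates of the constant 1. *)
have Lf n x : (N.+1 <= n)%N -> (d * c2^-1)%:E <= iter n L f x.
  move=> /subnK <-; set j := (n - N.+1)%N.
  rewrite iterD; apply: (@le_trans _ _ (iter j L (fun=> d%:E * 1) x)).
    rewrite iter_transferZ => [|_]; last by [].
    by rewrite EFinM lee_wpmul2l ?lee_fin ?(ltW d0)// (gibbs_le_transfer_one G).
  apply: le_iter_transfer => z; first by rewrite mule1 lee_fin ltW.
  by rewrite mule1; exact: Hd.
exists N.+1, ((C ^+ 4)^-1 * (d * c2^-1 * mass m [:: s]))%R.
  by rewrite mulr_gt0 ?invr_gt0 ?exprn_gt0// mulr_gt0// mulr_gt0// invr_gt0.
move=> n Nn; pose g w : R := ((nth s w 0 == s) && (nth s w n == s))%:R.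
have gE x : (g (word n.+1 x))%:E = (\1_(cyl [:: s]) (iter n T x))%:E * f x.
  rewrite /f !indicE -EFinM -natrM mulnb /g; congr (_%:R%:E).
  rewrite !nth_mkseq// andbC; congr (_ && _); apply/idP/idP.
  - by move=> /eqP xs; apply: mem_set; apply/cylinder1; rewrite state_iter_shift addn0.
  - by move=> /set_mem/cylinder1; rewrite state_iter_shift addn0 => ->.
  - by move=> /eqP xs; apply: mem_set; exact/cylinder1.
  - by move=> /set_mem/cylinder1 ->.
have mR := measurable_return_set n s.
have gR : \int[m]_x (g (word n.+1 x))%:E = m (return_set n s).
  rewrite -[X in m X]setIT -integral_indic//; apply: eq_integral => x _.
  by rewrite gE /f !indicE -EFinM -natrM mulnb in_setI andbC.
have g0 w : (0 <= g w)%R by [].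
have := integral_transfer_word_le mpsi C1 gl gg (leqnSn n) g0.
rewrite gR (_ : iter n L _ = fun x => (\1_(cyl [:: s]) x)%:E * iter n L f x); last first.
  by rewrite -iter_transfer_shift//; congr (iter n L _); apply/funext.
move=> H; rewrite -lee_pdivrMl in H; last by rewrite exprn_gt0.
rewrite EFinM; apply: le_trans H; rewrite lee_wpmul2l ?lee_fin ?invr_ge0 ?exprn_ge0 ?(ltW C0)//.
rewrite EFinM -massE -[X in m X]setIT -integral_indic//; last exact: measurable_cylinder.
have mf : measurable_fun setT f.
  by apply/measurable_EFinP; apply: measurable_indic; exact: measurable_cylinder.
have k0 : (0 <= d * c2^-1)%R.
  by apply: mulr_ge0; [exact: ltW|rewrite invr_ge0; exact: ltW].
rewrite -ge0_integralZl//.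
apply: ge0_le_integral => //.
- by move=> x _; rewrite mule_ge0.
- exact: emeasurable_funM.
- by apply: emeasurable_funM => //; exact: measurable_iter_transfer.
move=> x _; rewrite muleC lee_wpmul2l//; exact: Lf.
Qed.

Variables (phi : X -> R) (P : R).
Hypothesis psiE : forall x, psi x = (phi x - P)%R.

Lemma birkhoff_subr n x : birkhoff psi n x = (birkhoff phi n x - n%:R * P)%R.
Proof.
rewrite /birkhoff (eq_bigr (fun i : 'I_n => phi (iter i T x) - P)%R) => [|i _].
  by rewrite big_split/= sumrN big_const_ord iter_addr_0 mulr_natl.
exact: psiE.
Qed.

Let Z n s : \bar R := \esum_(x in periodic n s) (expR (birkhoff phi n x))%:E.

Let U n s : set X := \bigcup_(x in periodic n s) cyl (word n x).

Let mU n s : measurable (U n s).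
Proof.
apply: measurable_agree => x [y ys /cylinder_wordE xy]; exists n => z xz.
by exists y => //; apply/cylinder_wordE => i ni; rewrite xz// xy.
Qed.

Let expR_birkhoff n x :
  expR (birkhoff phi n x) = (expR (n%:R * P) * expR (birkhoff psi n x))%R.
Proof. by rewrite -expRD birkhoff_subr; congr expR; ring. Qed.

Let Z_le n s : (0 < n)%N -> Z n s <= (expR (n%:R * P) * C)%:E.
Proof.
move=> n0; have [_ _ _ C1 gl gg _ _] := G.
have k0 : (0 <= expR (n%:R * P) * C)%R by rewrite mulr_ge0 ?expR_ge0// (le_trans ler01).
have D x : periodic n s x -> (expR (birkhoff phi n x))%:E <=
    (expR (n%:R * P) * C)%:E * m (cyl (word n x)).
  move=> _; rewrite massE -EFinM lee_fin expR_birkhoff -mulrA ler_wpM2l ?expR_ge0//.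
  by have := gg _ _ (cylinder_word n x); rewrite size_word.
apply: le_trans (le_esum D) _.
rewrite esum_cylinder_word//; last exact: periodic_inj.
rewrite -[leRHS]mule1 lee_wpmul2l ?lee_fin//; apply: probability_le1.
exact: mU.
Qed.

Let le_Z n s : (0 < n)%N ->
  (expR (n%:R * P) * C^-1)%:E * m (return_set n s) <= Z n s.
Proof.
move=> n0; have [_ _ _ C1 gl gg _ _] := G.
have C0 : (0 < C)%R by rewrite (lt_le_trans ltr01).
have k0 : (0 <= expR (n%:R * P) * C^-1)%R by rewrite mulr_ge0 ?expR_ge0// invr_ge0 ltW.
have D x : periodic n s x ->
    (expR (n%:R * P) * C^-1)%:E * m (cyl (word n x)) <= (expR (birkhoff phi n x))%:E.
  move=> _; rewrite massE -EFinM lee_fin expR_birkhoff -mulrA ler_wpM2l ?expR_ge0//.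
  by rewrite ler_pdivrMl//; have := gl _ _ (cylinder_word n x); rewrite size_word.
apply: le_trans (le_esum D).
rewrite esum_cylinder_word//; last exact: periodic_inj.
rewrite lee_wpmul2l ?lee_fin//; apply: le_measure; rewrite ?inE.
- exact: measurable_return_set.
- exact: mU.
exact: return_set_sub.
Qed.

(** The Gibbs property turns the sum over periodic points into [expR (n%:R * P)] times the measure
    of the union of their cylinders, up to the factor [C]. That measure lies between the measure of
    the return set and 1, and constants vanish in the limit. *)
Theorem gurevich_pressure_gibbs s : cyl [:: s] !=set0 ->
  gurevich_pressure phi s = P%:E.
Proof.
move=> s0; have [N [c c0 Hc]] := measure_return_set_ge s0.
have [_ _ _ C1 _ _ _ _] := G; have C0 : (0 < C)%R by rewrite (lt_le_trans ltr01).
apply/cvg_lim => //.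
have lim0 (a : R) : (n%:R^-1 * a + P)%:E @[n --> \oo] --> P%:E.
  apply: cvg_EFin; first by exact: nearW.
  rewrite -[X in _ --> X]add0r -(mul0r a); apply: cvgD; last exact: cvg_cst.
  apply: cvgM; last exact: cvg_cst.
  apply/gtr0_cvgV0; last exact: cvgr_idn.
  by exists 1%N => // n /=; rewrite ltr0n.
apply: squeeze_cvge (lim0 (ln (C^-1 * c))%R) (lim0 (ln C)).
near=> n; have n0 : (0 < n)%N by near: n; exists 1%N.
have nN : (N <= n)%N by near: n; exists N.
have n0' : (0 < n%:R^-1 :> R)%R by rewrite invr_gt0 ltr0n.
have lnE b : (0 < b)%R -> (n%:R^-1 * ln b + P)%:E =
    (n%:R^-1)%:E * lne (expR (n%:R * P) * b)%:E.
  move=> b0; rewrite lne_EFin ?mulr_gt0 ?expR_gt0// lnM ?posrE ?expR_gt0// expRK.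
  by rewrite -EFinM; congr (_%:E); field; rewrite pnatr_eq0 -lt0n.
have Zlow : (expR (n%:R * P) * (C^-1 * c))%:E <= Z n s.
  apply: le_trans (le_Z s n0); rewrite mulrA [leLHS]EFinM lee_wpmul2l ?Hc//.
  by rewrite lee_fin mulr_ge0 ?expR_ge0// invr_ge0 ltW.
have Z0 : 0 < Z n s.
  by apply: lt_le_trans Zlow; rewrite lte_fin mulr_gt0 ?expR_gt0// mulr_gt0// invr_gt0.
have Cc0 : (0 < C^-1 * c)%R by rewrite mulr_gt0// invr_gt0.
rewrite !lnE// !lee_pmul2l// !lee_lne ?in_itv/= ?leey ?Zlow ?Z_le//.
- by rewrite andbT ltW.
- by rewrite lee_fin mulr_ge0 ?expR_ge0// ltW.
- by rewrite lee_fin mulr_ge0 ?expR_ge0// ltW.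
- by rewrite ltW.
Unshelve. all: end_near.
Qed.

End gurevich.

(** * Normalization of the data and the final estimate *)

Section normalization.
Context (S : countType) (t : rel S) (X0 : admissible t !=set0) (R : realType).
Local Notation X := (markov_shift X0).
Local Notation T := (@left_shift S t X0).
Local Notation cyl := (@cylinder S t X0).
Implicit Types (x y z : X) (s : S) (w : seq S).

Lemma exists_gibbs_data (theta : R) (phi : X -> R) (m : probability X R) :
  (0 < theta < 1)%R -> topologically_mixing T -> locally_holder theta phi ->
  gibbs_measure phi m ->
  exists P A C : R, gibbs_data (fun x => phi x - P)%R m theta A C.
Proof.
move=> th mix [A A0 HA] [inv [C [P [C0 HC]]]]; exists P, A, C.
have mass_bounds (a : seq S) x : a != [::] -> cyl a x ->
    (C^-1 <= mass m a / expR (birkhoff (fun z => phi z - P) (size a) x) <= C)%R.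
  move=> a0 ax; have := HC a x a0 ax; rewrite massE -EFinM !lee_fin.
  by rewrite (birkhoff_subr (phi := phi) (P := P) (fun=> erefl)).
(* Any nonempty one-letter cylinder gives [C^-1 <= C]. *)
have C1 : (1 <= C)%R.
  have := @mass_bounds [:: state_at (point : X) 0] point isT ((cylinder1 _ _).2 erefl).
  move=> /andP[/le_trans h /h]; rewrite -div1r ler_pdivrMr// => CC.
  by rewrite leNgt; apply/negP => C1; move: CC; apply/negP; rewrite -ltNge mulr_ilt1// ltW.
have nilE x : birkhoff (fun z => phi z - P)%R 0 x = 0%R by rewrite /birkhoff big_ord0.
have mass_nil : mass m [::] = 1%R.
  rewrite /mass (_ : cyl [::] = setT) ?probability_setT//.
  by apply/seteqP.
split => //.
- exact: ltW.
- move=> k x y k0 xy; have : (phi x - phi y <= A * theta ^+ k)%R.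
    rewrite -lee_fin; apply: le_trans (HA k k0).
    by apply: ereal_sup_ubound; exists (x, y).
  by lra.
- move=> a x ax; have [->|a0] := eqVneq a [::].
    by rewrite mass_nil nilE expR0 mulr1.
  have /andP[_] := mass_bounds a x a0 ax.
  by rewrite ler_pdivrMr ?expR_gt0.
- move=> a x ax; have [->|a0] := eqVneq a [::].
    by rewrite mass_nil nilE expR0 mulr1.
  have /andP[+ _] := mass_bounds a x a0 ax.
  by rewrite ler_pdivlMr ?expR_gt0// ler_pdivrMl.
Qed.

Lemma L_spaceP (theta : R) (f : X -> R) : (0 < theta < 1)%R -> L_space theta f ->
  exists M l : R, [/\ L_norm theta f = (M + l)%:E, (0 <= l)%R,
    forall x, (`|f x| <= M)%R & lip_le theta f l].
Proof.
move=> /andP[th0 th1] [cf Lfin].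
have s0 : 0 <= sup_norm f.
  apply: le_trans (_ : `|f point|%:E <= _); first by rewrite lee_fin.
  by apply: ereal_sup_ubound; exists point.
have t0 : 0 <= theta_seminorm theta f by rewrite /theta_seminorm le_max lexx.
have sfin : sup_norm f \is a fin_num.
  by rewrite ge0_fin_numE//; apply: le_lt_trans Lfin; rewrite leeDr.
have tfin : theta_seminorm theta f \is a fin_num.
  by rewrite ge0_fin_numE//; apply: le_lt_trans Lfin; rewrite leeDl.
exists (fine (sup_norm f)), (fine (theta_seminorm theta f)); split.
- by rewrite EFinD !fineK// addeC.
- exact: fine_ge0.
- move=> x; rewrite -lee_fin fineK//; apply: ereal_sup_ubound.
  by exists x.
move=> k x y k0 xy; have l0 := fine_ge0 t0; set l := fine _ in l0 *.
have thk : (0 <= theta ^+ k)%R by rewrite exprn_ge0// ltW.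
have [->|/eqP xny] := eqVneq x y; first by rewrite lerDl mulr_ge0.
have : (`|f x - f y| / shift_dist theta x y <= l)%R.
  rewrite -lee_fin fineK//; apply: le_trans (_ : _ <= ereal_sup _) _; last first.
    by rewrite /theta_seminorm le_max; apply/orP; right; exact: lexx.
  by apply: ereal_sup_ubound; exists (x, y) => //=; split => //; rewrite xy.
rewrite /shift_dist; case: pselect => [h|h]; last first.
  case: xny; apply: state_at_inj => i; apply/eqP/negPn/negP => xyi.
  by apply: h; exists i.
(* The first difference [j] is at least [k], so the distance of [x] and [y] is at most
   [theta ^+ k]. *)
case: ex_minnP => j xyj _; rewrite ler_pdivrMr ?exprn_gt0// => H.
rewrite -lerBlDl; apply: le_trans (ler_norm _) _; apply: le_trans H _.
rewrite ler_wpM2l//; apply: ler_wiXn2l; [exact: ltW|exact: ltW|].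
by rewrite leqNgt; apply: contra xyj => /xy ->.
Qed.

End normalization.

Theorem theorem1p1 (R : realType) (S : countType) (t : rel S)
    (X0 : admissible t !=set0) (theta : R)
    (phi : markov_shift X0 -> R) (m : probability (markov_shift X0) R) :
  (0 < theta < 1)%R ->
  topologically_mixing (@left_shift S t X0) ->
  locally_holder theta phi ->
  gibbs_measure phi m ->
  exists2 a : R, (0 < a)%R &
    forall s : S, @cylinder S t X0 [:: s] !=set0 ->
    forall mu : probability (markov_shift X0) R,
      invariant_measure (@left_shift S t X0) mu ->
    forall f : markov_shift X0 -> R, L_space theta f ->
      `| \int[m]_x (f x)%:E - \int[mu]_x (f x)%:E | <=
        a%:E * L_norm theta f *
          sqrte (gurevich_pressure phi s - metric_pressure mu phi).
Proof.
move=> th mix hol gib.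
have [P [A [C G]]] := exists_gibbs_data th mix hol gib.
have [h [h_bounds h_log hL]] := exists_eigenfunction G.
have psiE x : (phi x - P)%R = (phi x - P)%R by [].
have [K K0 HK] := Rintegral_sub_le_deficit G h_bounds h_log hL psiE.
(* The factor 2 comes from translating [f], with values between [- M] and [M], to the nonnegative
   function [g] bounded by [2 * M]. *)
exists (2 * K)%R; first by rewrite mulr_gt0.
move=> s s0 mu muT f fL; have [cf _] := fL.
have [M [l [-> l0 fM fl]]] := L_spaceP th fL.
have mf : measurable_fun setT f by exact: measurable_fun_continuous.
have M0 : (0 <= M)%R := le_trans (normr_ge0 _) (fM point).
have intE (nu : probability (markov_shift X0) R) :
    \int[nu]_x (f x)%:E = (\int[nu]_x f x)%:E.
  by rewrite /Rintegral fineK//; apply: integrable_fin_num (bounded_integrable nu mf fM).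
rewrite (gurevich_pressure_gibbs G psiE s0) !intE.
have [->|[D [-> HD]]] := HK mu muT.
  (* The right-hand side is then infinite unless the norm of [f] is 0; in that case [f] vanishes and
     both sides are compared with 0. *)
  have -> : sqrte (P%:E - -oo) = +oo by [].
  have [Ml|Ml] := ltP 0%R (M + l)%R.
    by rewrite gt0_muley ?leey// -EFinM lte_fin mulr_gt0// mulr_gt0.
  have f0 x : f x = 0%R.
    by apply/eqP; rewrite -normr_le0; apply: le_trans (fM x) _; apply: le_trans Ml; rewrite lerDl.
  have -> : f = fun=> 0%R by apply/funext.
  rewrite !Rintegral_probability_cst subee// abse0 mule_ge0// mule_ge0 ?lee_fin ?addr_ge0//.
  by rewrite mulr_ge0 ?ltW.
have -> : P%:E - (P - D)%:E = D%:E by rewrite -EFinB; congr (_%:E); ring.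
pose g x : R := (M + f x)%R.
have gM x : (0 <= g x <= 2 * M)%R.
  by have := fM x; rewrite ler_norml /g => /andP[? ?]; apply/andP; split; lra.
have gl : lip_le theta g l by move=> k x y k0 xy; rewrite /g -addrA lerD2l; exact: fl.
have gE (nu : probability (markov_shift X0) R) :
    (\int[nu]_x g x = M + \int[nu]_x f x)%R.
  rewrite RintegralD ?Rintegral_probability_cst//.
    exact: finite_measure_integrable_cst.
  exact: bounded_integrable fM.
have := HD g _ l gM l0 gl; rewrite !gE opprD addrACA subrr add0r => /le_trans H.
rewrite -EFinB -!EFinM lee_fin; apply: H; rewrite ler_wpM2r ?sqrtr_ge0//.
by have := mulr_ge0 (ltW K0) l0; nra.
Qed.
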